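(* Let $\mathbf n=(n_1,n_2,\dots)$ be a sequence of non-negative integers with finitely many non-zero entries satisfying $\sum_{i\ge1}(i-2)n_i=-2$. Write $n+1=\sum_i n_i$ and assume $n\ge2$. The cyclic group of order $2n-n_1$ acts on $\mathrm{T}_i(\mathbf n)$ by the internal rotation $R_i$, and the triple \[\left(\mathrm{T}_i(\mathbf n),\ \langle R_i\rangle,\ \frac{[2n-n_1]_q}{[n+1]_q\,[n]_q}\begin{bmatrix}n+1\\ n_1,n_2,\dots\end{bmatrix}_q\right)\] exhibits the cyclic sieving phenomenon.
   Context: Rooted plane trees: a plane tree is a finite tree with a counterclockwise cyclic order of the half-edges around each node, up to isomorphism (orientation-preserving homeomorphism). A corner is a sector between two consecutive half-edges around a node (a node of degree $k\ge1$ has $k$ corners). A rooted plane tree is a plane tree with one distinguished corner, the root corner. A leaf is a node of degree $1$. $\mathrm{T}_i(\mathbf n)$ (here the index $i$ is a fixed symbol standing for ''internally rooted'') is the set of rooted plane trees having exactly $n_j$ nodes of degree $j$ (graph degree) for each $j\ge1$ and whose root corner is incident to a non-leaf. Corners are visited in counterclockwise order around the tree as follows: identify a corner with the half-edge $h$ that follows it counterclockwise around its node; if $\alpha(h)$ is the other half of the same edge and $\sigma(h')$ is the half-edge following $h'$ counterclockwise around its node, then the corner after $h$ is $\sigma(\alpha(h))$. The internal rotation $R_i$ acts on trees rooted at a non-leaf by moving the root corner to the next corner incident to a non-leaf in this order. There are $2n-n_1$ such corners, so $R_i^{2n-n_1}=\mathrm{id}$ on $\mathrm{T}_i(\mathbf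 n)$, and the cyclic group of order $2n-n_1$ acts with its generator acting as $R_i$ (the action need not be faithful). $q$-notation: $[M]_q=\frac{1-q^M}{1-q}$, $[M]_q!=[1]_q\cdots[M]_q$, $[0]_q!=1$; for non-negative integers $N_1,N_2,\dots$ with $\sum_iN_i=M$, $\begin{bmatrix}M\\ N_1,N_2,\dots\end{bmatrix}_q=\frac{[M]_q!}{\prod_{i\ge1}[N_i]_q!}$. Cyclic sieving phenomenon: given a finite set $S$, an action on $S$ of a cyclic group $G$ of order $m$ with generator $g$, and a polynomial $P(q)$ with non-negative integer coefficients, the triple $(S,G,P)$ exhibits the cyclic sieving phenomenon if the number of elements of $S$ fixed by $g^e$ equals $P(\omega^e)$ for all primitive $m$-th roots of unity $\omega$ and all integers $e$. (Part of the assertion is that the given $P$ is a polynomial with non-negative integer coefficients.) *)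

(* Defs.v *)
From HB Require Import structures.
From mathcomp Require Import all_boot all_order all_algebra all_fingroup.
From mathcomp Require Import all_solvable.
(* for `[< P >], the boolean reflecting the proposition P *)
From mathcomp Require Import boolp.

Set Implicit Arguments.
Unset Strict Implicit.
Unset Printing Implicit Defensive.

Import Order.TTheory GRing.Theory Num.Theory.
Local Open Scope ring_scope.

Section HalfEdges.

Variable D : finType.
Implicit Types (x y : {perm D} * {perm D} * D) (h k : D).

(* A rooted plane graph with half-edge set D, given by (sigma, alpha, r):
   sigma h is the half-edge following h counterclockwise around its node,
   alpha h is the other half of the edge of h, and the corner just before the
   half-edge h (counterclockwise) is identified with h; r is the root corner.
   A single node without edges is not representable. *)
Definition rooted_map : finType := ({perm D} * {perm D} * D)%type.

Definition sigma x : {perm D} := x.1.1.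
Definition alpha x : {perm D} := x.1.2.
Definition root_corner x : D := x.2.

Definition node x h : {set D} := porbit (sigma x) h.
Definition edge x h : {set D} := porbit (alpha x) h.
Definition degree x h : nat := #|node x h|.
Definition leaf x h : bool := degree x h == 1%N.

Definition nb_nodes_of_degree x (j : nat) : nat :=
  #|[set v in porbits (sigma x) | #|v| == j]|.

Definition edge_involution x : Prop :=
  forall h, alpha x h <> h /\ alpha x (alpha x h) = h.

Definition connected_graph x : Prop :=
  forall h k, connect (fun a b => (b \in node x a) || (b == alpha x a)) h k.

(* The half-edges of c are the starting halves of the successive edges of a
   closed walk; nodes and edges are visited at most once (so a loop is a cycle
   of length 1, a double edge a cycle of length 2). *)
Definition graph_cycle x (c : seq D) : bool :=
  [&& c != [::], path.cycle (fun h k => alpha x h \in node x k) c,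
      uniq [seq node x h | h <- c] & uniq [seq edge x h | h <- c]].

Definition rooted_plane_tree x : Prop :=
  [/\ edge_involution x, connected_graph x & forall c, ~~ graph_cycle x c].

Definition rooted_iso x y : Prop :=
  exists f : {perm D},
    [/\ forall h, sigma y (f h) = f (sigma x h),
        forall h, alpha y (f h) = f (alpha x h)
      & root_corner y = f (root_corner x)].

Definition iso_class x : {set rooted_map} := [set y | `[< rooted_iso x y >]].

Definition internally_rooted_tree (d : nat -> nat) x : Prop :=
  [/\ rooted_plane_tree x,
      forall j, (1 <= j)%N -> nb_nodes_of_degree x j = d j
    & ~~ leaf x (root_corner x)].

Definition next_corner x h : D := sigma x (alpha x h).

(* [fingraph.orbit f h'] lists h', f h', f (f h'), ... until just before the
   first return to h'; for h' = f h with f injective, h comes last. The default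
   value of head is not used when h itself is not at a leaf. *)
Definition next_internal_corner x h : D :=
  head h [seq k <- fingraph.orbit (next_corner x) (next_corner x h)
         | ~~ leaf x k].

Definition rotate_map x : rooted_map :=
  (sigma x, alpha x, next_internal_corner x (root_corner x)).

(* The rotation commutes with isomorphisms, so that the image of an
   isomorphism class is the isomorphism class of the rotated tree. *)
Definition internal_rotation (X : {set rooted_map}) : {set rooted_map} :=
  rotate_map @: X.

End HalfEdges.

(* A plane tree with n edges has 2n half-edges, so that up to isomorphism they
   may be labelled by 'I_(2 * n); elements are isomorphism classes. *)
Definition Ti (n : nat) (d : nat -> nat) : {set {set rooted_map 'I_(2 * n)}} :=
  [set iso_class x | x in [set x | `[< internally_rooted_tree d x >]]].

Section QAnalogues.

Variables (F : fieldType) (q : F).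

Definition qint (M : nat) : F := (1 - q ^+ M) / (1 - q).

Definition qfact (M : nat) : F := \prod_(1 <= i < M.+1) qint i.

(* d 1, d 2, ..., with d i = 0 for i > N. *)
Definition qmultinomial (M N : nat) (d : nat -> nat) : F :=
  qfact M / \prod_(1 <= i < N.+1) qfact (d i).

End QAnalogues.

(* Elements of the field of fractions of Z[q]; q is the indeterminate. *)
Definition qvar : {fraction {poly int}} := tofrac 'X.

Definition expgz (gT : finGroupType) (g : gT) (e : int) : gT :=
  match e with
  | Posz k => (g ^+ k)%g
  | Negz k => (g ^- k.+1)%g
  end.

Definition cyclic_sieving (C : numClosedFieldType) (gT : finGroupType)
    (G : {group gT}) (g : gT) (T : finType) (to : action G T) (S : {set T})
    (P : {poly int}) : Prop :=
  [/\ generator G g,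
      [acts G, on S | to],
      forall i : nat, 0 <= P`_i
    & forall (w : C) (e : int), #|G|.-primitive_root w ->
        #|('Fix_(S | to)[expgz g e])%g|%:R = (map_poly intr P).[w ^ e]].

(* Main.v *)
(* Rooting kills automorphisms, so a tree class fixed by the e-th power of the
   rotation is a corner orbit of a plane tree having an automorphism of order
   k = m / gcd(m, e), m being the number of internal corners. Such an
   automorphism fixes exactly one node, or flips exactly one edge (then k = 2),
   unless it is trivial. The quotient of the tree is again a tree, with one
   marked node or with one half-edge glued to itself, and the labelled quotients
   are counted by contracting edges: matchings of prescribed blocks of half-edges
   that form a tree with p + 2 nodes number p! times the product of the degrees.
   Every quotient lifts in a number of ways depending only on k, which gives the
   number of fixed points as m ((n - 1) / k)! / (k prod_i (d_i / k)!), or 0 when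
   the degrees do not allow a centre; this is also the value at a primitive k-th
   root of unity of [m] [n-1]! / prod_i [d_i]!, read off its cyclotomic
   factorization.

   For the signs of the coefficients, put K = n + 1 - d_1, so that
   [m] = [n] + q^n [K - 1]. This writes (1 - q^(n+1)) (1 - q^K) times the
   polynomial as a combination of (1 - q) A and q^n (1 - q) Q with A and Q
   products of Gaussian binomials. These are unimodal, so the low coefficients
   of (1 - q) A and (1 - q) Q are nonnegative, hence also those of the
   polynomial itself; it is palindromic, which settles the other ones. *)
Require Import Defs.
From mathcomp Require Import all_boot all_order all_algebra all_fingroup.
From mathcomp Require Import all_solvable all_field.
From mathcomp Require Import boolp zify ring.

Set Implicit Arguments.
Unset Strict Implicit.
Unset Printing Implicit Defensive.

Import Order.TTheory GRing.Theory Num.Theory.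

Local Open Scope ring_scope.

(** * The sieving polynomial and its values at roots of unity *)

(** Contraction of edges counts matchings of labelled half-edges, whereas the sieving set consists
    of isomorphism classes. Every count is therefore made on labelled objects over [D] and compared
    through free actions: a rooted map has no automorphism, so each class has as many members as [D]
    has permutations. An unrooted tree may have several automorphisms of the same order; to count
    the pair (s, a) once, a single one is selected, the one that turns the central node by the
    smallest angle (for order at most 2 there is only one). Its quotient is recorded in coordinates,
    nodes with k sheets above them, the central node being the only one around which the sheets are
    permuted. Connectivity is stated by two-colourings constant along edges, which pass to
    contractions and quotients without any handling of paths; acyclicity is replaced by the excess
    of nodes over edges. The polynomial is defined by its cyclotomic exponents instead of by a
    division: these are natural numbers because the denominator can exceed [n-1]! in ['Phi_k] only
    if the degrees allow a centre, and then k divides m. *)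

Definition qpoly (M : nat) : {poly int} := \sum_(i < M) 'X^i.
Definition qfactp (M : nat) : {poly int} := \prod_(1 <= i < M.+1) qpoly i.

Lemma qpolyE M : ('X - 1) * qpoly M = 'X^M - 1.
Proof. by rewrite subrX1. Qed.

Lemma size_qpoly M : size (qpoly M) = M.
Proof.
case: M => [|M]; first by rewrite /qpoly big_ord0 size_poly0.
have q0 : qpoly M.+1 != 0.
  apply/eqP=> q0; have := qpolyE M.+1; rewrite q0 mulr0 => /esym/eqP.
  by rewrite -size_poly_eq0 size_XnsubC.
have : size (('X - 1%:P) * qpoly M.+1) = M.+2 by rewrite qpolyE size_XnsubC.
by rewrite size_monicM ?monicXsubC ?size_XsubC //= => -[].
Qed.

Lemma qpoly_neq0 M : (0 < M)%N -> qpoly M != 0.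
Proof. by rewrite -size_poly_gt0 size_qpoly. Qed.

Lemma qfactp_neq0 M : qfactp M != 0.
Proof.
rewrite /qfactp big_nat; apply: (big_ind (fun p => p != 0)) => [|p q p0 q0|i /andP[i0 _]].
- exact: oner_neq0.
- by rewrite mulf_neq0.
exact: qpoly_neq0.
Qed.

Lemma qfactpS M : qfactp M.+1 = qfactp M * qpoly M.+1.
Proof. by rewrite /qfactp big_nat_recr. Qed.

Lemma qfactp0 : qfactp 0 = 1.
Proof. by rewrite /qfactp big_geq. Qed.

Lemma Cyclotomic1 : 'Phi_1 = 'X - 1.
Proof. by have := @prod_Cyclotomic 1 isT; rewrite big_seq1. Qed.

(** The bound [B] is free so that all q-integers and q-factorials involved factor over one index
    range and can be compared exponent by exponent. *)
Lemma qpoly_cyclotomic B M : (0 < M < B)%N ->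
  qpoly M = \prod_(2 <= k < B) 'Phi_k ^+ (k %| M)%N.
Proof.
case/andP=> M0 MB; have X1 : 'X - 1 != 0 :> {poly int}.
  by rewrite -size_poly_eq0 size_XsubC.
apply: (mulfI X1); rewrite qpolyE -prod_Cyclotomic // -Cyclotomic1.
transitivity (\prod_(1 <= k < B) 'Phi_k ^+ (k %| M)%N); last first.
  by rewrite [LHS]big_ltn ?(leq_trans _ MB) // dvd1n expr1.
rewrite [RHS](bigID (fun k => (k %| M)%N)) /= [X in _ = _ * X]big1 ?mulr1.
  rewrite -[RHS]big_filter; transitivity
    (\prod_(k <- [seq k <- index_iota 1 B | (k %| M)%N]) 'Phi_k).
    apply: perm_big; apply: uniq_perm; rewrite ?divisors_uniq ?filter_uniq ?iota_uniq //.
    move=> k; rewrite -dvdn_divisors // mem_filter mem_index_iota.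
    have [kM|//] := boolP (k %| M)%N.
    by rewrite (dvdn_gt0 M0 kM) (leq_ltn_trans (dvdn_leq M0 kM)).
  by apply: eq_big_seq => k; rewrite mem_filter => /andP[-> _].
by move=> k /negbTE->.
Qed.

(** Among 1, .., [M] exactly [M %/ k] numbers are multiples of [k], and each contributes one
    ['Phi_k]. *)
Lemma qfactp_cyclotomic B M : (M < B)%N ->
  qfactp M = \prod_(2 <= k < B) 'Phi_k ^+ (M %/ k).
Proof.
elim: M => [|M IH] MB.
  by rewrite qfactp0 big1 // => k _; rewrite div0n.
rewrite qfactpS IH 1?ltnW // (@qpoly_cyclotomic B M.+1) // -big_split.
rewrite !big_nat; apply: eq_bigr => k /andP[k2 _].
by rewrite /= -exprD divnS ?(ltnW k2) // addnC.
Qed.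

Section Evaluation.

Variables (C : numClosedFieldType) (k : nat) (z : C).
Hypotheses (k_gt0 : (0 < k)%N) (zk : k.-primitive_root z).

Definition evalz (p : {poly int}) : C := (map_poly intr p).[z].

Lemma evalzM p q : evalz (p * q) = evalz p * evalz q.
Proof. by rewrite /evalz rmorphM hornerM. Qed.

Lemma evalz_qpoly M : (z - 1) * evalz (qpoly M) = z ^+ M - 1.
Proof.
have: evalz ('X - 1) = z - 1 by rewrite /evalz rmorphB /= map_polyX rmorph1 !hornerE.
move=> <-; rewrite -evalzM qpolyE /evalz rmorphB /= map_polyXn rmorph1.
by rewrite !hornerE.
Qed.

Lemma evalz_sum M : evalz (qpoly M) = \sum_(i < M) z ^+ i.
Proof.
rewrite /evalz /qpoly rmorph_sum horner_sum; apply: eq_bigr => i _.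
by rewrite /= map_polyXn hornerXn.
Qed.

Lemma evalz_qpoly_neq0 M : (0 < M < k)%N -> evalz (qpoly M) != 0.
Proof.
case/andP=> M0 Mk; apply/eqP=> q0; have := evalz_qpoly M.
rewrite q0 mulr0 => /esym/eqP; rewrite subr_eq0 -(prim_order_dvd zk).
by move/(dvdn_leq M0); rewrite leqNgt Mk.
Qed.

Lemma evalz_qpoly_mod M : evalz (qpoly M) = evalz (qpoly (M %% k)) \/ k = 1%N.
Proof.
have [->|k1] := eqVneq k 1%N; [by right|left].
have z1 : z - 1 != 0.
  by rewrite subr_eq0 -[z]expr1 -(prim_order_dvd zk) dvdn1.
by apply: (mulfI z1); rewrite !evalz_qpoly (prim_expr_mod zk).
Qed.

Lemma evalz_qfactp_neq0 M : (M < k)%N -> evalz (qfactp M) != 0.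
Proof.
elim: M => [|M IH] Mk; first by rewrite qfactp0 /evalz rmorph1 hornerC oner_neq0.
by rewrite qfactpS evalzM mulf_neq0 ?IH ?evalz_qpoly_neq0 // ltnW.
Qed.

(** The factor of [k] that vanishes at [z]. For k = 1 no q-integer of positive index vanishes at z =
    1, hence the value 1. *)
Definition PhiK : {poly int} := if (1 < k)%N then 'Phi_k else 1.

Definition cofactorK : {poly int} := \prod_(2 <= j < k) 'Phi_j ^+ (j %| k)%N.

Lemma qpoly_cofactorK : qpoly k = PhiK * cofactorK.
Proof.
rewrite /PhiK /cofactorK; case: ltnP => k1.
  rewrite (@qpoly_cyclotomic k.+1) ?ltnSn ?andbT // big_nat_recr //= dvdnn.
  by rewrite mulrC.
have -> : k = 1%N by lia.
by rewrite big_geq // mulr1 /qpoly big_ord1.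
Qed.

Lemma PhiK_neq0 : PhiK != 0.
Proof.
by rewrite /PhiK; case: ifP => _; rewrite ?oner_neq0 ?monic_neq0 ?Cyclotomic_monic.
Qed.

Lemma evalz_cofactorK : evalz cofactorK != 0.
Proof.
rewrite /cofactorK big_nat; apply: (big_ind (fun p => evalz p != 0)).
- by rewrite /evalz rmorph1 hornerC oner_neq0.
- by move=> p q p0 q0; rewrite evalzM mulf_neq0.
move=> j /andP[j2 jk]; case: (_ %| _)%N => /=; last first.
  by rewrite expr0 /evalz rmorph1 hornerC oner_neq0.
rewrite expr1; have j0 : (0 < j < k)%N by rewrite jk andbT ltnW.
apply: contraNneq (evalz_qpoly_neq0 j0) => e0.
rewrite (@qpoly_cyclotomic j.+1) ?ltnSn ?andbT ?(ltnW j2) //.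
by rewrite big_nat_recr //= dvdnn expr1 evalzM e0 mulr0.
Qed.

Lemma evalz_PhiK : (1 < k)%N -> evalz PhiK = 0.
Proof.
move=> k1; apply/eqP; rewrite -(mulIr_eq0 _ (mulIf evalz_cofactorK)).
rewrite -evalzM -qpoly_cofactorK.
have z1 : z - 1 != 0.
  by rewrite subr_eq0 -[z]expr1 -(prim_order_dvd zk) dvdn1 gtn_eqF.
by rewrite -(mulrI_eq0 _ (mulfI z1)) evalz_qpoly (prim_expr_order zk) subrr.
Qed.

(** What is left of [M] when its factor [PhiK], if any, is removed. For multiples of [k] the form
    comes from [M](q) = [k](q) [M/k](q^k), whose last factor is the integer M/k at [z]. *)
Definition qpoly' (M : nat) : {poly int} :=
  if (k %| M)%N then cofactorK * (qpoly (M %/ k) \Po 'X^k) else qpoly M.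

Definition qfact' (M : nat) : {poly int} := \prod_(1 <= i < M.+1) qpoly' i.

Lemma qpoly_mul (a : nat) : qpoly (k * a) = qpoly k * (qpoly a \Po 'X^k).
Proof.
have X1 : 'X - 1 != 0 :> {poly int} by rewrite -size_poly_eq0 size_XsubC.
apply: (mulfI X1); rewrite mulrA !qpolyE.
have := congr1 (comp_poly 'X^k) (qpolyE a).
rewrite comp_polyM comp_polyB comp_polyX comp_polyC => ->.
by rewrite comp_polyB comp_Xn_poly comp_polyC exprM.
Qed.

Lemma qpoly_PhiK M : qpoly M = PhiK ^+ (k %| M)%N * qpoly' M.
Proof.
rewrite /qpoly'; case: ifP => [kM|_]; last by rewrite mul1r.
by rewrite expr1 mulrA -qpoly_cofactorK -qpoly_mul mulnC divnK.
Qed.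

Lemma qfactp_PhiK M : qfactp M = PhiK ^+ (M %/ k) * qfact' M.
Proof.
elim: M => [|M IH]; first by rewrite div0n mul1r /qfact' big_geq // qfactp0.
rewrite qfactpS IH qpoly_PhiK /qfact' [in RHS]big_nat_recr //= divnS //.
by rewrite exprD mulrACA [_ ^+ (k %| _)%N * _]mulrC.
Qed.

Lemma evalz_qpoly' M : (k %| M)%N ->
  evalz (qpoly' M) = evalz cofactorK * (M %/ k)%:R.
Proof.
move=> kM; rewrite /qpoly' kM evalzM; congr (_ * _).
rewrite /evalz map_comp_poly horner_comp map_polyXn hornerXn (prim_expr_order zk).
rewrite /qpoly rmorph_sum horner_sum (eq_bigr (fun=> 1)) => [|i _].
  by rewrite sumr_const card_ord.
by rewrite /= map_polyXn hornerXn expr1n.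
Qed.

(** The factors split into [M %/ k] full blocks of length [k] and a remainder. The multiple of [k]
    closing the i-th block contributes [cofactorK] times i; the other values depend only on the
    residue modulo [k], so each block gives [k-1]! once. *)
Lemma evalz_qfact' M : evalz (qfact' M) =
  evalz cofactorK ^+ (M %/ k) * (M %/ k)`!%:R * evalz (qfactp k.-1) ^+ (M %/ k)
  * evalz (qfactp (M %% k)).
Proof.
elim: M => [|M IH].
  by rewrite div0n mod0n /qfact' big_geq // qfactp0 /evalz rmorph1 hornerC !mulr1.
rewrite /qfact' big_nat_recr //= -/(qfact' M) evalzM IH.
rewrite divnS // modnS; case: ifP => kM.
  rewrite evalz_qpoly' // divnS // kM add1n factS natrM !exprS.
  have -> : (M %% k)%N = k.-1.
    have := modnS M k; rewrite kM => _; move: kM; rewrite -addn1 /dvdn -modnDml.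
    have := ltn_pmod M k_gt0; move: (M %% k)%N => r rk.
    have [r1k|] := ltnP (r + 1)%N k; first by rewrite modn_small // addn1.
    by lia.
  rewrite qfactp0 [evalz 1](_ : _ = 1); last by rewrite /evalz rmorph1 hornerC.
  by rewrite mulr1; ring.
rewrite add0n qfactpS evalzM -!mulrA; do 4!congr (_ * _).
rewrite /qpoly' kM; case: (evalz_qpoly_mod M.+1) => [->|k1]; last by rewrite k1 dvd1n in kM.
by rewrite modnS kM.
Qed.

Section Quotient.

Variables (I : eqType) (r : seq I) (d : I -> nat) (m n1 : nat) (P : {poly int}).
Hypotheses (PE : P * \prod_(i <- r) qfactp (d i) = qpoly m * qfactp n1)
  (km : (k %| m)%N).
Let S := (\sum_(i <- r) d i %/ k)%N.

Lemma evalz_prod (J : Type) (t : seq J) (p : J -> {poly int}) :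
  evalz (\prod_(i <- t) p i) = \prod_(i <- t) evalz (p i).
Proof.
by apply: (big_morph _ evalzM); rewrite /evalz rmorph1 hornerC.
Qed.

(** Evaluating [PE] directly may only give 0 = 0; the powers of [PhiK] are cancelled as polynomials
    before [z] is substituted. *)
Lemma evalz_quotient_eq : (S <= (n1 %/ k).+1)%N ->
  evalz P * \prod_(i <- r) evalz (qfact' (d i)) =
  evalz (PhiK ^+ ((n1 %/ k).+1 - S)) * (evalz (qpoly' m) * evalz (qfact' n1)).
Proof.
move=> leS; rewrite -evalz_prod -!evalzM; congr evalz.
have P0 : PhiK ^+ S != 0 by rewrite expf_neq0 ?PhiK_neq0.
apply: (mulfI P0); rewrite mulrCA [RHS]mulrA -exprD subnKC //.
rewrite [X in P * X](_ : _ = \prod_(i <- r) qfactp (d i)).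
  by rewrite PE qpoly_PhiK km qfactp_PhiK exprS expr1; ring.
rewrite /S -prodrXr -big_split; apply: eq_bigr => i _ /=.
by rewrite -qfactp_PhiK.
Qed.

Lemma evalz_qfact'_neq0 M : evalz (qfact' M) != 0.
Proof.
rewrite evalz_qfact' !mulf_neq0 ?expf_neq0 ?evalz_cofactorK //.
- by rewrite pnatr_eq0 -lt0n fact_gt0.
- by rewrite evalz_qfactp_neq0 // prednK.
by rewrite evalz_qfactp_neq0 // ltn_pmod.
Qed.

Lemma evalz_quotient0 : (1 < k)%N -> (S < (n1 %/ k).+1)%N -> evalz P = 0.
Proof.
move=> k1 ltS; have := evalz_quotient_eq (ltnW ltS).
rewrite -[in RHS](prednK (n := _ - _)) ?subn_gt0 // exprS evalzM evalz_PhiK //.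
rewrite !mul0r => /eqP; rewrite mulf_eq0 => /orP[/eqP//|].
rewrite prodf_seq_eq0 => /hasP[i _ /=].
by rewrite (negbTE (evalz_qfact'_neq0 _)).
Qed.

(** Numerator and denominator contain [PhiK] equally often, and carry the same powers of [cofactorK]
    and [k-1]!: the remainders of the [d i] contribute [0]! = [1]! = 1, and that of [n1] supplies
    the last [k-1]!, which is 1 for k = 2. The factor [m] leaves m/k, whence the [k] on the left. *)
Lemma evalz_quotient : S = (n1 %/ k).+1 ->
    (forall i, i \in r -> (d i %% k <= 1)%N) -> ((n1 %% k)%N = k.-1 \/ k = 2) ->
  evalz P * k%:R * \prod_(i <- r) (d i %/ k)`!%:R = (m * (n1 %/ k)`!)%:R.
Proof.
move=> SE dr n1r; have := evalz_quotient_eq (eq_leq SE).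
rewrite SE subnn expr0 [evalz 1](_ : _ = 1) ?mul1r; last first.
  by rewrite /evalz rmorph1 hornerC.
set c := evalz cofactorK; set F := evalz (qfactp k.-1).
have e01 j : (j <= 1)%N -> evalz (qfactp j) = 1.
  case: j => [|[|//]] _; rewrite ?qfactpS qfactp0 ?mul1r /qpoly ?big_ord1;
  by rewrite /evalz rmorph1 hornerC.
have -> : \prod_(i <- r) evalz (qfact' (d i)) =
    c ^+ S * F ^+ S * \prod_(i <- r) (d i %/ k)`!%:R.
  rewrite /S -!prodrXr -!big_split big_seq [in RHS]big_seq.
  by apply: eq_bigr => i /dr di; rewrite evalz_qfact' (e01 _ di) -/c -/F /=; ring.
rewrite evalz_qpoly' // evalz_qfact' -/c -/F.
have -> : evalz (qfactp (n1 %% k)) = F.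
  have [->//|k2] := n1r; rewrite /F k2 !e01 // -ltnS; exact: ltn_pmod.
have c0 : c != 0 by apply: evalz_cofactorK.
have F0 : F != 0 by rewrite evalz_qfactp_neq0 // prednK.
move=> eqP; apply: (mulfI (expf_neq0 S c0)); apply: (mulfI (expf_neq0 S F0)).
rewrite natrM (_ : m%:R = (m %/ k)%:R * k%:R); last by rewrite -natrM divnK.
rewrite SE.
transitivity (k%:R * (evalz P * (c ^+ S * F ^+ S *
   \prod_(i <- r) (d i %/ k)`!%:R))); first by rewrite SE; ring.
by rewrite eqP !exprS; ring.
Qed.

(** Treated apart from [evalz_quotient]: for k = 1 the application has [S] = n + 1, but [n1.+1] =
    n. *)
Lemma evalz_quotient1 : k = 1%N ->
  evalz P * \prod_(i <- r) (d i)`!%:R = (m * n1`!)%:R.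
Proof.
move=> k1; have z1 : z = 1.
  by apply/eqP; rewrite -[z]expr1 -(prim_order_dvd zk) k1.
have ev M : evalz (qpoly M) = M%:R.
  by rewrite evalz_sum z1 (eq_bigr (fun=> 1)) ?sumr_const ?card_ord // => i _; rewrite expr1n.
have evf M : evalz (qfactp M) = M`!%:R.
  elim: M => [|M IH]; first by rewrite qfactp0 /evalz rmorph1 hornerC.
  by rewrite qfactpS evalzM ev IH factS natrM mulrC.
have := congr1 evalz PE; rewrite !evalzM evalz_prod ev evf natrM => <-.
by congr (_ * _); apply: eq_bigr => i _; rewrite evf.
Qed.

End Quotient.

End Evaluation.

Local Close Scope ring_scope.

(** * Degree sequences that allow a rotation symmetry, and the cyclotomic exponents *)

Section DegreeSequence.

Variables (d : nat -> nat) (N n : nat).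
Hypothesis d_sum : (\sum_(1 <= i < N.+1) d i)%N = n.+1.
Hypothesis d_deg : (\sum_(1 <= i < N.+1) i * d i)%N = (2 * n)%N.
Hypothesis n_ge2 : (2 <= n)%N.

Lemma N_gt0 : (0 < N)%N.
Proof. by case: N d_sum => // ; rewrite big_geq. Qed.

(** If all n + 1 nodes were leaves, the degree sum would be n + 1, less than 2n. *)
Lemma d1_le : (d 1 <= n)%N.
Proof.
have N1 : (1 < N.+1)%N by rewrite ltnS N_gt0.
have := d_deg; have := d_sum; rewrite !(big_ltn N1) mul1n.
have [//|d1n] := leqP (d 1%N) n; move=> e1.
have /eqP : (\sum_(2 <= i < N.+1) d i)%N = 0%N by lia.
rewrite sum_nat_seq_eq0 => /allP z; rewrite big1_seq ?addn0; last first.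
  by move=> i /= /z /eqP->; rewrite muln0.
by lia.
Qed.

(* The degree sequences allowing a rotation symmetry of order k about a node of
   degree j, respectively about an edge. *)
Definition node_centered (k j : nat) : Prop :=
  [/\ (k %| n)%N, (0 < j < N.+1)%N, (k %| j)%N, (d j %% k = 1)%N &
      forall i, (0 < i < N.+1)%N -> i != j -> (k %| d i)%N].

Definition edge_centered (k : nat) : Prop :=
  k = 2 /\ forall i, (0 < i < N.+1)%N -> (2 %| d i)%N.

Lemma modn_sum (k : nat) : (\sum_(1 <= i < N.+1) d i %/ k * k +
   \sum_(1 <= i < N.+1) d i %% k)%N = n.+1.
Proof. by rewrite -d_sum -big_split; apply: eq_bigr => i _ /=; rewrite -divn_eq. Qed.

(** Writing n + 1 = S k + t with t at most 1 gives n - 1 = (S - 1) k + (k + t - 2), and k + t - 2 is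
    a remainder below k. *)
Lemma sum_divn_eq (k : nat) : (1 < k)%N ->
    (\sum_(1 <= i < N.+1) d i %% k <= 1)%N ->
  (\sum_(1 <= i < N.+1) d i %/ k)%N = (n.-1 %/ k).+1.
Proof.
move=> k1; have := modn_sum k; rewrite -big_distrl /=.
set S := \sum_(1 <= i < N.+1) d i %/ k; set t := \sum_(1 <= i < N.+1) d i %% k.
clearbody S t => St t1.
case: S St => [|S] St; first by lia.
have -> : n.-1 = (S * k + (k + t - 2))%N by lia.
by rewrite divnMDl ?divn_small ?addn0 //; lia.
Qed.

Lemma centered_sum_divn (k : nat) : (1 < k)%N ->
    (exists j, node_centered k j) \/ edge_centered k ->
  (\sum_(1 <= i < N.+1) d i %/ k)%N = (n.-1 %/ k).+1.
Proof.
move=> k1 H; apply: sum_divn_eq => //.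
case: H => [[j [_ jN _ dj di]]|[k2 di]]; last first.
  rewrite big1_seq // => i /=; rewrite mem_index_iota k2 => /di.
  exact/eqP.
have jI : j \in index_iota 1 N.+1 by rewrite mem_index_iota.
rewrite (bigD1_seq j) ?iota_uniq //= dj big1_seq ?addn0 // => i.
by rewrite mem_index_iota => /andP[ij iN]; apply/eqP/di.
Qed.

(** Put n + 1 = S k + t, t being the sum of the remainders; S k > n - 1 leaves t = 0 or t = 1. If t
    = 0, all [d i] are multiples of k, so k divides 2n and n + 1, hence 2. If t = 1, a single degree
    j has remainder 1; k divides n and the degree sum, hence j d_j, and d_j is prime to k. *)
Lemma sum_divn_centered (k : nat) : (1 < k)%N ->
    ((n.-1 %/ k) < \sum_(1 <= i < N.+1) d i %/ k)%N ->
  (k %| 2 * n - d 1)%N /\ ((exists j, node_centered k j) \/ edge_centered k).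
Proof.
move=> k1; have k0 := ltnW k1; have := modn_sum k; rewrite -big_distrl /=.
set S := \sum_(1 <= i < N.+1) d i %/ k; set t := \sum_(1 <= i < N.+1) d i %% k.
move=> St; rewrite ltn_divLR // => ltS.
have N1 : (1 < N.+1)%N by rewrite ltnS N_gt0.
have one_in : (0 < 1 < N.+1)%N by rewrite N1.
have [t0|t0] := eqVneq t 0%N.
  have di i : (0 < i < N.+1)%N -> (k %| d i)%N.
    move/eqP: t0; rewrite sum_nat_seq_eq0 => /allP z iN.
    by have := z i; rewrite mem_index_iota iN => /(_ isT).
  have k2n : (k %| 2 * n)%N.
    rewrite -d_deg big_nat; apply: dvdn_sum => i /di; exact: dvdn_mull.
  split; first by rewrite dvdn_sub ?di.
  have k2 : k = 2.
    have kn : k %| n.+1 by rewrite -St t0 addn0 dvdn_mull.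
    have : k %| 2 * n + 2 by rewrite -mulnSr dvdn_mull.
    by rewrite dvdn_addr // => /dvdn_leq; lia.
  by right; split=> // i /di; rewrite k2.
have t1 : t = 1 by lia.
have [j jI dj] : exists2 j, j \in index_iota 1 N.+1 & d j %% k != 0.
  apply/hasP; rewrite -[has _ _]negbK -all_predC; apply: contraNN t0 => /allP z.
  by rewrite /t big1_seq // => i /= /z /= /negPn/eqP.
have jN : 0 < j < N.+1 by rewrite -mem_index_iota.
have := t1; rewrite /t (bigD1_seq j) ?iota_uniq //= => tj.
have dj1 : d j %% k = 1 by move: dj tj; case: (d j %% k) => [|[|x]].
have di i : 0 < i < N.+1 -> i != j -> k %| d i.
  move=> iN ij; have /eqP : \sum_(1 <= i < N.+1 | i != j) d i %% k = 0 by lia.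
  rewrite sum_nat_seq_eq0 => /allP z; have := z i.
  by rewrite mem_index_iota iN ij => /(_ isT).
have kn : k %| n.
  by have -> : n = S * k; [move: St; rewrite t1; lia | apply: dvdn_mull].
have kj : k %| j.
  have cop : coprime k (d j) by rewrite -coprime_modr dj1 coprimen1.
  rewrite -(Gauss_dvdl _ cop).
  rewrite -(@dvdn_addl (\sum_(1 <= i < N.+1 | i != j) i * d i)); last first.
    rewrite big_seq_cond; apply: dvdn_sum => i /andP[].
    by rewrite mem_index_iota => iN ij; apply/dvdn_mull/di.
  have := d_deg; rewrite (bigD1_seq j) ?iota_uniq //= => ->.
  exact: dvdn_mull.
have j1 : 1 != j.
  by apply: contraTneq kj => <-; rewrite dvdn1 gtn_eqF.
split; first by rewrite dvdn_sub ?dvdn_mull ?di.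
by left; exists j; split.
Qed.

(* The subtraction never truncates, by sum_divn_centered. *)
Definition cyc_exponent (k : nat) : nat :=
  (k %| 2 * n - d 1) + n.-1 %/ k - \sum_(1 <= i < N.+1) d i %/ k.

Definition sieving_poly : {poly int} :=
  \prod_(2 <= k < (2 * n).+1) 'Phi_k ^+ cyc_exponent k.

Lemma sieving_polyE :
  (sieving_poly * \prod_(1 <= i < N.+1) qfactp (d i) =
   qpoly (2 * n - d 1) * qfactp n.-1)%R.
Proof.
have d1n := d1_le.
have dn i : i \in index_iota 1 N.+1 -> d i <= n.+1.
  by move=> iI; rewrite -d_sum (bigD1_seq i) ?iota_uniq //= leq_addr.
rewrite (@qpoly_cyclotomic (2 * n).+1); last by lia.
rewrite (@qfactp_cyclotomic (2 * n).+1); last by lia.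
rewrite (eq_big_seq (fun i => \prod_(2 <= k < (2 * n).+1) 'Phi_k ^+ (d i %/ k))%R).
  rewrite exchange_big /= /sieving_poly -!big_split !big_nat.
  apply: eq_bigr => k /andP[k2 _] /=; rewrite -GRing.expr_sum -!exprD.
  congr (_ ^+ _)%R; rewrite /cyc_exponent subnK //.
  have [lt|] := ltnP (n.-1 %/ k) (\sum_(1 <= i < N.+1) d i %/ k); last first.
    by move=> le; rewrite (leq_trans le) // leq_addl.
  have [-> H] := sum_divn_centered k2 lt.
  by rewrite (centered_sum_divn k2 H).
by move=> i /dn di; apply: qfactp_cyclotomic; lia.
Qed.

End DegreeSequence.

(** * Matchings that form trees *)

(** Each edge merges at most two values of [c], so it costs at most one vertex. *)
Lemma contract_edges (V : finType) (W : {set V}) (es : seq (V * V)) :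
  exists c : V -> V, (forall e, e \in es -> c e.1 = c e.2) /\
    (#|W| <= #|c @: W| + size es)%N.
Proof.
elim: es => [|e es [c [cE cW]]].
  by exists id; split=> //; rewrite imset_id addn0.
exists (fun v => if c v == c e.1 then c e.2 else c v); split=> [e'|].
  rewrite inE => /predU1P[-> | /cE->] //; rewrite eqxx.
  by case: eqP.
set c' := fun v => _.
have: (#|c @: W| <= #|c e.1 |: c' @: W|)%N.
  apply/subset_leq_card/subsetP=> _ /imsetP[v Wv ->]; rewrite !inE.
  have [//|ne] := boolP (c v == c e.1).
  by apply/imsetP; exists v; rewrite // /c' (negbTE ne).
by rewrite cardsU1 /=; case: (_ \notin _) => /=; lia.
Qed.

(** Once all edges are contracted, comparison with the image of one vertex [w] is a two-colouring
    constant along edges; by connectivity it is constant on [W], so a single vertex remains. *)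
Lemma edge_bound (V : finType) (W : {set V}) (es : seq (V * V)) :
    (forall c : V -> bool, (forall e, e \in es -> c e.1 = c e.2) ->
       {in W &, forall u v, c u = c v}) ->
  (#|W| <= (size es).+1)%N.
Proof.
move=> conn; have [c [cE le_W]] := contract_edges W es.
have [->|[w Ww]] := set_0Vmem W; first by rewrite cards0.
apply: leq_trans le_W _; rewrite -add1n leq_add2r.
rewrite -(cards1 (c w)); apply/subset_leq_card/subsetP=> _ /imsetP[v Wv ->].
rewrite inE; have cP e: e \in es -> (c e.1 == c w) = (c e.2 == c w).
  by move/cE->.
by rewrite (conn (fun v => c v == c w) cP v w Wv Ww) eqxx.
Qed.

(** A choice of one point in each 2-cycle of an involution, by the enumeration order; fixed points
    are left out. *)
Definition half (T : finType) (a : T -> T) : {set T} :=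
  [set x | (enum_rank x < enum_rank (a x))%N].

Lemma half_or (T : finType) (a : T -> T) x : involutive a ->
  a x != x -> (a x \in half a) = (x \notin half a).
Proof.
move=> aK nx; rewrite !inE aK.
have: (enum_rank (a x) != enum_rank x :> nat).
  by rewrite (inj_eq (@ord_inj _)) (inj_eq enum_rank_inj).
by lia.
Qed.

Lemma half_supp (T : finType) (a : T -> T) x : x \in half a -> a x != x.
Proof. by rewrite inE; apply: contraTneq => ->; rewrite ltnn. Qed.

Lemma card_half (T : finType) (a : T -> T) : involutive a ->
  #|[set x | a x != x]| = (#|half a|).*2.
Proof.
move=> aK; have a_inj := inv_inj aK.
have ->: [set x | a x != x] = half a :|: a @^-1: half a.
  apply/setP=> x; rewrite in_setU [x \in a @^-1: _]inE [LHS]inE.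
  have [ax|nx] := eqVneq (a x) x; last by rewrite half_or // orbN.
  by rewrite ax orbb; apply/esym/negP=> /half_supp/eqP.
rewrite cardsU (card_preimset _ a_inj) addnn.
have ->: half a :&: a @^-1: half a = set0.
  apply/setP=> x; rewrite !in_setI [x \in a @^-1: _]inE in_set0.
  by have [hx|] := boolP (x \in half a) => //; rewrite half_or ?half_supp ?hx.
by rewrite cards0 subn0.
Qed.

Section TreeMatchings.

Variables Q V : finType.
Implicit Types (b : Q -> V) (W : {set V}) (H : {set Q}) (a : {perm Q}).

(* The graph on W with an edge from b x to b (a x) for each x is connected. *)
Definition links b W (a : Q -> Q) : Prop := forall c : V -> bool,
  (forall x, c (b x) = c (b (a x))) -> {in W &, forall u v, c u = c v}.

Lemma links_bound b W (a : Q -> Q) : involutive a -> links b W a ->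
  (#|W|.*2 <= #|[set x | a x != x]|.+2)%N.
Proof.
move=> aK conn; rewrite card_half // -doubleS leq_double (cardE (half a)).
rewrite -(size_map (fun x => (b x, b (a x)))); apply: edge_bound => c cE.
apply: conn => x; have [->//|nx] := eqVneq (a x) x.
wlog hx : x nx / x \in half a.
  move=> IH; have [/IH->//|hx] := boolP (x \in half a).
  by have := IH (a x); rewrite aK half_or // eq_sym => ->.
by apply: (cE (b x, b (a x))); apply: map_f; rewrite mem_enum.
Qed.

(** Points outside [H] are fixed, so that the type [Q] stays the same while edges are contracted.
    The tree property is connectivity together with the size condition #|H| = 2 (#|W| - 1) of the
    counting theorem. *)
Definition tree_matchings H b W : {set {perm Q}} :=
  [set a : {perm Q} | [&& [forall x, a (a x) == x],
     [forall x, (a x != x) == (x \in H)] & `[< links b W a >]]].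

Lemma tree_matchingsP H b W a : reflect
  [/\ involutive a, forall x, (a x != x) = (x \in H) & links b W a]
  (a \in tree_matchings H b W).
Proof.
rewrite inE; apply: (iffP and3P) => [[/forallP h1 /forallP h2 /asboolP h3]|].
  by split=> [x|x|//]; [exact: (eqP (h1 x)) | exact: (eqP (h2 x))].
move=> [h1 h2 h3]; split; last exact/asboolP; apply/forallP=> x; apply/eqP=> //.
Qed.

Definition block_degree H b (w : V) : nat := #|[set x in H | b x == w]|.

Definition merge b (u v : V) (x : Q) : V := if b x == v then u else b x.

(** Composing with [tperm h k] deletes the edge between h and k, while [merge] identifies its two
    ends. *)
Lemma links_merge b W a h k : involutive a -> a h = k -> b h != b k ->
  b h \in W ->
  links b W a <-> links (merge b (b h) (b k)) (W :\ b k) (tperm h k * a)%g.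
Proof.
move=> aK ah nhk Wh; have ak: a k = h by rewrite -ah aK.
have kh : h != k by apply: contraNneq nhk => ->.
have aE x : x != h -> x != k -> (tperm h k * a)%g x = a x.
  by move=> xh xk; rewrite permM tpermD // eq_sym.
have a'h : (tperm h k * a)%g h = h by rewrite permM tpermL ak.
have a'k : (tperm h k * a)%g k = k by rewrite permM tpermR ah.
split=> conn c cP.
  pose c1 v := c (if v == b k then b h else v).
  have c1b x : c1 (b x) = c (merge b (b h) (b k) x) by [].
  have c1P x : c1 (b x) = c1 (b (a x)).
    have [->|xh] := eqVneq x h.
      by rewrite ah /c1 (negbTE nhk) eqxx.
    have [->|xk] := eqVneq x k.
      by rewrite ak /c1 (negbTE nhk) eqxx.
    by rewrite !c1b cP aE.
  move=> u v /setD1P[uk Wu] /setD1P[vk Wv].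
  by have := conn c1 c1P u v Wu Wv; rewrite /c1 (negbTE uk) (negbTE vk).
have chk : c (b h) = c (b k) by rewrite -ah.
have c'P x : c (merge b (b h) (b k) x) = c (b x).
  by rewrite /merge; case: eqP => // ->.
have c'a x : c (merge b (b h) (b k) x) =
             c (merge b (b h) (b k) ((tperm h k * a)%g x)).
  have [->|xh] := eqVneq x h; first by rewrite a'h.
  have [->|xk] := eqVneq x k; first by rewrite a'k.
  by rewrite aE // !c'P.
have all u : u \in W -> c u = c (b h).
  move=> Wu; have [->//|uk] := eqVneq u (b k).
  by apply: (conn c c'a); rewrite !inE ?uk ?nhk.
by move=> u v Wu Wv; rewrite !all.
Qed.

Lemma card_tree_matchings_contract H b W h k : h \in H -> k \in H ->
    b h != b k -> b h \in W ->
  #|[set a in tree_matchings H b W | a h == k]| =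
  #|tree_matchings (H :\ h :\ k) (merge b (b h) (b k)) (W :\ b k)|.
Proof.
move=> Hh Hk nhk Wh; have kh : h != k by apply: contraNneq nhk => ->.
rewrite -[RHS](card_preimset _ (mulgI (tperm h k))); apply: eq_card => a.
rewrite inE [RHS]inE; apply/andP/tree_matchingsP.
  move=> [/tree_matchingsP[aK aH conn] /eqP ah].
  have ak: a k = h by rewrite -ah aK.
  have aE x : x != h -> x != k -> (tperm h k * a)%g x = a x.
    by move=> xh xk; rewrite permM tpermD // eq_sym.
  have a'h : (tperm h k * a)%g h = h by rewrite permM tpermL ak.
  have a'k : (tperm h k * a)%g k = k by rewrite permM tpermR ah.
  split; last exact: (proj1 (links_merge aK ah nhk Wh) conn).
    move=> x; have [->|xh] := eqVneq x h; first by rewrite !a'h.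
    have [->|xk] := eqVneq x k; first by rewrite !a'k.
    rewrite (aE x) // aE ?aK //.
      by apply: contraNneq xk => axh; rewrite -[x]aK axh ah.
    by apply: contraNneq xh => axk; rewrite -[x]aK axk ak.
  move=> x; rewrite !inE.
  have [->|xk] := eqVneq x k; first by rewrite a'k eqxx.
  have [->|xh] := eqVneq x h; first by rewrite a'h eqxx.
  by rewrite aE // aH.
set a' := (tperm h k * a)%g => -[aK aH conn].
have aE : a = (tperm h k * a')%g by rewrite /a' mulgA tperm2 mul1g.
have a'k : a' k = k by apply/eqP; rewrite -[_ == _]negbK aH !inE eqxx.
have a'h : a' h = h by apply/eqP; rewrite -[_ == _]negbK aH !inE eqxx andbF.
have ah : a h = k by rewrite aE permM tpermL.
have ak : a k = h by rewrite aE permM tpermR.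
have aD x : x != h -> x != k -> a x = a' x.
  by move=> xh xk; rewrite aE permM tpermD // eq_sym.
have aI : involutive a.
  move=> x; have [->|xh] := eqVneq x h; first by rewrite ah.
  have [->|xk] := eqVneq x k; first by rewrite ak.
  rewrite (aD x) // aD ?aK //.
    by apply: contraNneq xh => axh; rewrite -[x]aK axh a'h.
  by apply: contraNneq xk => axk; rewrite -[x]aK axk a'k.
split; last by rewrite ah.
apply/tree_matchingsP; split=> //; last exact: (proj2 (links_merge aI ah nhk Wh) conn).
move=> x; have [->|xh] := eqVneq x h; first by rewrite ah eq_sym kh Hh.
have [->|xk] := eqVneq x k; first by rewrite ak kh Hk.
by rewrite aD // aH !inE xh xk.
Qed.

(** Deleting a loop keeps the blocks linked, but leaves fewer edges than [links_bound] requires. *)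
Lemma tree_matchings_loop H b W h k a : (#|H| < #|W|.*2)%N -> h != k ->
  b h = b k -> a \in tree_matchings H b W -> a h != k.
Proof.
move=> leHW nhk bhk /tree_matchingsP[aK aH conn]; apply/eqP=> ah.
have ak: a k = h by rewrite -ah aK.
have aE x : x != h -> x != k -> (tperm h k * a)%g x = a x.
  by move=> xh xk; rewrite permM tpermD // eq_sym.
have a'h : (tperm h k * a)%g h = h by rewrite permM tpermL ak.
have a'k : (tperm h k * a)%g k = k by rewrite permM tpermR ah.
have a'K : involutive (tperm h k * a)%g.
  move=> x; have [->|xh] := eqVneq x h; first by rewrite !a'h.
  have [->|xk] := eqVneq x k; first by rewrite !a'k.
  rewrite (aE x) // aE ?aK //.
    by apply: contraNneq xk => axh; rewrite -[x]aK axh ah.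
  by apply: contraNneq xh => axk; rewrite -[x]aK axk ak.
have conn' : links b W (tperm h k * a)%g.
  move=> c cP; apply: conn => x; have [->|xh] := eqVneq x h.
    by rewrite ah bhk.
  have [->|xk] := eqVneq x k; first by rewrite ak bhk.
  by rewrite -aE.
have /= := links_bound a'K conn'.
suff: (#|[set x | (tperm h k * a)%g x != x]|.+2 <= #|H|)%N by lia.
have Hh : h \in H by rewrite -aH ah eq_sym.
have Hk : k \in H by rewrite -aH ak.
rewrite (cardsD1 h H) Hh (cardsD1 k (H :\ h)) !inE [k == h]eq_sym nhk Hk !ltnS.
apply/subset_leq_card/subsetP=> x; rewrite !inE.
have [->|xk] := eqVneq x k; first by rewrite a'k eqxx.
have [->|xh] := eqVneq x h; first by rewrite a'h eqxx.
by rewrite aE // aH.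
Qed.


Lemma sum_block_degree H b W : (forall x, x \in H -> b x \in W) ->
  \sum_(w in W) block_degree H b w = #|H|.
Proof.
move=> bW; rewrite -sum1_card (partition_big b (mem W)) //=.
apply: eq_bigr => w _; rewrite /block_degree -sum1_card.
by apply: eq_bigl => x; rewrite inE.
Qed.

Lemma block_degree_merge H b (h k : Q) w : h \in H -> k \in H -> b h != b k ->
  w != b k ->
  block_degree (H :\ h :\ k) (merge b (b h) (b k)) w =
  if w == b h then (block_degree H b (b h) + block_degree H b (b k) - 2)%N
  else block_degree H b w.
Proof.
move=> Hh Hk nhk wk; rewrite /block_degree /merge.
have [->|wh] := eqVneq w (b h); last first.
  apply: eq_card => x; rewrite !inE.
  have [->|xk] := eqVneq x k; first by rewrite /= eq_sym (negbTE wk) andbF.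
  have [->|xh] := eqVneq x h; first by rewrite /= eq_sym (negbTE wh) andbF.
  by have [->|//] := eqVneq (b x) (b k); rewrite ![_ == w]eq_sym (negbTE wh) (negbTE wk).
have ->: [set x in H :\ h :\ k | (if b x == b k then b h else b x) == b h] =
   ([set x in H | b x == b h] :\ h) :|: ([set x in H | b x == b k] :\ k).
  apply/setP=> x; rewrite !inE.
  have [->|xk] := eqVneq x k.
    by rewrite /= [b k == _]eq_sym (negbTE nhk) !andbF.
  have [->|xh] := eqVneq x h; first by rewrite /= (negbTE nhk) !andbF.
  by case: (x \in H) => //=; case: (b x == b k); rewrite ?eqxx ?orbT ?orbF.
rewrite cardsU.
have ->: ([set x in H | b x == b h] :\ h) :&: ([set x in H | b x == b k] :\ k)
   = set0.
  apply/setP=> x; rewrite !inE; have [->|] := eqVneq (b x) (b h).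
    by rewrite (negbTE nhk) !andbF.
  by rewrite !andbF.
rewrite cards0 [in RHS](cardsD1 h) [X in _ = (_ + X - 2)%N](cardsD1 k) !inE.
by rewrite Hh Hk !eqxx /=; lia.
Qed.

Lemma card_tree_matchings_rec H b W h : (#|H| < #|W|.*2)%N ->
    (forall x, x \in H -> b x \in W) -> h \in H ->
  #|tree_matchings H b W| =
    (\sum_(w in W | w != b h) \sum_(k in H | b k == w)
       #|[set a in tree_matchings H b W | a h == k]|)%N.
Proof.
move=> leHW bW Hh.
rewrite -sum1_card (partition_big (fun a : {perm Q} => a h) (mem H)) /=;
  last first.
  by move=> a /tree_matchingsP[aK aH _]; rewrite -aH aK eq_sym aH.
rewrite (bigID (fun k => b k == b h)) /= big1 ?add0n; last first.
  move=> k /andP[Hk bhk]; apply: big_pred0 => a; apply/negbTE.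
  apply/negP=> /andP[aT]; apply/negP.
  have [kh|nkh] := eqVneq k h.
    by rewrite kh; case/tree_matchingsP: aT => _ -> _.
  by apply: tree_matchings_loop aT; rewrite ?(eqP bhk) // eq_sym.
rewrite (partition_big b (fun w => (w \in W) && (w != b h))) /=; last first.
  by move=> k /andP[Hk nk]; rewrite bW.
apply: eq_bigr => w /andP[Ww nw]; apply: eq_big => [k|k /andP[/andP[Hk _] _]].
  by have [->|] := eqVneq (b k) w; rewrite ?nw ?andbT ?andbF.
by rewrite -sum1_card; apply: eq_bigl => a; rewrite inE.
Qed.

(** Induction on the number of blocks, contracting the edge at a chosen half-edge [h]: e partners
    lie in a block of degree e, and merging it with a block of degree d leaves degree d + e - 2. The
    result agrees with p! / prod (d - 1)! trees on p + 2 labelled nodes, times d! ways of attaching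
    the edges at each node. *)
Theorem card_tree_matchings p H b W :
    #|W| = p.+2 -> #|H| = (p.+1).*2 -> (forall x, x \in H -> b x \in W) ->
  #|tree_matchings H b W| = (p`! * \prod_(w in W) block_degree H b w)%N.
Proof.
elim: p H b W => [|p IH] H b W cW cH bW.
all: have [h Hh]: exists h, h \in H by apply/set0Pn; rewrite -card_gt0 cH.
all: have Wh := bW h Hh.
all: have sumH := sum_block_degree bW.
all: have dpos x : x \in H -> (0 < block_degree H b (b x))%N
  by move=> Hx; rewrite card_gt0; apply/set0Pn; exists x; rewrite inE Hx eqxx.
all: have leHW : #|H| < #|W|.*2 by rewrite cW cH.
all: rewrite (card_tree_matchings_rec leHW bW Hh).
- have [w nw WE] : exists2 w, w != b h & W = [set b h; w].
    have: #|W :\ b h| == 1 by move: cW; rewrite (cardsD1 (b h)) Wh add1n => -[->].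
    case/cards1P=> w WE; exists w; last by rewrite -(setD1K Wh) WE.
    by have: w \in W :\ b h by [rewrite WE set11]; rewrite !inE => /andP[].
  have sW (F : V -> nat) : \sum_(v in W | v != b h) F v = F w.
    rewrite (big_pred1 w) // => v; rewrite WE !inE /=.
    by have [->|] := eqVneq v (b h); rewrite /= ?andbT // eq_sym (negbTE nw).
  rewrite sW fact0 mul1n WE big_setU1 ?big_set1 ?inE 1?eq_sym //=.
  have := sumH; rewrite {1}WE big_setU1 ?big_set1 ?inE 1?eq_sym //= cH => sumH'.
  rewrite (eq_bigr (fun=> 1)) => [|k /andP[Hk /eqP bk]]; last first.
    have bhk: b h != b k by rewrite bk eq_sym.
    rewrite card_tree_matchings_contract ?WE ?inE ?eqxx //.
    have H0 : H :\ h :\ k = set0.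
      apply/eqP; rewrite -cards_eq0; have := cH.
      rewrite (cardsD1 h H) Hh (cardsD1 k (H :\ h)) !inE Hk.
      have -> : k != h by [apply: contraNneq bhk => ->]. lia.
    rewrite H0 bk; rewrite -(cards1 (1%g : {perm Q})); apply: eq_card => a.
    rewrite [RHS]inE; apply/tree_matchingsP/eqP => [[aK aH _]|->].
      by apply/permP=> x; rewrite perm1; apply/eqP; rewrite -[_ == _]negbK aH inE.
    split=> [x|x|c _ u v]; rewrite ?perm1 ?eqxx ?inE //.
    move=> /andP[uw uE] /andP[vw vE]; move: uE vE.
    by rewrite (negbTE uw) (negbTE vw) !orbF => /eqP-> /eqP->.
  rewrite /= sum1dep_card -/(block_degree H b w).
  by have := dpos h Hh; case: (block_degree H b (b h)) sumH' => [|[|[|d]]] //=; lia.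
- rewrite [in RHS](bigD1 (b h)) //=.
  set R := \prod_(w in W | w != b h) block_degree H b w.
  have Wcount : #|[set w in W | w != b h]| = p.+2.
    have: #|W :\ b h| = p.+2 by move: cW; rewrite (cardsD1 (b h)) Wh add1n => -[->].
    by move=> <-; apply: eq_card => w; rewrite !inE andbC.
  transitivity (\sum_(w in W | w != b h) 
      p`! * ((block_degree H b (b h) + block_degree H b w - 2) * R)).
    apply: eq_bigr => w /andP[Ww nw].
    rewrite (eq_bigr (fun=> p`! * ((block_degree H b (b h) + block_degree H b w - 2)
       * \prod_(u in W | (u != b h) && (u != w)) block_degree H b u))); last first.
      move=> k /andP[Hk /eqP bk]; have nhk : b h != b k by rewrite bk eq_sym.
      have kh : k != h by apply: contraNneq nhk => ->.
      rewrite card_tree_matchings_contract // IH; first last.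
      * move=> x; rewrite !inE /merge => /and3P[xk xh Hx].
        by have [_|nx] := eqVneq (b x) (b k); rewrite ?nhk ?Wh ?nx ?bW ?andbT.
      * by move: cH; rewrite (cardsD1 h H) Hh (cardsD1 k (H :\ h)) !inE kh Hk; lia.
      * by move: cW; rewrite (cardsD1 (b k)) bW // add1n => -[].
      congr (_ * _); rewrite (bigD1 (b h)) ?inE ?nhk //=.
      rewrite block_degree_merge // eqxx bk; congr (_ * _).
      apply: eq_big => [u|u]; first by rewrite !inE; case: (u \in W); rewrite ?andbF //= !andbT andbC.
      rewrite !inE => /andP[/andP[uk _] uh].
      by move: uk; rewrite -bk => uk; rewrite block_degree_merge // (negbTE uh).
    rewrite sum_nat_const.
    have -> : #|[pred k | k \in H & b k == w]| = block_degree H b w.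
      by rewrite /block_degree; apply: eq_card => k; rewrite !inE.
    rewrite mulnCA; congr (_ * _); rewrite mulnCA; congr (_ * _).
    rewrite /R [in RHS](bigD1 w) ?Ww //=; congr (_ * _).
    by apply: eq_bigl => u; rewrite andbA.
  rewrite -big_distrr -big_distrl /= factS.
  (* If another block is empty both sides vanish; otherwise all degrees are positive and the
     subtraction of 2 is exact. *)
  have [->|R0] := eqVneq R 0; first by rewrite !muln0.
  (* The p + 2 other blocks have total degree 2(p + 2) - d, where d is the degree of the block of
     [h]; the sum is (p + 2) d + 2(p + 2) - d - 2(p + 2). *)
  suff -> : \sum_(w in W | w != b h) (block_degree H b (b h) +
      block_degree H b w - 2) = p.+1 * block_degree H b (b h).
    by rewrite !mulnA (mulnC p.+1).
  have dw w : w \in W -> w != b h -> 0 < block_degree H b w.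
    move=> Ww nw; rewrite lt0n; apply: contraNneq R0 => d0.
    by rewrite /R (bigD1 w) ?Ww //= d0.
  have := sumH; rewrite (bigD1 (b h)) //= => sumH'.
  have: \sum_(w in W | w != b h) (block_degree H b (b h) + block_degree H b w - 2)
     + \sum_(w in W | w != b h) 2
     = \sum_(w in W | w != b h) (block_degree H b (b h) + block_degree H b w).
    rewrite -big_split; apply: eq_bigr => w /andP[Ww nw] /=; apply: subnK.
    by rewrite (leq_add (dpos h Hh) (dw w Ww nw)).
  rewrite big_split /= !sum_nat_const.
  have -> : #|[pred w in W | w != b h]| = p.+2.
    by rewrite -Wcount; apply: eq_card => w; rewrite !inE.
  by move: sumH'; rewrite cH; lia.
Qed.

End TreeMatchings.

(** * Plane trees as pairs of permutations *)

Section Maps.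

Variable D : finType.
Implicit Types (s a f : {perm D}) (x y h k : D).

Definition transitive2 (s a : D -> D) : Prop := forall c : D -> bool,
  (forall x, c (s x) = c x) -> (forall x, c (a x) = c x) ->
  forall x y, c x = c y.

Lemma invariant_porbit (c : D -> bool) s : (forall x, c (s x) = c x) ->
  forall x y, y \in porbit s x -> c y = c x.
Proof.
move=> cs x y /porbitP[i ->]; elim: i => [|i IH]; first by rewrite expg0 perm1.
by rewrite expgSr permM cs.
Qed.

Lemma links_porbit s (a : D -> D) :
  links (porbit s) (porbits s) a <-> transitive2 s a.
Proof.
split=> conn c.
  move=> cs ca x y.
  pose c' (A : {set D}) := [exists z in A, c z].
  have c'E z : c' (porbit s z) = c z.
    apply/exists_inP/idP => [[t /(invariant_porbit cs) -> //]|cz].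
    by exists z; rewrite ?porbit_id.
  rewrite -!c'E; apply: conn; try exact: imset_f.
  by move=> z; rewrite !c'E ca.
move=> cb _ _ /imsetP[x _ ->] /imsetP[y _ ->].
apply: (conn (fun z => c (porbit s z))) => z //.
by have := porbit_perm s 1 z; rewrite expg1 => ->.
Qed.

Lemma transitive2_bound s (a : D -> D) : involutive a -> transitive2 s a ->
  (#|porbits s|.*2 <= #|[set x | a x != x]|.+2)%N.
Proof. by move=> aK /links_porbit; apply: links_bound. Qed.

(** Composing [s] with the transposition joins the cycles of h and k. The two permutations differ
    only at h and k; if c h and c k differed, the value c k, taken at [s h], would persist along the
    [s]-cycle of h and be taken at h itself. *)
Lemma invariant_mul_tperm (c : D -> bool) s h k : h \notin porbit s k ->
  (forall x, c (s (tperm h k x)) = c x) -> c h = c k.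
Proof.
move=> hk cst; have csh : c (s h) = c k by rewrite -(cst k) tpermR.
apply/eqP/negPn/negP=> nhk.
suff cP i : c ((s ^+ i.+1)%g h) = c (s h).
  have := cP (#[s].-1)%g; rewrite prednK ?order_gt0 // expg_order perm1 csh.
  exact/eqP.
elim: i => [|i IH]; first by rewrite expg1.
rewrite expgSr permM -[RHS]IH -[RHS]cst tpermD //.
  by apply: contraNneq nhk => e; rewrite {1}e IH csh.
by apply: contraNneq hk => ->; rewrite porbit_sym mem_porbit.
Qed.

(* Contracting an edge changes neither the product of s and a nor the excess of
   nodes over edges. *)
Lemma one_face s a : involutive a -> transitive2 s a ->
    #|porbits s|.*2 = #|[set x | a x != x]|.+2 ->
  forall c : D -> bool, (forall x, c (s (a x)) = c x) -> forall x y, c x = c y.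
Proof.
have [m] := ubnP #|[set x | a x != x]|; elim: m s a => // m IH s a.
rewrite ltnS => le_m aK conn cnt c csa.
have [a0|[h]] := set_0Vmem [set x | a x != x].
  have aE x : a x = x.
    by apply/eqP/negPn/negP=> ax; have := in_set0 x; rewrite -a0 inE ax.
  by apply: conn => x; rewrite ?aE // -{2}[x]aE -[RHS]csa !aE.
rewrite inE; set k := a h => nhk; have kh : h != k by rewrite eq_sym.
have ak : a k = h by rewrite aK.
pose a' := (tperm h k * a)%g.
have aE x : x != h -> x != k -> a' x = a x.
  by move=> xh xk; rewrite permM tpermD // eq_sym.
have a'h : a' h = h by rewrite permM tpermL ak.
have a'k : a' k = k by rewrite permM tpermR.
have a'K : involutive a'.
  move=> x; have [->|xh] := eqVneq x h; first by rewrite !a'h.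
  have [->|xk] := eqVneq x k; first by rewrite !a'k.
  rewrite (aE x) // aE ?aK //.
    by apply: contraNneq xk => axh; rewrite -[x]aK axh.
  by apply: contraNneq xh => axk; rewrite -[x]aK axk ak.
have suppE : #|[set x | a x != x]| = #|[set x | a' x != x]|.+2.
  rewrite (cardsD1 h) inE nhk (cardsD1 k) !inE nhk ak kh /= !add1n.
  congr (_.+2); apply: eq_card => x; rewrite !inE.
  have [->|xk] := eqVneq x k; first by rewrite a'k eqxx.
  have [->|xh] := eqVneq x h; first by rewrite a'h eqxx.
  by rewrite aE.
(* Were both ends at the same node, this edge could be deleted without disconnecting the graph,
   against the bound on the number of nodes. *)
have [hks|hks] := boolP (h \in porbit s k).
  have conn' : transitive2 s a'.
    move=> c' cs ca; apply: conn => // x.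
    have [->|xh] := eqVneq x h.
      by rewrite -/k (invariant_porbit cs hks).
    have [->|xk] := eqVneq x k; first by rewrite ak (invariant_porbit cs hks).
    by rewrite -aE.
  by have := transitive2_bound a'K conn'; lia.
(* Moving the transposition from [a] to [s] contracts the edge. *)
pose s' := (tperm h k * s)%g.
have s'a' x : s' (a' x) = s (a x).
  rewrite permM; congr (s _).
  have [->|xh] := eqVneq x h; first by rewrite a'h tpermL.
  have [->|xk] := eqVneq x k; first by rewrite a'k tpermR.
  rewrite aE // tpermD //.
    by apply: contraNneq xk => /esym axh; rewrite -[x]aK axh.
  by apply: contraNneq xh => /esym axk; rewrite -[x]aK axk ak.
apply: (IH s' a') => //; first by rewrite ltnW // -suppE.
- move=> c' cs ca; have chk : c' h = c' k.
    by apply: (invariant_mul_tperm hks) => x; rewrite -[RHS]cs permM.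
  have ct x : c' (tperm h k x) = c' x by case: tpermP => [->|->|].
  apply: conn => x; first by rewrite -[in RHS]ct -[in RHS]cs permM tpermK.
  have [->|xh] := eqVneq x h; first by rewrite -/k.
  have [->|xk] := eqVneq x k; first by rewrite ak.
  by rewrite -aE.
  have := porbits_mul_tperm s h k; rewrite hks kh /= -/s'.
  move: cnt; rewrite suppE; clearbody s' a'; move: #|porbits s'| #|porbits s|.
  lia.
by move=> x; rewrite s'a'.
Qed.

Lemma commute_permE s f x : commute f s -> f (s x) = s (f x).
Proof. by move=> fs; rewrite -!permM (fs). Qed.

(** The set of fixed points of [f] is stable under [s] and [a], so by connectivity it is empty or
    everything. *)
Lemma automorphism_free s a f x : transitive2 s a -> commute f s ->
  commute f a -> f x = x -> f = 1%g.
Proof.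
move=> conn fs fa fx; apply/permP=> y; rewrite perm1; apply/eqP.
rewrite (conn (fun z => f z == z) _ _ y x) ?fx //= => z.
  by rewrite commute_permE // (inj_eq perm_inj).
by rewrite commute_permE // (inj_eq perm_inj).
Qed.

Lemma transitive2_connect (x : rooted_map D) : edge_involution x ->
  connected_graph x <-> transitive2 (sigma x) (alpha x).
Proof.
move=> ei; split=> [conn c cs ca h k | conn h k].
  have /connectP[p + ->] := conn h k.
  elim: p h => //= y p IH h /andP[/orP e /IH <-].
  by case: e => [/(invariant_porbit cs) -> | /eqP-> //].
pose e := fun y z : D => (z \in node x y) || (z == alpha x y).
have e_sym y z : e y z = e z y.
  rewrite /e [z \in _]porbit_sym; congr (_ || _).
  by apply/eqP/eqP=> ->; rewrite (proj2 (ei _)).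
have cP y z : e y z -> connect e h z = connect e h y.
  by move=> yz; apply/idP/idP => hy; apply: connect_trans hy (connect1 _);
     rewrite // e_sym.
rewrite -/e (conn (connect e h) _ _ k h) // => y; apply: cP.
  by rewrite /e [_ \in _](mem_porbit (sigma x) 1 y).
by rewrite /e eqxx orbT.
Qed.

(** Deleting one edge of a cycle leaves the graph connected, with one edge too few for its number of
    nodes. *)
Lemma tree_acyclic (x : rooted_map D) : edge_involution x ->
    transitive2 (sigma x) (alpha x) -> #|porbits (sigma x)|.*2 = #|D|.+2 ->
  forall c, ~~ graph_cycle x c.
Proof.
set s := sigma x; set a := alpha x => ei conn cnt c; apply/negP.
case/and4P; case: c => // h c _ cyc _ une.
have aK : involutive a by move=> z; case: (ei z).
have an z : a z != z by apply/eqP; case: (ei z).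
pose k := a h; have ak : a k = h by rewrite aK.
have kh : h != k by rewrite eq_sym an.
pose a' := (tperm h k * a)%g.
have aE z : z != h -> z != k -> a' z = a z.
  by move=> zh zk; rewrite permM tpermD // eq_sym.
have a'h : a' h = h by rewrite permM tpermL ak.
have a'k : a' k = k by rewrite permM tpermR.
have a'K : involutive a'.
  move=> z; have [->|zh] := eqVneq z h; first by rewrite !a'h.
  have [->|zk] := eqVneq z k; first by rewrite !a'k.
  rewrite (aE z) // aE ?aK //.
    by apply: contraNneq zk => axh; rewrite -[z]aK axh.
  by apply: contraNneq zh => axk; rewrite -[z]aK axk ak.
have supp : (#|[set z | a' z != z]|.+2 <= #|D|)%N.
  have -> : #|D| = #|[set: D]| by rewrite cardsT.
  rewrite (cardsD1 h [set: D]) (cardsD1 k ([set: D] :\ h)) !inE an /= !add1n !ltnS.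
  apply/subset_leq_card/subsetP=> z; rewrite !inE.
  have [->|zk] := eqVneq z k; first by rewrite a'k eqxx.
  by have [->|zh] := eqVneq z h; first by rewrite a'h eqxx.
have conn' : transitive2 s a'.
  (* The ends of the deleted edge are still joined by the rest of the cycle, which does not use that
     edge again. *)
  move=> b bs ba; have bk : b k = b h.
    have edges z : z \in c -> b (a z) = b z.
      move=> zc; rewrite -aE ?ba //.
        by apply: contraTneq une => zh; rewrite /= negb_and negbK -zh map_f.
      move: une => /= /andP[+ _]; apply: contraNneq => zk.
      suff -> : edge x h = edge x z by apply: map_f.
      apply/eqP; rewrite eq_porbit_mem zk porbit_sym.
      exact: (mem_porbit a 1 h).
    move: cyc; rewrite /= rcons_path => /andP[pth lst].
    have node_b y z : a y \in node x z -> b (a y) = b z.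
      exact: (invariant_porbit bs).
    have last_h : b (a (last h c)) = b h by apply: node_b.
    have : b (a (last h c)) = b k.
      case: (c) pth edges => //= y p /andP[hy]; rewrite -/k in hy.
      move: (node_b _ _ hy); rewrite -/k => bky.
      elim: p y {hy} bky => /= [|z p IH] y bky.
        by move=> _ /(_ y (mem_head _ _)) ->.
      case/andP=> yz pz edges; apply: (IH z) => //; last first.
        by move=> t tp; apply: edges; rewrite inE tp orbT.
      by rewrite bky -(edges y (mem_head _ _)); apply: node_b.
    by rewrite last_h.
  apply: conn => // z.
  have [->|zh] := eqVneq z h; first by rewrite -/k bk.
  have [->|zk] := eqVneq z k; first by rewrite ak bk.
  by rewrite -aE.
by have := transitive2_bound a'K conn'; lia.
Qed.

End Maps.

(** * The centre of a rotation symmetry *)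

(** An orbit has size b = 1 or b = p, and in both cases p = b + (p - 1) [b = 1]; this is summed over
    the orbits. *)
Lemma card_orbits_prime (gT : finGroupType) (T : finType) (G : {group gT})
    (to : {action gT &-> T}) (S : {set T}) : prime #|G| ->
    [acts G, on S | to]%g ->
  (#|G| * #|(orbit to G @: S)%g| = #|S| + (#|G|).-1 * #|('Fix_(S | to)(G))%g|)%N.
Proof.
move=> prG actS; rewrite -(acts_sum_card_orbit actS).
have -> : #|('Fix_(S | to)(G))%g| = (\sum_(B in (orbit to G @: S)%g) (#|B| == 1))%N.
  transitivity (\sum_(B in (orbit to G @: S)%g | #|B| == 1) 1); last first.
    by rewrite big_mkcondr; apply: eq_bigr => B _; case: eqP.
  rewrite -(card_imset _ set1_inj) sum1dep_card; apply: eq_card => B.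
  rewrite [in RHS]inE; apply/imsetP/andP => [[x /setIP[Sx fx] ->]|[]].
    by rewrite cards1 -{1}(orbit1P fx) imset_f.
  case/imsetP=> x Sx -> /cards1P[y oE]; exists x; last first.
    by have := orbit_refl to G x; rewrite oE => /set1P->.
  rewrite inE Sx; apply/orbit1P.
  by have := orbit_refl to G x; rewrite oE => /set1P->.
rewrite big_distrr -big_split mulnC -sum_nat_const; apply: eq_bigr => B /imsetP[x Sx ->] /=.
have: (#|orbit to G x| %| #|G|)%N by rewrite card_orbit dvdn_indexg.
case/primeP: prG => G1 dvG /dvG /orP[] /eqP-> /=; first by rewrite muln1 add1n prednK // ltnW.
by rewrite gtn_eqF // muln0 addn0.
Qed.

Lemma card_porbits_pred (D : finType) (s : {perm D}) (P : pred {set D}) :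
  #|[set x | P (porbit s x)]| = \sum_(A in porbits s | P A) #|A|.
Proof.
rewrite -sum1_card (partition_big (porbit s) (fun A => (A \in porbits s) && P A)).
  apply: eq_bigr => _ /andP[/imsetP[x _ ->] Px]; rewrite -sum1_card.
  apply: eq_bigl => y; rewrite inE -eq_porbit_mem.
  by have [->|] := eqVneq; rewrite ?Px ?andbF.
by move=> x; rewrite inE => ->; rewrite imset_f.
Qed.

Section Center.

Variables (D : finType) (s a f : {perm D}).
Hypotheses (aK : involutive a) (an : forall x, a x != x).
Hypothesis conn : transitive2 s a.
Hypothesis cnt : #|porbits s|.*2 = #|D|.+2.

Let act_set : {action {perm D} &-> {set D}} := ('P^*)%act.

Lemma imset_porbit (t g : {perm D}) x : commute g t ->
  act_set (porbit t x) g = porbit t (g x).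
Proof.
move=> gt; apply/setP=> y; apply/imsetP/idP.
  case=> _ /porbitP[i ->] ->; apply/porbitP; exists i.
  by rewrite /= apermE -!permM (commuteX i gt).
case/porbitP=> i ->; exists ((t ^+ i)%g x); first exact: mem_porbit.
by rewrite /= apermE -!permM (commuteX i gt).
Qed.

Lemma acts_porbits (t g : {perm D}) : commute g t ->
  [acts <[g]>, on porbits t | act_set]%g.
Proof.
move=> gt; have sub i A : A \in porbits t -> act_set A (g ^+ i)%g \in porbits t.
  case/imsetP=> x _ ->; rewrite imset_porbit ?imset_f //.
  exact/commute_sym/commuteX/commute_sym.
apply/actsP=> _ /cycleP[i ->] A; apply/idP/idP; last exact: sub.
by move=> /(sub (#[g]%g * i - i)%N); rewrite -actM -expgD subnKC
  ?leq_pmull ?order_gt0 // expgM expg_order expg1n act1.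
Qed.

Lemma fix_porbits (t g : {perm D}) : commute g t ->
  ('Fix_(porbits t | act_set)(<[g]>))%g =
    [set porbit t x | x : D & g x \in porbit t x].
Proof.
move=> gt; apply/setP=> A; rewrite inE; apply/andP/imsetP => [[/imsetP[x _ ->]]|].
  rewrite afix_cycle ?in_setT // => /afix1P fx; move/eqP: fx; rewrite imset_porbit //.
  by rewrite eq_porbit_mem => gx; exists x; rewrite // inE.
case=> x; rewrite inE => gx ->; split; first exact: imset_f.
rewrite afix_cycle ?in_setT //; apply/afix1P; rewrite imset_porbit //.
by apply/eqP; rewrite eq_porbit_mem.
Qed.

Lemma orbit_porbit (t g : {perm D}) x : commute g t ->
  orbit act_set <[g]>%g (porbit t (g x)) = orbit act_set <[g]>%g (porbit t x).
Proof.
move=> gt; rewrite -imset_porbit //; apply: orbit_act; exact: cycle_id.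
Qed.

Lemma porbit_involution x y : (y \in porbit a x) = (y == x) || (y == a x).
Proof.
apply/porbitP/orP => [[i ->]|[]/eqP->]; last 2 first.
- by exists 0; rewrite expg0 perm1.
- by exists 1; rewrite expg1.
elim: i => [|i [/eqP IH|/eqP IH]]; first by left; rewrite expg0 perm1.
  by right; rewrite expgSr permM IH.
by left; rewrite expgSr permM IH aK.
Qed.

Lemma card_edges : #|porbits a|.*2 = #|D|.
Proof.
have -> : #|D| = #|[set x | predT (porbit a x)]|.
  by rewrite -cardsT; apply: eq_card => x; rewrite !inE.
rewrite card_porbits_pred (eq_bigr (fun=> 2)) => [|A /andP[/imsetP[x _ ->] _]].
  rewrite sum_nat_const muln2; congr _.*2.
  by apply: eq_card => A; rewrite [RHS]inE andbT.
have -> : porbit a x = [set x; a x].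
  by apply/setP=> y; rewrite porbit_involution !inE.
by rewrite cards2 eq_sym an.
Qed.

Section Prime.

Variable g : {perm D}.
Hypotheses (gs : commute g s) (ga : commute g a) (pr_g : prime #[g]%g).

Let p := #[g]%g.
Let O := orbit act_set <[g]>%g.
Let nodeF := [set porbit s x | x : D & g x \in porbit s x].
Let edgeF := [set porbit a x | x : D & g x \in porbit a x].

Lemma prime_free x : g x != x.
Proof.
apply: contraTneq pr_g => /(automorphism_free conn gs ga) ->.
by rewrite order1.
Qed.

(** [g] moves every half-edge, so an edge that it preserves is reversed. *)
Lemma edgeF_flip x : porbit a x \in edgeF -> g x = a x.
Proof.
case/imsetP=> y; rewrite inE porbit_involution (negbTE (prime_free y)) /=.
move=> /eqP gy /eqP; rewrite eq_porbit_mem porbit_involution.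
by case/orP=> /eqP->; rewrite ?gy // commute_permE // gy.
Qed.

Lemma nodes_orbits : (p * #|O @: porbits s| = #|porbits s| + p.-1 * #|nodeF|)%N.
Proof. by rewrite /nodeF -fix_porbits //; apply: card_orbits_prime (acts_porbits gs). Qed.

Lemma edges_orbits : (p * #|O @: porbits a| = #|porbits a| + p.-1 * #|edgeF|)%N.
Proof. by rewrite /edgeF -fix_porbits //; apply: card_orbits_prime (acts_porbits ga). Qed.

Lemma orbit_edgeF A : A \in edgeF -> O A = [set A].
Proof.
rewrite /edgeF -fix_porbits // => /setIP[_ fA]; exact/orbit1P.
Qed.

(** In the quotient graph a flipped edge becomes a half-edge glued to itself and connects nothing;
    the other edge orbits must connect all the node orbits. *)
Lemma quotient_bound :
  (#|O @: porbits s| + #|edgeF| <= #|O @: porbits a|.+1)%N.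
Proof.
have subF : O @: edgeF \subset O @: porbits a.
  by apply/imsetS/subsetP=> _ /imsetP[x _ ->]; apply: imset_f.
have cF : #|O @: edgeF| = #|edgeF|.
  rewrite card_in_imset // => A B AF BF; rewrite !orbit_edgeF // => /set1_inj //.
pose E := O @: porbits a :\: O @: edgeF.
have cE : (#|E| + #|edgeF| = #|O @: porbits a|)%N.
  by rewrite cardsD (setIidPr subF) cF subnK // -cF subset_leq_card.
rewrite -cE -addSn leq_add2r.
pose rep (B : {set {set D}}) := [pick x | B == O (porbit a x)].
pose es := [seq if rep B is Some x then (O (porbit s x), O (porbit s (a x)))
            else (B, B) | B <- enum E].
have -> : #|E| = size es by rewrite size_map -cardE.
apply: edge_bound => c cP.
have cg x : c (O (porbit s (g x))) = c (O (porbit s x)).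
  by rewrite /O orbit_porbit.
suff all x y : c (O (porbit s x)) = c (O (porbit s y)).
  by move=> _ _ /imsetP[_ /imsetP[x _ ->] ->] /imsetP[_ /imsetP[y _ ->] ->].
apply: (conn (c := fun z => c (O (porbit s z)))) => z.
  by have := porbit_perm s 1 z; rewrite expg1 => ->.
have [zF|zF] := boolP (porbit a z \in edgeF).
  by rewrite -(edgeF_flip zF) cg.
have zE : O (porbit a z) \in E.
  apply/setDP; split; first by rewrite !imset_f.
  apply: contra zF => /imsetP[A AF eO].
  have : porbit a z \in O A by rewrite -eO; apply: orbit_refl.
  by rewrite orbit_edgeF // => /set1P->.
have cgi i w : c (O (porbit s ((g ^+ i)%g w))) = c (O (porbit s w)).
  elim: i => [|i IH]; first by rewrite expg0 perm1.
  by rewrite expgSr permM cg.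
have [t rx eO] : exists2 t, rep (O (porbit a z)) = Some t &
    O (porbit a z) = O (porbit a t).
  by rewrite /rep; case: pickP => [t /eqP|/(_ z)/eqP//]; exists t.
have {rx} /cP/= cx : (O (porbit s t), O (porbit s (a t))) \in es.
  by apply/mapP; exists (O (porbit a z)); rewrite ?mem_enum ?rx.
have : porbit a z \in O (porbit a t) by rewrite -eO; apply: orbit_refl.
case/orbitP=> _ /cycleP[i ->]; rewrite imset_porbit; last first.
  exact/commute_sym/commuteX/commute_sym.
move/eqP; rewrite eq_porbit_mem porbit_sym porbit_involution.
case/orP=> /eqP->; rewrite ?aK.
  by rewrite -[in LHS]commute_permE ?cgi //; exact/commute_sym/commuteX/commute_sym.
by rewrite -[in RHS]commute_permE ?cgi //; exact/commute_sym/commuteX/commute_sym.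
Qed.

(* The quotient graph is connected, so it has at most one more node than edges;
   the tree has exactly one more, and all orbits but those of fixed nodes and
   flipped edges have size p. *)
Lemma prime_center : (#|nodeF| = 1 /\ #|edgeF| = 0) \/
  [/\ p = 2, #|nodeF| = 0 & #|edgeF| = 1].
Proof.
have := nodes_orbits; have := edges_orbits; have := quotient_bound.
have := card_edges; have p_gt1 : 1 < p := prime_gt1 pr_g; move: cnt.
(* On a flipped edge the square of [g] fixes a half-edge, so p divides 2. *)
have odd_flip : 2 < p -> #|edgeF| = 0.
  move=> p2; apply/eqP; rewrite cards_eq0; apply/set0Pn=> -[A AF].
  case/imsetP: (AF) => x _ eA; rewrite eA in AF.
  have gx := edgeF_flip AF.
  have g2 : (g ^+ 2)%g = 1%g.
    apply: (@automorphism_free _ s a _ x) => //.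
    - exact/commute_sym/commuteX/commute_sym.
    - exact/commute_sym/commuteX/commute_sym.
    by rewrite expgS expg1 permM gx commute_permE // gx aK.
  have : p %| 2 by rewrite order_dvdn g2.
  by move/dvdn_leq; lia.
move: (#|O @: porbits s|) (#|O @: porbits a|) => u v.
move: odd_flip; rewrite -/p; case: p p_gt1 => [|[|q]] // _.
move: #|nodeF| #|edgeF| #|porbits s| #|porbits a| #|D| => A r S E d /=.
move=> odd_r SD ED bound vE uS.
have SE : S = E.+1 by lia.
have le_q : q.+1 * A + r <= q.+1.
  have : q.+2 * (u + r) <= q.+2 * v.+1 by rewrite leq_pmul2l.
  rewrite mulnDr uS mulnS vE SE; lia.
case: A le_q uS => [|[|A]] le_q uS; last 2 first.
- by left; split=> //; lia.
- by move: le_q; rewrite mulnS; nia.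
(* For odd p without fixed node, p would divide both the number of edges and the number of nodes,
   which is one larger. *)
right; case: q odd_r uS vE le_q => [|q] odd_r uS vE le_q; last first.
  have r0 := odd_r isT; move: uS vE; rewrite r0 !muln0 !addn0 SE => uS vE.
  have : q.+3 %| E + 1 by rewrite addn1 -uS dvdn_mulr.
  by rewrite -vE dvdn_addr ?dvdn_mulr.
by split=> //; lia.
Qed.

End Prime.

Lemma commuteXl (i : nat) (g t : {perm D}) : commute g t -> commute (g ^+ i)%g t.
Proof. by move/commute_sym/(commuteX i)/commute_sym. Qed.

Lemma mem_porbit_expg (t g : {perm D}) i x : commute g t -> g x \in porbit t x ->
  (g ^+ i)%g x \in porbit t x.
Proof.
move=> gt gx; elim: i => [|i IH]; first by rewrite expg0 perm1 porbit_id.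
rewrite expgSr permM -eq_porbit_mem -imset_porbit //.
move: IH; rewrite -eq_porbit_mem => /eqP->; rewrite imset_porbit //.
by rewrite eq_porbit_mem.
Qed.

Lemma prime_power (g : {perm D}) : g != 1%g -> exists i, prime #[(g ^+ i)%g]%g.
Proof.
move=> g1; have gt1: 1 < #[g]%g by rewrite ltn_neqAle eq_sym order_eq1 g1 order_gt0.
exists (#[g]%g %/ pdiv #[g]%g)%N; rewrite orderXdiv ?dvdn_div ?pdiv_dvd //.
rewrite divnA ?pdiv_dvd // mulKn ?order_gt0 //; exact: pdiv_prime.
Qed.

Hypotheses (fs : commute f s) (fa : commute f a).

(** Some power g of f has prime order, and f, commuting with g, preserves the unique node or edge
    that g preserves. A nontrivial power of f preserving the node of y has itself a power of prime
    order, which preserves both nodes, so they agree. On a flipped edge f and g both act as the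
    flip, so f = g. *)
Theorem automorphism_center : f != 1%g ->
  (exists2 x, f x \in porbit s x & forall i y, (f ^+ i)%g != 1%g ->
       (f ^+ i)%g y \in porbit s y -> y \in porbit s x) \/
  [/\ #[f]%g = 2, exists x, f x = a x & forall y, f y \notin porbit s y].
Proof.
move=> f1; have [i pr_g] := prime_power f1; set g := (f ^+ i)%g in pr_g.
have gs : commute g s by apply: commuteXl.
have ga : commute g a by apply: commuteXl.
have gf : commute g f by apply/commute_sym/commuteX.
have [[n1 r0]|[p2 n0 r1]] := prime_center gs ga pr_g.
  left; have /cards1P[A AE] := introT eqP n1.
  have inA y : g y \in porbit s y -> porbit s y = A.
    by move=> gy; apply/set1P; rewrite -AE; apply/imsetP; exists y; rewrite ?inE.
  have: A \in [set A] by rewrite set11.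
  rewrite -AE => /imsetP[x]; rewrite inE => gx xA.
  have fx : f x \in porbit s x.
    rewrite -eq_porbit_mem -xA; apply/eqP/inA.
    rewrite -permM -gf permM -imset_porbit //.
    rewrite /=; apply/imsetP; exists (g x) => //.
  exists x => // j y fj fy; have [l pr_l] := prime_power fj.
  set t := ((f ^+ j) ^+ l)%g in pr_l.
  have ts : commute t s by do 2!apply: commuteXl.
  have ta : commute t a by do 2!apply: commuteXl.
  have ty : t y \in porbit s y.
    by apply: mem_porbit_expg => //; apply: commuteXl.
  have tx : t x \in porbit s x.
    by rewrite /t -expgM; apply: mem_porbit_expg.
  have := prime_center ts ta pr_l; set nF := [set _ | _ : _ & _].
  have [nx ny] : porbit s x \in nF /\ porbit s y \in nF.
    by split; apply/imsetP; [exists x | exists y]; rewrite ?inE.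
  case=> [[/eqP/cards1P[B nB] _]|[_ /eqP]]; last first.
    by rewrite cards_eq0 => /eqP nF0; rewrite nF0 inE in nx.
  by move: nx ny; rewrite nB -eq_porbit_mem => /set1P-> /set1P->.
right; have /cards1P[A AE] := introT eqP r1.
have: A \in [set A] by rewrite set11.
rewrite -AE => /imsetP[x]; rewrite inE => gx xA.
have gax : g x = a x.
  by apply: edgeF_flip => //; apply/imsetP; exists x; rewrite ?inE.
have : porbit a (f x) \in [set A].
  rewrite -AE; apply/imsetP; exists (f x); rewrite ?inE //.
  by rewrite -permM -gf permM gax commute_permE // porbit_involution eqxx orbT.
move/set1P/eqP; rewrite xA eq_porbit_mem porbit_involution.
case/orP=> /eqP fx; first by rewrite (automorphism_free conn fs fa fx) eqxx in f1.
have fg : f = g.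
  apply/eqP; rewrite eq_mulgV1; apply/eqP.
  apply: (@automorphism_free _ s a _ (a x)) => //.
  - by apply/commute_sym/commuteM/commuteV/commute_sym => //; apply/commute_sym.
  - by apply/commute_sym/commuteM/commuteV/commute_sym => //; apply/commute_sym.
  rewrite permM (commute_permE _ fa) fx aK; apply: (@perm_inj _ g).
  by rewrite permKV commute_permE // gax aK.
rewrite fg; split=> //; first by exists x.
move=> y; apply/negP=> gy; move/eqP: n0; rewrite cards_eq0 => /eqP n0.
have : porbit s y \in set0 by rewrite -n0; apply/imsetP; exists y; rewrite ?inE.
by rewrite inE.
Qed.

End Center.

(** * Quotients by an automorphism *)

Section Markings.

Variables (T : finType) (S : eqType) (cl : T -> {set T}) (ty : T -> S).
Variable sz : S -> nat.
Hypothesis cl_refl : forall x, x \in cl x.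
Hypothesis cl_eq : forall x y, y \in cl x -> cl y = cl x.
Hypothesis ty_cl : forall x y, y \in cl x -> ty y = ty x.
Hypothesis card_cl : forall x, #|cl x| = sz (ty x).

(** An isomorphism between frames is determined by the images of the base points, so isomorphisms
    are counted by such lists. Each choice discards a whole class because base points lie over
    distinct quotient nodes. *)
Fixpoint markings (A : {set T}) (ts : seq S) : seq (seq T) :=
  if ts is t :: ts' then
    [seq x :: m | x <- enum [set x in A | ty x == t], m <- markings (A :\: cl x) ts']
  else [:: [::]].

Fixpoint good_marking (A : {set T}) (ts : seq S) (m : seq T) : bool :=
  match ts, m with
  | [::], [::] => true
  | t :: ts', x :: m' => [&& x \in A, ty x == t & good_marking (A :\: cl x) ts' m']
  | _, _ => false
  end.

(** When the head [t] is treated, as many classes of type [t] are free as [t] has occurrences in the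
    remaining list, the head included. *)
Fixpoint marking_count (ts : seq S) : nat :=
  if ts is t :: ts' then sz t * (count_mem t ts) * marking_count ts' else 1.

Lemma mem_markings A ts m : (m \in markings A ts) = good_marking A ts m.
Proof.
elim: ts A m => [|t ts IH] A [|x m] //=.
  by apply/allpairsPdep => -[? [? []]].
apply/allpairsPdep/and3P => [[y [m' [yA m'M [-> ->]]]]|[xA xt gm]].
  by rewrite mem_enum inE in yA; case/andP: yA => -> ->; rewrite -IH.
by exists x, m; rewrite mem_enum inE xA xt IH.
Qed.

Lemma uniq_markings A ts : uniq (markings A ts).
Proof.
elim: ts A => [|t ts IH] A //=; apply: allpairs_uniq_dep => //.
- exact: enum_uniq.
by move=> [x m] [y m'] _ _ /= [-> ->].
Qed.

Lemma size_markings (A : {set T}) ts : (forall x, x \in A -> cl x \subset A) ->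
    {in ts, forall t, #|[set x in A | ty x == t]| = sz t * count_mem t ts} ->
  size (markings A ts) = marking_count ts.
Proof.
elim: ts A => [|t ts IH] A Acl cnt //=.
have hd := cnt t (mem_head _ _).
rewrite size_allpairs_dep -hd cardE.
have: {in enum [set x in A | ty x == t],
    forall x, size (markings (A :\: cl x) ts) = marking_count ts}.
  move=> x; rewrite mem_enum inE => /andP[xA /eqP xt]; apply: IH.
    move=> y /setDP[yA ycx]; rewrite subsetD Acl //=.
    rewrite disjoint_sym; apply/pred0P=> z /=; apply/negbTE/andP => -[zx zy].
    by case/negP: ycx; rewrite -(cl_eq zx) (cl_eq zy) cl_refl.
  move=> u uts; have [e|ne] := eqVneq u t.
    have -> : [set y in A :\: cl x | ty y == u] = [set y in A | ty y == u] :\: cl x.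
      by apply/setP=> y; rewrite !inE andbA.
    rewrite cardsD (setIidPr _).
      by rewrite card_cl xt e hd /= eqxx mulnDr muln1 addKn.
    apply/subsetP=> y yx; rewrite inE (ty_cl yx) xt e eqxx andbT.
    exact: (subsetP (Acl x xA)).
  have := cnt u; rewrite inE uts orbT => /(_ isT) /=.
  rewrite [t == u]eq_sym (negbTE ne) add0n => <-; apply: eq_card => y.
  rewrite !inE; case: (eqVneq (ty y) u) => [yu|]; rewrite ?andbF // !andbT.
  by case: (boolP (y \in cl x)) => //= /ty_cl yx; rewrite -yu yx xt eqxx in ne.
elim: (enum _) => [|y r IHr] //= sE.
rewrite sE ?mem_head // IHr => [|z zr]; last by rewrite sE // inE zr orbT.
by rewrite mulSn.
Qed.

Lemma good_markingP (A : {set T}) ts m x0 t0 : reflect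
  [/\ size m = size ts, forall i, i < size ts -> nth x0 m i \in A,
      forall i, i < size ts -> ty (nth x0 m i) = nth t0 ts i &
      forall i j, i < j < size ts -> nth x0 m j \notin cl (nth x0 m i)]
  (good_marking A ts m).
Proof.
elim: ts A m => [|t ts IH] A [|x m] /=; try by constructor=> // -[].
  by constructor; split=> // i j /andP[].
apply: (iffP and3P) => [[xA /eqP xt /IH[sm mA mt mc]]|[[sm] mA mt mc]].
  split=> [|[|i]|[|i]|[|i] [|j]] //=; rewrite ?sm //.
  - by rewrite ltnS => /mA/setDP[].
  - by rewrite ltnS => /mt.
  - by rewrite ltnS => /mA/setDP[].
  by rewrite !ltnS => /mc.
split; first exact: (mA 0).
  by apply/eqP; apply: (mt 0).
apply/IH; split=> // [i li|i li|i j lij].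
- by rewrite inE (mc 0 i.+1) //= (mA i.+1).
- exact: (mt i.+1).
exact: (mc i.+1 j.+1).
Qed.

End Markings.

(** * Nodes of the quotient and their types *)

Section Classes.

Variables (D : finType) (k : nat) (s f : {perm D}).
Hypotheses (k_gt0 : 0 < k) (fs : commute f s) (fk : (f ^+ k)%g = 1%g).

(** The orbit under the commuting [s] and [f]: all half-edges above one node of the quotient by
    [f]. *)
Definition orbit2 (x : D) : {set D} :=
  [set y | [exists i : 'I_#[s]%g, exists j : 'I_#[f]%g,
     y == (s ^+ i)%g ((f ^+ j)%g x)]].

Lemma orbit2P x y : reflect (exists i j, y = (s ^+ i)%g ((f ^+ j)%g x)) (y \in orbit2 x).
Proof.
rewrite inE; apply: (iffP existsP) => [[i /existsP[j /eqP->]]|[i [j ->]]].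
  by exists i, j.
exists (Ordinal (ltn_pmod i (order_gt0 s))); apply/existsP.
exists (Ordinal (ltn_pmod j (order_gt0 f))); apply/eqP.
by rewrite /= !expg_mod ?expg_order.
Qed.

Lemma orbit2_refl x : x \in orbit2 x.
Proof. by apply/orbit2P; exists 0, 0; rewrite !expg0 !perm1. Qed.

Lemma sf_commute i j x : (f ^+ j)%g ((s ^+ i)%g x) = (s ^+ i)%g ((f ^+ j)%g x).
Proof.
apply: commute_permE; exact: (commuteX2 _ _ fs).
Qed.

Lemma expg_cancel (g : {perm D}) i x : (g ^+ (#[g]%g * i - i))%g ((g ^+ i)%g x) = x.
Proof.
by rewrite -permM -expgD subnKC ?leq_pmull ?order_gt0 // expgM expg_order expg1n perm1.
Qed.

Lemma orbit2_trans x y z : y \in orbit2 x -> z \in orbit2 y -> z \in orbit2 x.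
Proof.
move=> /orbit2P[i [j ->]] /orbit2P[i' [j' ->]]; apply/orbit2P.
exists (i + i'), (j + j'); rewrite sf_commute -[in RHS]permM.
by rewrite !expgD !permM.
Qed.

Lemma orbit2_sym x y : y \in orbit2 x -> x \in orbit2 y.
Proof.
move/orbit2P=> [i [j ->]]; apply/orbit2P.
exists (#[s]%g * i - i), (#[f]%g * j - j).
by rewrite sf_commute !expg_cancel.
Qed.

Lemma orbit2_eq x y : y \in orbit2 x -> orbit2 y = orbit2 x.
Proof.
move=> yx; apply/setP=> z; apply/idP/idP; first exact: orbit2_trans.
exact/orbit2_trans/orbit2_sym.
Qed.

(* t.1 is the degree of the image of the node of x in the quotient by f, and
   turning once around that image acts as f if t.2 holds, trivially otherwise. *)
Definition typed (t : nat * bool) (x : D) : Prop :=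
  [/\ 0 < t.1, (s ^+ t.1)%g x = (f ^+ t.2)%g x &
    forall i a i' a', i < t.1 -> a < k -> i' < t.1 -> a' < k ->
      (s ^+ i)%g ((f ^+ a)%g x) = (s ^+ i')%g ((f ^+ a')%g x) -> i = i' /\ a = a'].

Lemma typed_mul t x q : typed t x ->
  (s ^+ (t.1 * q))%g x = (f ^+ (t.2 * q))%g x.
Proof.
case=> _ tx _; elim: q => [|q IH]; first by rewrite !muln0 !expg0 perm1.
by rewrite !mulnS !expgD !permM tx -sf_commute IH -!permM -!expgD addnC.
Qed.

Lemma typed_reduce t x i a : typed t x -> exists i' a', [/\ i' < t.1, a' < k &
  (s ^+ i)%g ((f ^+ a)%g x) = (s ^+ i')%g ((f ^+ a')%g x)].
Proof.
move=> tx; have [t0 _ _] := tx.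
exists (i %% t.1), ((t.2 * (i %/ t.1) + a) %% k); rewrite !ltn_pmod //; split=> //.
rewrite {1}(divn_eq i t.1) (expg_mod _ fk) expgD permM -sf_commute.
by rewrite [_ * t.1]mulnC (typed_mul _ tx) expgD permM.
Qed.

Lemma card_orbit2 t x : typed t x -> #|orbit2 x| = k * t.1.
Proof.
move=> tx; have [t0 _ inj] := tx.
pose F (p : 'I_t.1 * 'I_k) := (s ^+ p.1)%g ((f ^+ p.2)%g x).
have -> : orbit2 x = F @: setT.
  apply/setP=> y; apply/orbit2P/imsetP => [[i [a ->]]|[[i a] _ ->]]; last by exists i, a.
  have [i' [a' [li la ->]]] := typed_reduce i a tx.
  by exists (Ordinal li, Ordinal la).
rewrite card_imset ?cardsT ?card_prod ?card_ord 1?mulnC //.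
move=> [i a] [i' a'] /inj/= []; rewrite ?ltn_ord //.
by move=> /val_inj -> /val_inj ->.
Qed.

Lemma typed_orbit2 t x y : y \in orbit2 x -> typed t x -> typed t y.
Proof.
case/orbit2P=> i [j ->] [t0 tx inj]; rewrite -permM.
set g := (f ^+ j * s ^+ i)%g.
have sg p z : (s ^+ p)%g (g z) = g ((s ^+ p)%g z).
  rewrite !permM sf_commute; move: ((f ^+ j)%g z) => w.
  by rewrite -!permM -!expgD addnC.
have fg p z : (f ^+ p)%g (g z) = g ((f ^+ p)%g z).
  by rewrite !permM sf_commute; congr (_ _); rewrite -!permM -!expgD addnC.
split; [by [] | by rewrite sg fg tx |].
by move=> i1 a i' a' l1 l2 l3 l4; rewrite !fg !sg => /perm_inj; apply: inj.
Qed.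

Lemma card_porbit_period p x : 0 < p -> (s ^+ p)%g x = x ->
    (forall i j, i < p -> j < p -> (s ^+ i)%g x = (s ^+ j)%g x -> i = j) ->
  #|porbit s x| = p.
Proof.
move=> p0 px inj.
have -> : porbit s x = (fun i : 'I_p => (s ^+ i)%g x) @: setT.
  apply/setP=> y; apply/porbitP/imsetP => [[i ->]|[i _ ->]]; last by exists i.
  exists (Ordinal (ltn_pmod i p0)) => //=.
  rewrite {1}(divn_eq i p) expgD permM mulnC; congr (_ _).
  by elim: (i %/ p) => [|q IH]; rewrite ?muln0 ?expg0 ?perm1 // mulnSr expgD permM IH.
rewrite card_imset ?cardsT ?card_ord // => i j /inj e.
by apply/val_inj/e; rewrite ltn_ord.
Qed.

(** If [t.2] holds, one turn around the quotient node leads to the next sheet, so the [k] sheets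
    form a single node upstairs; otherwise every sheet carries its own node. *)
Lemma typed_degree t x : typed t x ->
  #|porbit s x| = if t.2 then k * t.1 else t.1.
Proof.
case: t => dl [] [/= t0 tx inj]; last first.
  apply: card_porbit_period => // [|i j li lj e]; first by rewrite tx expg0 perm1.
  by case: (inj i 0 j 0) => //; rewrite expg0 perm1.
have txq q : (s ^+ (dl * q))%g x = (f ^+ q)%g x.
  by have := @typed_mul (dl, true) x q; rewrite /= mul1n; apply; split.
apply: card_porbit_period; first by rewrite muln_gt0 k_gt0.
  by rewrite mulnC txq fk perm1.
have red i : (s ^+ i)%g x = (s ^+ (i %% dl))%g ((f ^+ (i %/ dl))%g x).
  by rewrite {1}(divn_eq i dl) mulnC expgD permM txq.
move=> i j li lj; rewrite (red i) (red j) => /inj[]; rewrite ?ltn_pmod //;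
  rewrite ?ltn_divLR //.
by move=> em ed; rewrite (divn_eq i dl) em ed -divn_eq.
Qed.

Lemma typed_holonomy t x : 1 < k -> typed t x -> t.2 = (f x \in porbit s x).
Proof.
case: t => dl [] k1 [/= t0 tx inj]; apply/esym.
  by move: tx; rewrite expg1 => <-; apply: mem_porbit.
apply/negbTE/porbitP=> -[i e].
have sdl q : (s ^+ (dl * q))%g x = x.
  elim: q => [|q IH]; first by rewrite muln0 expg0 perm1.
  by rewrite mulnSr expgD permM IH tx expg0 perm1.
have [] // := inj 0 1 (i %% dl) 0 t0 k1 (ltn_pmod i t0) k_gt0.
by rewrite !expg0 expg1 !perm1 e [in LHS](divn_eq i dl) mulnC expgD permM sdl.
Qed.

End Classes.

(** * Coordinates on a cyclic covering *)

Section Frames.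

Variables (k' : nat) (ts : seq (nat * bool)).
Notation k := k'.+1.
Notation N := (size ts).
Implicit Types v : 'I_N.

Definition vtype v : nat * bool := nth (0, false) ts v.
(* The half-edges of the quotient, and those of the k sheets above them. *)
Definition slot : finType := {v : 'I_N & 'I_((vtype v).1)}.
Definition cell : finType := (slot * 'I_k)%type.

Definition shift_sheet (p : cell) : cell := (p.1, (p.2 + Zp1)%R).
(** The model of [s]: turning around a quotient node changes the sheet only when passing from its
    last slot back to the first, and only if its flag is set. *)
Definition next_cell (p : cell) : cell :=
  (Tagged (fun v => 'I_((vtype v).1)) (ordS (tagged p.1)),
   if (vtype (tag p.1)).2 && ((tagged p.1).+1 == (vtype (tag p.1)).1)
   then (p.2 + Zp1)%R else p.2).

Lemma next_cell_inj : injective next_cell.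
Proof.
move=> [[v t] a] [[v' t'] a'] /eqP; rewrite xpair_eqE => /andP[/eqP/= e1].
have ev : v = v' := congr1 tag e1.
subst v'; have et : ordS t = ordS t' by move/eqP: e1; rewrite eq_Tagged => /eqP.
by rewrite (ordS_inj et); case: ifP => _ /eqP; [move=> /addIr-> | move->].
Qed.

Lemma shift_sheet_inj : injective shift_sheet.
Proof.
move=> [q a] [q' a'] /eqP; rewrite xpair_eqE => /andP[/eqP/= -> /eqP e].
by rewrite (addIr _ e).
Qed.

Lemma next_shift p : next_cell (shift_sheet p) = shift_sheet (next_cell p).
Proof.
by case: p => [[v t] a]; rewrite /next_cell /shift_sheet /=; case: ifP.
Qed.

Lemma card_cell : #|{: cell}| = k * sumn [seq t.1 | t <- ts].
Proof.
rewrite card_prod card_ord mulnC; congr (_ * _).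
rewrite card_tagged sumnE big_map big_enum /= sumnE big_map.
rewrite (big_nth (0, false)) big_mkord.
by apply: eq_bigr => v _; rewrite card_ord.
Qed.

Lemma inZpS (i : nat) : inZp i.+1 = (inZp i + Zp1 :> 'I_k)%R.
Proof. by apply/val_inj; rewrite /= modnDm addn1. Qed.

Section Frame.

Variables (D : finType) (s f : {perm D}) (m : 'I_N -> D).

Definition place (p : cell) : D :=
  (s ^+ (tagged p.1))%g ((f ^+ p.2)%g (m (tag p.1))).

(** A coordinate system: [m] chooses a half-edge above each quotient node, and [place] turns
    [next_cell] and [shift_sheet] into [s] and [f]. *)
Definition frame : Prop :=
  [/\ commute f s, (f ^+ k)%g = 1%g,
      forall v, typed k s f (vtype v) (m v) & bijective place].

Lemma place0 v (v0 : 0 < (vtype v).1) : place (Tagged _ (Ordinal v0), 0%R) = m v.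
Proof. by rewrite /place /= !expg0 !perm1. Qed.

Hypotheses (fs : commute f s) (fk : (f ^+ k)%g = 1%g).
Hypothesis mt : forall v, typed k s f (vtype v) (m v).

Lemma f_inZp i x : (f ^+ (inZp i : 'I_k))%g x = (f ^+ i)%g x.
Proof. by rewrite /= expg_mod. Qed.

Lemma f_addZp1 (a : 'I_k) x : (f ^+ (a + Zp1)%R)%g x = f ((f ^+ a)%g x).
Proof. by rewrite -{1}(valZpK a) -inZpS f_inZp expgSr permM. Qed.

Lemma place_shift p : place (shift_sheet p) = f (place p).
Proof.
rewrite /place /= f_addZp1; apply/esym.
by have := sf_commute fs (tagged p.1) 1 ((f ^+ p.2)%g (m (tag p.1))); rewrite expg1.
Qed.

Lemma place_next p : place (next_cell p) = s (place p).
Proof.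
case: p => [[v t] a]; rewrite /place /next_cell /= -[in RHS]permM -expgSr.
have [v0 vt _] := mt v.
have [le|] := ltnP t.+1 (vtype v).1.
  by rewrite (modn_small le) (ltn_eqF le) andbF.
move=> le; have e : t.+1 = (vtype v).1 by apply/eqP; rewrite eqn_leq ltn_ord le.
rewrite e eqxx andbT modnn expg0 perm1 -sf_commute // vt.
by case: ((vtype v).2); rewrite ?f_addZp1 ?expg1 ?expg0 ?perm1 // -!permM -expgS -expgSr.
Qed.

End Frame.

Lemma frame_conj (D : finType) (s f : {perm D}) m (g : {perm D}) :
  frame s f m -> frame (s ^ g)%g (f ^ g)%g (g \o m) /\
  place (s ^ g)%g (f ^ g)%g (g \o m) =1 g \o place s f m.
Proof.
move=> [fs fk mt bij].
have pl : place (s ^ g)%g (f ^ g)%g (g \o m) =1 g \o place s f m.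
  by move=> p; rewrite /place /= -!conjXg !permJ.
split=> //; split.
- by rewrite /commute -!conjMg fs.
- by rewrite -conjXg fk conj1g.
- move=> v; have [v0 vt inj] := mt v; split=> //=.
    by rewrite -!conjXg !permJ vt.
  move=> i a i' a' l1 l2 l3 l4; rewrite -!conjXg !permJ => /perm_inj.
  exact: inj.
apply: (eq_bij _ (fsym pl)).
exact: (bij_comp (Bijective (permK g) (permKV g)) bij).
Qed.

(** The model on the cells is transported to [D] by an arbitrary bijection. *)
Lemma frame_exists (D : finType) : #|D| = #|{: cell}| ->
    (forall v, 0 < (vtype v).1) ->
  exists (s f : {perm D}) m, frame s f m.
Proof.
move=> cD v0; pose b (p : cell) : D := enum_val (cast_ord (esym cD) (enum_rank p)).
pose c (x : D) : cell := enum_val (cast_ord cD (enum_rank x)).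
have bK : cancel b c by move=> p; rewrite /b /c enum_valK cast_ordKV enum_rankK.
have cK : cancel c b by move=> x; rewrite /b /c enum_valK cast_ordK enum_rankK.
have s_inj : injective (b \o next_cell \o c).
  by apply: inj_comp (can_inj cK); apply: inj_comp (can_inj bK) next_cell_inj.
have f_inj : injective (b \o shift_sheet \o c).
  by apply: inj_comp (can_inj cK); apply: inj_comp (can_inj bK) shift_sheet_inj.
pose s := perm s_inj; pose f := perm f_inj.
have sE p : s (b p) = b (next_cell p) by rewrite permE /= bK.
have fE p : f (b p) = b (shift_sheet p) by rewrite permE /= bK.
pose m v := b (Tagged (fun v => 'I_((vtype v).1)) (Ordinal (v0 v)), 0%R).
have fX q (x : 'I_k) i : (f ^+ i)%g (b (q, x)) = b (q, (x + inZp i)%R).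
  elim: i => [|i IH]; first by rewrite expg0 perm1 (_ : inZp 0 = 0%R) ?addr0 //; apply/val_inj.
  by rewrite expgSr permM IH fE /shift_sheet /= -addrA -inZpS.
have sX v x i (iv : i < (vtype v).1) :
    (s ^+ i)%g (b (Tagged (fun v => 'I_((vtype v).1)) (Ordinal (v0 v)), x)) =
    b (Tagged (fun v => 'I_((vtype v).1)) (Ordinal iv), x).
  elim: i iv => [|i IH] iv; first by rewrite expg0 perm1; congr (b (Tagged _ _, _)); apply/val_inj.
  rewrite expgSr permM (IH (ltnW iv)) sE /next_cell /= (ltn_eqF iv) andbF.
  by congr (b (Tagged _ _, _)); apply/val_inj; rewrite /= modn_small.
have pl : place s f m =1 b.
  move=> [[v t] a]; rewrite /place /m /= fX add0r valZpK.
  by rewrite (sX v a t (ltn_ord t)); congr (b (Tagged _ _, _)); apply/val_inj.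
exists s, f, m; split.
- apply/permP=> x; rewrite -[x]cK !permM sE !fE sE.
  by rewrite next_shift.
- apply/permP=> x; rewrite -[x]cK perm1; case: (c x) => q a; rewrite fX.
  by rewrite (_ : inZp k = 0%R) ?addr0 //; apply/val_inj; rewrite /= modnn.
- move=> v; split=> //.
    rewrite -[X in (s ^+ X)%g _](prednK (v0 v)) expgSr permM.
    have lt : (vtype v).1.-1 < (vtype v).1 by rewrite prednK.
    rewrite (sX v 0%R _ lt) sE /next_cell /= prednK // eqxx andbT.
    rewrite fX; congr (b _); congr (_, _).
      by congr Tagged; apply/val_inj; rewrite /= prednK // modnn.
    by case: (vtype v).2; rewrite add0r //; apply/val_inj.
  move=> i a i' a' li la li' la'.
  rewrite /m !fX !add0r (sX v _ _ li) (sX v _ _ li') => /(can_inj bK) /eqP.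
  rewrite xpair_eqE eq_Tagged -!(inj_eq val_inj) /= !modn_small //.
  by move=> /andP[/eqP-> /eqP->].
by apply: (eq_bij _ (fsym pl)); exists c.
Qed.

End Frames.

Section FrameCount.

Variables (k' : nat) (ts : seq (nat * bool)) (D : finType) (x0 : D).
Notation k := k'.+1.
Notation N := (size ts).
Notation vtype := (@vtype ts).
Notation frame := (@frame k' ts D).
Notation place := (@place k' ts D).
Implicit Types (s f g : {perm D}) (m : 'I_N -> D).

Hypothesis hol1 : k' = 0 -> {in ts, forall t, t.2 = false}.

(** The flag tells whether [f] preserves the node, and the degree then gives [t.1]. With one sheet
    [f] is trivial and cannot reveal the flag, which [hol1] fixes instead. *)
Lemma typed_unique s f x t u : commute f s -> (f ^+ k)%g = 1%g ->
  t \in ts -> u \in ts -> typed k s f t x -> typed k s f u x -> t = u.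
Proof.
move=> fs fk tts uts tx ux.
have e2 : t.2 = u.2.
  case: (posnP k') => [k0|kpos]; first by rewrite !hol1.
  have k1 : 1 < k by [].
  by rewrite (typed_holonomy (ltn0Sn k') k1 tx) (typed_holonomy (ltn0Sn k') k1 ux).
have := typed_degree (ltn0Sn k') fs fk ux; rewrite (typed_degree (ltn0Sn k') fs fk tx) -e2.
case: t u e2 {tts uts tx ux} => [t b] [u c] /= ->.
by case: c => [/eqP|->] //; rewrite eqn_pmul2l // => /eqP->.
Qed.

Lemma vtype_mem (v : 'I_N) : vtype v \in ts.
Proof. exact: mem_nth. Qed.

Lemma frame_of_marks s f m : #|D| = #|{: cell k' ts}| ->
    commute f s -> (f ^+ k)%g = 1%g -> (forall v, typed k s f (vtype v) (m v)) ->
    (forall u v, u != v -> m v \notin orbit2 s f (m u)) ->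
  frame s f m.
Proof.
move=> cD fs fk mt sep; split=> //; apply: inj_card_bij; last by rewrite cD.
move=> [[u i] a] [[v j] b] e.
have uv : u = v.
  apply/eqP/negPn/negP=> /sep/negP; apply.
  have h1 : place s f m (existT _ u i, a) \in orbit2 s f (m u).
    by apply/orbit2P; exists i, a.
  have h2 : place s f m (existT _ v j, b) \in orbit2 s f (m v).
    by apply/orbit2P; exists j, b.
  by have := orbit2_sym fs h2; rewrite -e; apply: (orbit2_trans fs h1).
subst v; have [_ _ inj] := mt u.
have [/val_inj-> /val_inj->//] := inj i a j b (ltn_ord _) (ltn_ord _) (ltn_ord _) (ltn_ord _) e.
Qed.

Section FrameType.

Variables (s f : {perm D}) (m : 'I_N -> D) (c : D -> cell k' ts).
Hypotheses (fr : frame s f m) (cK : cancel c (place s f m)) (placeK : cancel (place s f m) c).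

Definition frame_type (x : D) : nat * bool := vtype (tag (c x).1).

Let fs : commute f s. Proof. by case: fr. Qed.
Let fk : (f ^+ k)%g = 1%g. Proof. by case: fr. Qed.
Let mt v : typed k s f (vtype v) (m v). Proof. by case: fr. Qed.

Lemma place_orbit2 p : place s f m p \in orbit2 s f (m (tag p.1)).
Proof. by apply/orbit2P; exists (tagged p.1), p.2. Qed.

Lemma orbit2_place v x : (x \in orbit2 s f (m v)) = (tag (c x).1 == v).
Proof.
apply/idP/eqP => [/orbit2P[i [j ->]]|<-]; last first.
  by rewrite -{1}(cK x) place_orbit2.
have [i' [a' [li la ->]]] := typed_reduce (ltn0Sn k') fs fk i j (mt v).
by rewrite -[X in c X]/(place s f m (Tagged _ (Ordinal li), Ordinal la)) placeK.
Qed.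

Lemma frame_typed x : typed k s f (frame_type x) x.
Proof. by apply: (typed_orbit2 fs) (mt _); rewrite orbit2_place. Qed.

Lemma frame_type_mem x : frame_type x \in ts.
Proof. exact: vtype_mem. Qed.

Lemma frame_type_orbit2 x y : y \in orbit2 s f x -> frame_type y = frame_type x.
Proof.
move=> yx; apply: (typed_unique fs fk (frame_type_mem _) (frame_type_mem _) (frame_typed y)).
exact: (typed_orbit2 fs yx (frame_typed x)).
Qed.

Lemma card_frame_type t :
  #|[set x | frame_type x == t]| = k * t.1 * count_mem t ts.
Proof.
rewrite -sum1_card (partition_big (fun x => tag (c x).1) (fun v => vtype v == t)) /=;
  last by move=> x; rewrite inE.
transitivity (\sum_(v | vtype v == t) k * t.1).
  apply: eq_bigr => v /eqP vt; rewrite -vt -(card_orbit2 (ltn0Sn k') fs fk (mt v)) -sum1_card.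
  apply: eq_bigl => x; rewrite inE orbit2_place.
  by rewrite /frame_type; have [->|] := eqVneq (tag (c x).1) v; rewrite ?andbF ?eqxx.
rewrite sum_nat_const mulnC; congr (_ * _).
by rewrite -sum1_card -sum1_count (big_nth (0, false)) big_mkord.
Qed.

End FrameType.

(** Evaluation at the base points of the first frame is a bijection from the isomorphisms onto the
    good markings for [s] and [f]: a good marking is itself a frame, and equating coordinates
    defines the isomorphism. *)
Theorem card_frame_isos s0 f0 m0 s f m1 : frame s0 f0 m0 -> frame s f m1 ->
  #|[set g : {perm D} | (s0 ^ g == s)%g && (f0 ^ g == f)%g]| =
  marking_count (fun t => k * t.1) ts.
Proof.
move=> fr0 fr1; have [fs fk mt [c placeK cK]] := fr1.
have cD : #|D| = #|{: cell k' ts}|.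
  by case: fr0 => _ _ _ /bij_eq_card->.
pose ty := frame_type c.
have szE : size (markings (orbit2 s f) ty [set: D] ts) =
    marking_count (fun t => k * t.1) ts.
  apply: size_markings => //.
  - exact: orbit2_refl.
  - exact: orbit2_eq.
  - exact: (frame_type_orbit2 fr1 cK placeK).
  - by move=> x; apply: (card_orbit2 (ltn0Sn k') fs fk); exact: (frame_typed fr1 cK placeK).
  - move=> t _; rewrite -(card_frame_type fr1 cK placeK t).
    by apply: eq_card => x; rewrite !inE.
rewrite -szE; set F := [set g | _].
pose phi g := [seq g (m0 v) | v <- enum 'I_N].
rewrite cardE -(size_map phi); apply/perm_size/uniq_perm.
- rewrite map_inj_in_uniq ?enum_uniq // => g h; rewrite !mem_enum !inE.
  move=> /andP[/eqP gs /eqP gf] /andP[/eqP hs /eqP hf] /eq_in_map e.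
  have [_ gE] := frame_conj g fr0; have [_ hE] := frame_conj h fr0.
  have em v : g (m0 v) = h (m0 v) by apply: e; rewrite mem_enum.
  case: fr0 => _ _ _ [c0 place0K c0K].
  apply/permP=> x; rewrite -[x]c0K.
  have := gE (c0 x); have := hE (c0 x); rewrite /= gs gf hs hf => <- <-.
  by rewrite /place /= em.
- exact: uniq_markings.
move=> ms; rewrite mem_markings; apply/mapP/(good_markingP _ _ _ _ _ x0 (0, false)).
  case=> g; rewrite mem_enum inE => /andP[/eqP gs /eqP gf] ->.
  have [] := frame_conj g fr0; rewrite gs gf => frg plE.
  have nthE (v : 'I_N) : nth x0 (phi g) v = g (m0 v).
    by rewrite (nth_map v) ?size_enum_ord // nth_ord_enum.
  have [_ _ mtg [cg placegK cgK]] := frg.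
  split; first by rewrite size_map size_enum_ord.
  - by move=> i _; rewrite inE.
  - move=> i iN; rewrite (nthE (Ordinal iN)).
    apply: (typed_unique fs fk (frame_type_mem _ _) (mem_nth _ iN)).
      exact: (frame_typed fr1 cK placeK).
    exact: (mtg (Ordinal iN)).
  move=> i j /andP[ij jN]; rewrite (nthE (Ordinal jN)) (nthE (Ordinal (ltn_trans ij jN))).
  rewrite (orbit2_place frg cgK placegK); set vj := Ordinal jN; set vi := Ordinal _.
  have: g (m0 vj) \in orbit2 s f ((g \o m0) vj) by apply: orbit2_refl.
  rewrite (orbit2_place frg cgK placegK) => /eqP->.
  by rewrite -(inj_eq val_inj) /= gtn_eqF.
case=> sm _ mty msep; pose m (v : 'I_N) := nth x0 ms v.
have mtm v : typed k s f (vtype v) (m v).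
  by rewrite /vtype -mty //; apply: (frame_typed fr1 cK placeK).
have frm : frame s f m.
  apply: frame_of_marks => // u v uv; have [uv'|vu|/val_inj e] := ltngtP u v.
  - by apply: msep; rewrite uv' /=.
  - apply: contraNN (msep v u _); last by rewrite vu /=.
    exact: orbit2_sym.
  by rewrite e eqxx in uv.
have [_ _ mt0 [c0 place0K c0K]] := fr0.
have [_ _ _ bijm] := frm.
have g_inj : injective (place s f m \o c0).
  exact: inj_comp (bij_inj bijm) (can_inj c0K).
pose g := perm g_inj.
have gE p : g (place s0 f0 m0 p) = place s f m p by rewrite permE /= place0K.
have [fs0 fk0 _ _] := fr0.
exists g; last first.
  apply: (@eq_from_nth _ x0); first by rewrite size_map size_enum_ord.
  move=> i; rewrite sm => iN.
  rewrite (nth_map (Ordinal iN)) ?size_enum_ord // (nth_ord_enum _ (Ordinal iN)).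
  have [v0 _ _] := mt0 (Ordinal iN).
  by rewrite -(@place0 k' ts D s0 f0 m0 _ v0) gE place0.
rewrite mem_enum inE; apply/andP; split; apply/eqP/permP=> x.
  rewrite -(permKV g x) permJ; set y := (g^-1)%g x.
  rewrite -[y]c0K gE -(place_next fs0 fk0 mt0) gE.
  exact: (place_next fs fk mtm).
rewrite -(permKV g x) permJ; set y := (g^-1)%g x.
rewrite -[y]c0K gE -(place_shift _ fs0 fk0) gE.
exact: (place_shift _ fs fk).
Qed.

(** Conjugating one frame by all permutations of [D] yields every pair that admits a frame, each as
    often as there are isomorphisms. *)
Corollary card_frames s0 f0 m0 : frame s0 f0 m0 ->
  (#|[set sf : {perm D} * {perm D} | `[< exists m, frame sf.1 sf.2 m >]]|
   * marking_count (fun t => k * t.1) ts = #|D|`!)%N.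
Proof.
move=> fr0.
have -> : #|D|`! = #|[set: {perm D}]|.
  rewrite -cardsT -card_perm; apply: eq_card => g; rewrite !inE.
  by apply/subsetP=> x; rewrite inE.
rewrite -[RHS]sum1_card (partition_big (fun g : {perm D} => (s0 ^ g, f0 ^ g)%g)
  (fun sf => `[< exists m, frame sf.1 sf.2 m >])) /=; last first.
  move=> g _; apply/asboolP; exists (g \o m0).
  by have [] := frame_conj g fr0.
rewrite -sum_nat_const; apply: eq_big => [sf|[s f]]; first by rewrite inE.
rewrite inE => /asboolP[m1 /= fr1]; rewrite -(card_frame_isos fr0 fr1) -sum1_card.
by apply: eq_bigl => g; rewrite !inE xpair_eqE.
Qed.

End FrameCount.

(** * Lifting matchings from the quotient *)

Section Voltages.

Variables (k' : nat) (Q : finType).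
Notation k := k'.+1.
Implicit Types (a : {perm Q}) (w : {ffun Q -> 'I_k}).

Definition self_inverse : {set 'I_k} := [set x | (x != 0%R) && (x == - x)%R].

(* A half-edge glued to itself in the quotient must be shifted by a nonzero
   self-inverse amount, since the lifted matching has no fixed point. *)
Definition voltages a : {set {ffun Q -> 'I_k}} :=
  [set w : {ffun Q -> 'I_k} | [forall q, (w (a q) == - w q)%R] &&
     [forall q, (a q == q) ==> (w q != 0%R)]].

Lemma voltagesP a w : reflect
  ((forall q, w (a q) = - w q)%R /\ (forall q, a q = q -> w q != 0%R))
  (w \in voltages a).
Proof.
rewrite inE; apply: (iffP andP) => [[/forallP h1 /forallP h2]|[h1 h2]].
  split=> q; first exact/eqP.
  by move=> aq; have := h2 q; rewrite aq eqxx.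
split; apply/forallP=> q; first exact/eqP.
by apply/implyP => /eqP /h2.
Qed.

(** On each 2-cycle the value at the point in [half a] is free and the partner takes the opposite; a
    fixed point takes a nonzero self-inverse value. *)
Lemma card_voltages a : involutive a ->
  #|voltages a| = k ^ #|half a| * #|self_inverse| ^ #|[set q | a q == q]|.
Proof.
move=> aK.
pose F q : {set 'I_k} := if q \in half a then setT
   else if a q == q then self_inverse else [set 0%R].
pose ext (w : {ffun Q -> 'I_k}) : {ffun Q -> 'I_k} :=
  [ffun q => if (q \in half a) || (a q == q) then w q else (- w (a q))%R].
have ext_half w q : q \in half a -> ext w q = w q by move=> h; rewrite ffunE h.
have ext_fix w q : a q = q -> ext w q = w q.
  by move=> h; rewrite ffunE h eqxx orbT.
have nhalf q : q \notin half a -> a q != q -> a q \in half a.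
  by move=> h1 h2; rewrite half_or.
have img : voltages a = ext @: family F.
  apply/setP=> w; apply/voltagesP/imsetP => [[w1 w2]|[u /familyP uF ->]].
    exists [ffun q => if (q \in half a) || (a q == q) then w q else 0%R].
      apply/familyP=> q; rewrite ffunE /F.
      case: (boolP (q \in half a)) => [_|h]; first by rewrite inE.
      have [aq|_] := eqVneq (a q) q; last by rewrite inE.
      by rewrite inE (w2 _ aq) -(w1 q) aq eqxx.
    apply/ffunP=> q; rewrite !ffunE.
    case: (boolP (q \in half a)) => //= h; case: (eqVneq (a q) q) => //= h2.
    by rewrite nhalf //= -w1 aK.
  split=> [q|q aq]; last first.
    rewrite ext_fix //; have := uF q; rewrite /F.
    case: (boolP (q \in half a)) => [/half_supp|_]; first by rewrite aq eqxx.
    by rewrite aq eqxx inE => /andP[].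
  have [aq|aq] := eqVneq (a q) q.
    rewrite aq ext_fix //; have := uF q; rewrite /F.
    case: (boolP (q \in half a)) => [/half_supp|_]; first by rewrite aq eqxx.
    by rewrite aq eqxx inE => /andP[_ /eqP].
  have [h|h] := boolP (q \in half a).
    rewrite [in RHS]ext_half // ffunE aK half_or // h /= eq_sym (negbTE aq).
    by [].
  by rewrite (ext_half _ _ (nhalf _ h aq)) ffunE (negbTE h) (negbTE aq) opprK.
rewrite img card_in_imset; last first.
  move=> u w /familyP uF /familyP wF e; apply/ffunP=> q.
  have [h|h] := boolP (q \in half a); first by rewrite -(ext_half u) // e ext_half.
  have [aq|aq] := eqVneq (a q) q; first by rewrite -(ext_fix u) // e ext_fix.
  have := uF q; have := wF q; rewrite /F (negbTE h) (negbTE aq).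
  by rewrite !inE => /eqP-> /eqP->.
rewrite card_family foldrE big_image /= (bigID (mem (half a))) /=.
congr (_ * _).
  rewrite (eq_bigr (fun=> k)) => [|q h]; last by rewrite /F h cardsT card_ord.
  by rewrite prod_nat_const.
rewrite (bigID (fun q => a q == q)) /= [X in _ * X]big1 ?muln1; last first.
  by move=> q /andP[h aq]; rewrite /F (negbTE h) (negbTE aq) cards1.
rewrite -prod_nat_const; apply: eq_big => q.
  rewrite inE andbC; have [aq|//] := eqVneq (a q) q.
  by apply/negP=> /half_supp; rewrite aq eqxx.
by case/andP=> h aq; rewrite /F (negbTE h) aq.
Qed.

End Voltages.

Arguments voltages {k' Q} a.
Arguments voltagesP {k' Q a w}.

Section Lifts.

Variables (k' : nat) (ts : seq (nat * bool)) (D : finType).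
Notation k := k'.+1.
Notation N := (size ts).
Notation slot := (slot ts).
Notation cell := (cell k' ts).
Variables (s f : {perm D}) (m : 'I_N -> D) (c : D -> cell).
Notation place := (@place k' ts D s f m).
Hypotheses (fr : frame k' s f m).
Hypotheses (placeK : cancel place c) (cK : cancel c place).

Let fs : commute f s. Proof. by case: fr. Qed.
Let fk : (f ^+ k)%g = 1%g. Proof. by case: fr. Qed.
Let mt v : typed k s f (vtype v) (m v). Proof. by case: fr. Qed.

Definition node_of (q : slot) : 'I_N := tag q.

Definition invariant_matchings : {set {perm D}} :=
  [set al : {perm D} | [&& [forall x, al (al x) == x], [forall x, al x != x],
     [forall x, al (f x) == f (al x)] & `[< transitive2 s al >]]].

Lemma invariant_matchingsP (al : {perm D}) : reflect
  [/\ involutive al, forall x, al x != x, forall x, al (f x) = f (al x) &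
      transitive2 s al] (al \in invariant_matchings).
Proof.
rewrite inE; apply: (iffP and4P).
  case=> /forallP h1 /forallP h2 /forallP h3 /asboolP h4.
  by split=> // x; [exact/eqP | exact/eqP].
case=> h1 h2 h3 h4; split; try exact/asboolP; apply/forallP=> x //; exact/eqP.
Qed.

Definition quotient_matchings : {set {perm slot} * {ffun slot -> 'I_k}} :=
  [set aw : {perm slot} * {ffun slot -> 'I_k} | [&& [forall q, aw.1 (aw.1 q) == q], aw.2 \in voltages aw.1 &
     `[< links node_of setT aw.1 >]]].

Lemma quotient_matchingsP (a : {perm slot}) (w : {ffun slot -> 'I_k}) : reflect
  [/\ involutive a, w \in voltages a & links node_of setT a]
  ((a, w) \in quotient_matchings).
Proof.
rewrite [(a, w) \in _]in_set /=; apply: (iffP and3P) => [[/forallP h1 h2 /asboolP h3]|[h1 h2 h3]].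
  by split=> // q; apply/eqP.
by split=> //; [apply/forallP=> q; apply/eqP | apply/asboolP].
Qed.

Definition lift_cell (a : {perm slot}) (w : {ffun slot -> 'I_k}) (p : cell) : cell :=
  (a p.1, (w p.1 + p.2)%R).

Lemma lift_cell_inj a w : injective (lift_cell a w).
Proof.
move=> [q x] [q' x'] /eqP; rewrite xpair_eqE => /andP[/eqP/perm_inj/= -> /eqP/= e].
by rewrite (addrI _ e).
Qed.

Lemma lift_matching_inj (aw : {perm slot} * {ffun slot -> 'I_k}) :
  injective (place \o lift_cell aw.1 aw.2 \o c).
Proof.
apply: inj_comp (can_inj cK); apply: inj_comp (can_inj placeK) _.
exact: lift_cell_inj.
Qed.

Definition lift_matching aw : {perm D} := perm (@lift_matching_inj aw).

Lemma lift_matchingE a w p : lift_matching (a, w) (place p) = place (lift_cell a w p).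
Proof. by rewrite permE /= placeK. Qed.

Lemma place_add q x (y : 'I_k) : place (q, (x + y)%R) = (f ^+ y)%g (place (q, x)).
Proof.
rewrite -{1}(valZpK y); elim: (val y) => [|i IH].
  by rewrite (_ : inZp 0 = 0%R) ?addr0 ?expg0 ?perm1 //; apply/val_inj.
rewrite inZpS addrA expgSr permM -IH.
exact: (place_shift m fs fk (q, _)).
Qed.

Lemma place_node (b : D -> bool) : (forall x, b (s x) = b x) ->
  forall q q' x, node_of q = node_of q' -> b (place (q, x)) = b (place (q', x)).
Proof.
move=> bs [v t] [v' t'] x /= ev; rewrite /node_of /= in ev; subst v'.
have bsX i y : b ((s ^+ i)%g y) = b y.
  elim: i => [|i IH]; first by rewrite expg0 perm1.
  by rewrite expgSr permM bs.
by rewrite /place /= !bsX.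
Qed.

(* Each case makes the lift of a connected quotient connected. *)
Definition anchored (a : {perm slot}) : Prop :=
  [\/ k' = 0, exists v : 'I_N, (vtype v).2 | k' = 1 /\ exists q, a q = q].

(** Connectivity of the quotient carries colours from node to node up to a shift of sheets, so it is
    enough to find one node [v0] above which all sheets have the same colour. *)
Lemma lift_transitive a w : w \in voltages a ->
  links node_of setT a -> anchored a -> transitive2 s (lift_matching (a, w)).
Proof.
move=> /voltagesP[wN w0] lk an b bs ba.
have slot_of v : {q : slot | node_of q = v}.
  have [v0 _ _] := mt v.
  by exists (existT _ v (Ordinal v0)).
pose B v x := b (place (sval (slot_of v), x)).
have BE q x : b (place (q, x)) = B (node_of q) x.
  by apply: place_node => //; rewrite (svalP (slot_of _)).
have Ba q x : B (node_of (a q)) (w q + x)%R = B (node_of q) x.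
  by rewrite -!BE -[RHS]ba lift_matchingE.
have [v1 _|noV] := pickP {: 'I_N}; last first.
  by move=> x; have := noV (tag (c x).1).
have [v0 B0] : exists v0, forall x, B v0 x = B v0 0%R.
  (* With one sheet this is clear; at a flagged node one turn along [s] leads to the next sheet; a
     fixed slot under two sheets has voltage 1 and joins them. *)
  case: an => [k0|[v hv]|[k1 [q aq]]].
  - exists v1 => x; congr (B _ _); apply/val_inj => /=.
    by have := ltn_ord x; move: (x : nat) => i; rewrite k0; case: i.
  - exists v => x.
    have e y : B v (y + Zp1)%R = B v y.
      rewrite /B; set q := sval _.
      have -> : place (q, (y + Zp1)%R) = f (place (q, y)).
        exact: (place_shift m fs fk (q, y)).
      have ev : tag q = v := svalP (slot_of v).
      have pt : place (q, y) \in orbit2 s f (m v) by rewrite -ev; apply: place_orbit2.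
      have [_ vt _] := typed_orbit2 fs pt (mt v).
      have -> : f (place (q, y)) = (f ^+ (vtype v).2)%g (place (q, y)) by rewrite hv expg1.
      rewrite -vt.
      by elim: (vtype v).1 => [|i IH]; rewrite ?expg0 ?perm1 // expgSr permM bs.
    rewrite -(valZpK x); elim: (val x) => [|i IH]; last by rewrite inZpS e.
    by congr (B _ _); apply/val_inj.
  exists (node_of q) => x.
  have e y : B (node_of q) (y + w q)%R = B (node_of q) y.
    by have := Ba q y; rewrite aq addrC.
  have [-> //|x0] := eqVneq x 0%R.
  have -> : x = w q; last by rewrite -[w q]add0r e.
  have := w0 _ aq; move: x0; move: (w q) => y; rewrite -!(inj_eq val_inj) /= => x0 y0.
  apply/val_inj => /=; have := ltn_ord x; have := ltn_ord y.
  by move: (x : nat) (y : nat) x0 y0 => i j; rewrite k1; lia.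
have eqB v x : B v x = B v0 0%R.
  pose C v := [forall x, B v x == B v0 0%R].
  have CE : forall q, C (node_of q) = C (node_of (a q)).
    move=> q; apply/forallP/forallP => H y.
      by rewrite -(subrK (w q) y) addrC Ba.
    by rewrite -(Ba q).
  have : C v = C v0 by apply: lk; rewrite ?inE.
  have -> : C v0 by apply/forallP=> y; rewrite B0.
  by move/forallP/(_ x)/eqP.
move=> x y; rewrite -(cK x) -(cK y).
case: (c x) => q z; case: (c y) => q' z'.
by rewrite !BE !eqB.
Qed.

(** A matching that commutes with [f] is determined by its values on sheet 0: the target slots give
    the involution, the target sheets the voltages. *)
Lemma card_invariant_matchings :
  (forall aw, aw \in quotient_matchings -> anchored aw.1) ->
  #|invariant_matchings| = #|quotient_matchings|.
Proof.
move=> anch; rewrite -(card_in_imset (f := lift_matching)); last first.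
  move=> [a w] [a' w'] _ _ /permP e.
  have e' p : lift_cell a w p = lift_cell a' w' p.
    by have := e (place p); rewrite !lift_matchingE => /(can_inj placeK).
  have ea : a = a' by apply/permP=> q; have := e' (q, 0%R) => /(congr1 fst).
  congr (_, _) => //; apply/ffunP=> q.
  by have := congr1 snd (e' (q, 0%R)); rewrite /= !addr0.
apply: eq_card => al; apply/invariant_matchingsP/imsetP.
  case=> aI an af tr.
  pose abar q := (c (al (place (q, 0%R)))).1; pose w := [ffun q => (c (al (place (q, 0%R)))).2].
  have afX i x : al ((f ^+ i)%g x) = (f ^+ i)%g (al x).
    elim: i => [|i IH]; first by rewrite !expg0 !perm1.
    by rewrite !expgSr !permM af IH.
  have alE q x : al (place (q, x)) = place (abar q, (w q + x)%R).
    rewrite (place_add (abar q) (w q) x) -[x in LHS]add0r (place_add q 0%R x) afX.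
    by congr ((f ^+ x)%g _); rewrite ffunE -surjective_pairing cK.
  have inv q : abar (abar q) = q /\ (w (abar q) + w q = 0)%R.
    have := aI (place (q, 0%R)); rewrite !alE => /(can_inj placeK) /eqP.
    by rewrite xpair_eqE addr0 => /andP[/eqP h1 /eqP h2].
  have abar_inj : injective abar.
    by apply: (can_inj (g := abar)) => q; case: (inv q).
  exists (perm abar_inj, w); last first.
    apply/permP=> x; rewrite -(cK x) lift_matchingE; case: (c x) => q y.
    by rewrite alE /lift_cell permE.
  apply/quotient_matchingsP; split.
  - by move=> q; rewrite !permE; case: (inv q).
  - apply/voltagesP; split=> q.
      by rewrite permE; case: (inv q) => _ /eqP; rewrite addr_eq0 => /eqP.
    rewrite permE => aq; apply/eqP=> w0.
    by have := an (place (q, 0%R)); rewrite alE aq w0 addr0 eqxx.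
  move=> C CE u v _ _.
  pose b x := C (node_of (c x).1).
  have bs x : b (s x) = b x.
    rewrite -(cK x) -(place_next fs fk mt) /b !placeK.
    by case: (c x) => -[].
  have ba x : b (al x) = b x.
    rewrite -(cK x); case: (c x) => q y; rewrite alE /b !placeK /=.
    by rewrite [RHS]CE permE.
  have [u0 _ _] := mt u; have [v0 _ _] := mt v.
  have := tr b bs ba (place (existT _ u (Ordinal u0), 0%R)) (place (existT _ v (Ordinal v0), 0%R)).
  by rewrite /b !placeK.
case=> -[a w] aw ->; have an := anch _ aw.
case/quotient_matchingsP: aw => aI wv lk; have [wN w0] := voltagesP wv.
split.
- move=> x; rewrite -(cK x) !lift_matchingE; case: (c x) => q y.
  by rewrite /lift_cell /= aI wN addKr.
- move=> x; rewrite -(cK x) lift_matchingE (inj_eq (can_inj placeK)).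
  case: (c x) => q y; rewrite xpair_eqE negb_and /=; have [aq|//] := eqVneq (a q) q.
  apply: contra (w0 q aq) => /eqP e; apply/eqP.
  by apply: (addIr y); rewrite add0r.
- move=> x; rewrite -(cK x) -(place_shift m fs fk) !lift_matchingE.
  rewrite -(place_shift m fs fk); congr (place _).
  by rewrite /lift_cell /shift_sheet /= addrA.
exact: lift_transitive.
Qed.

End Lifts.

Lemma card_self_inverse2 : #|self_inverse 1| = 1.
Proof.
rewrite -[RHS](cards1 (ord_max : 'I_2)); apply: eq_card => x; rewrite !inE.
rewrite -!(inj_eq val_inj) /=; have := ltn_ord x.
by case: (val x) => [|[|]].
Qed.

(** * Counting quotient trees *)

Section QuotientCount.

Variables (k' : nat) (ts : seq (nat * bool)).
Notation k := k'.+1.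
Notation N := (size ts).
Notation slot := (slot ts).

Definition linked_involutions : {set {perm slot}} :=
  [set a : {perm slot} | [forall q, a (a q) == q] && `[< links (@node_of ts) setT a >]].

Lemma linked_involutionsP (a : {perm slot}) :
  reflect (involutive a /\ links (@node_of ts) setT a) (a \in linked_involutions).
Proof.
rewrite inE; apply: (iffP andP) => [[/forallP h1 /asboolP h2]|[h1 h2]].
  by split=> // q; apply/eqP.
by split; [apply/forallP=> q; apply/eqP | apply/asboolP].
Qed.

Lemma card_quotient_matchings :
  #|quotient_matchings k' ts| = \sum_(a in linked_involutions) #|voltages (k' := k') a|.
Proof.
rewrite -sum1_card (partition_big (fun aw : {perm slot} * {ffun slot -> 'I_k} => aw.1)
   (mem linked_involutions)) /=; last first.
  by move=> [a w] /quotient_matchingsP[h1 _ h3]; apply/linked_involutionsP.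
apply: eq_bigr => a /linked_involutionsP[aI lk].
have inj : injective (fun w : {ffun slot -> 'I_k} => (a, w)) by move=> w w' [].
rewrite -(card_imset _ inj) -sum1_card; apply: eq_bigl => -[a' w].
apply/andP/imsetP => [[/quotient_matchingsP[_ wv _] /eqP/= e]|[w' wv [-> ->]]].
  by subst a'; exists w.
by split=> //; apply/quotient_matchingsP.
Qed.

Lemma card_slot : #|slot| = sumn [seq t.1 | t <- ts].
Proof.
have := card_cell k' ts; rewrite card_prod card_ord mulnC => /eqP.
by rewrite eqn_pmul2l // => /eqP.
Qed.

Lemma block_degree_slot v : block_degree setT (@node_of ts) v = (vtype v).1.
Proof.
rewrite /block_degree -[RHS]card_ord -cardsT.
have inj : injective (fun t : 'I_(vtype v).1 => existT _ v t : slot).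
  by move=> t t' /eqP; rewrite eq_Tagged => /eqP.
rewrite -(card_imset _ inj); apply: eq_card => q; rewrite !inE.
apply/eqP/imsetP => [|[t _ ->] //]; case: q => u t; rewrite /node_of /= => e.
by subst u; exists t.
Qed.

Lemma prod_block_degree :
  \prod_(v in [set: 'I_N]) block_degree setT (@node_of ts) v = \prod_(t <- ts) t.1.
Proof.
rewrite (big_nth (0, false)) big_mkord; apply: eq_big => v; first by rewrite inE.
by rewrite block_degree_slot.
Qed.

Lemma linked_support a : a \in linked_involutions ->
  N.*2 <= #|[set q | a q != q]|.+2.
Proof.
by move=> /linked_involutionsP[aI /(links_bound aI)]; rewrite cardsT card_ord.
Qed.

(** Connecting N nodes takes N - 1 edges, hence all 2(N - 1) slots, and none is left to be a fixed
    point. *)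
Lemma linked_tree p : N = p.+2 -> #|slot| = p.+1.*2 ->
  linked_involutions = tree_matchings setT (@node_of ts) setT.
Proof.
move=> Np cs; apply/setP=> a; apply/idP/tree_matchingsP => [aL|[h1 h2 h3]]; last exact/linked_involutionsP.
have [aI lk] := linked_involutionsP _ aL; split=> // q; rewrite inE.
have := linked_support aL; rewrite Np => le.
have : [set q | a q != q] == setT.
  by rewrite eqEcard subsetT cardsT cs -ltnS -ltnS.
by move/eqP/setP/(_ q); rewrite !inE.
Qed.

Theorem card_quotient_tree p : N = p.+2 -> #|slot| = p.+1.*2 ->
  #|quotient_matchings k' ts| = k ^ p.+1 * (p`! * \prod_(t <- ts) t.1).
Proof.
move=> Np cs; rewrite card_quotient_matchings (linked_tree Np cs).
rewrite (eq_bigr (fun=> k ^ p.+1)) => [|a /tree_matchingsP[aI aT _]]; last first.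
  have sT : [set q | a q != q] = setT by apply/setP=> q; rewrite inE aT.
  have h := card_half aI; rewrite sT cardsT cs in h.
  rewrite card_voltages // -(double_inj h) (_ : #|[set q | a q == q]| = 0) ?muln1 //.
  by apply/eqP; rewrite cards_eq0; apply/eqP/setP=> q; rewrite !inE -[_ == _]negbK aT inE.
rewrite sum_nat_const mulnC (@card_tree_matchings _ _ p) ?cardsT ?card_ord //.
by rewrite prod_block_degree.
Qed.

End QuotientCount.

Section EdgeCount.

Variables (ts : seq (nat * bool)).
Notation N := (size ts).
Notation slot := (slot ts).
Variable p : nat.
Hypotheses (Np : N = p.+2) (cs : #|slot| = (p.+1).*2.+1).

(** The p + 1 edges that connectivity requires take all slots but one. *)
Lemma linked_fix a : a \in linked_involutions ts ->
  #|half a| = p.+1 /\ #|[set q | a q == q]| = 1.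
Proof.
move=> aL; have [aI lk] := linked_involutionsP _ aL.
have := linked_support aL; rewrite Np card_half // !doubleS !ltnS => le.
have := cardsC [set q | a q != q]; rewrite cs card_half //.
have -> : ~: [set q | a q != q] = [set q | a q == q].
  by apply/setP=> q; rewrite !inE negbK.
lia.
Qed.

(** Removing the fixed slot from a node v leaves a tree matching in which the degree of v is lowered
    by 1. Over the d_v slots of v this adds up to d_v - 1 times the product of all degrees, and the
    numbers d_v - 1 sum to (2p + 3) - (p + 2) = p + 1. *)
Lemma card_linked_fix : #|linked_involutions ts| = p.+1`! * \prod_(t <- ts) t.1.
Proof.
have -> : #|linked_involutions ts| =
    \sum_(q : slot) #|tree_matchings (setT :\ q) (@node_of ts) setT|.
  transitivity (\sum_(a in linked_involutions ts) \sum_(q | a q == q) 1).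
    rewrite -sum1_card; apply: eq_bigr => a aL; rewrite sum1dep_card.
    by have [_ ->] := linked_fix aL.
  rewrite (exchange_big_dep predT) //=; apply: eq_bigr => q _; rewrite -sum1_card.
  apply: eq_bigl => a; apply/andP/tree_matchingsP => [[aL /eqP aq]|[h1 h2 h3]].
    have [aI lk] := linked_involutionsP _ aL; split=> // q'; rewrite !inE andbT.
    have [_ /eqP/cards1P[q0 e]] := linked_fix aL.
    have := in_set1 q q0; rewrite -e inE aq eqxx => /esym/eqP q0E.
    by have := in_set1 q' q0; rewrite -e inE q0E => ->.
  by split; [exact/linked_involutionsP | rewrite -[_ == _]negbK h2 !inE eqxx].
have step q : #|tree_matchings (setT :\ q) (@node_of ts) setT| =
    p`! * \prod_(v : 'I_N) ((vtype v).1 - (v == node_of q)).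
  rewrite (@card_tree_matchings _ _ p) ?cardsT ?card_ord //; last first.
    by have := cardsD1 q [set: slot]; rewrite cardsT cs inE add1n => -[].
  congr (_ * _); apply: eq_big => v; first by rewrite inE.
  move=> _; rewrite -block_degree_slot /block_degree.
  rewrite [in RHS](cardsD1 q) !inE eq_sym addKn; apply: eq_card => q'.
  by rewrite !inE andbT andbC.
under eq_bigr do rewrite step.
rewrite -big_distrr /= factS -mulnA mulnCA; congr (_ * _).
rewrite (partition_big (@node_of ts) predT) //=.
have [/allP pos|/allPn[t tts]] := boolP (all (fun t => 0 < t.1) ts); last first.
  rewrite -eqn0Ngt => /eqP t0.
  have [i iN ti] := nthP (0, false) tts.
  have vt : (vtype (Ordinal iN)).1 = 0 by rewrite /vtype ti.
  have -> : \prod_(u <- ts) u.1 = 0 by rewrite (big_rem t) //= t0.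
  rewrite muln0 big1 // => v _.
  by rewrite big1 // => q _; rewrite (bigD1 (Ordinal iN)) //= vt.
have dpos v : 0 < (@vtype ts v).1 := pos (vtype v) (mem_nth (0, false) (ltn_ord v)).
transitivity (\sum_(v : 'I_N) ((vtype v).1 - 1) * \prod_(t <- ts) t.1).
  apply: eq_bigr => v _.
  rewrite (eq_bigr (fun=> \prod_(u : 'I_N) ((vtype u).1 - (u == v)))); last first.
    by move=> q /eqP->.
  rewrite sum_nat_const (_ : #|_| = (vtype v).1); last first.
    by rewrite -block_degree_slot; apply: eq_card => q; rewrite !inE.
  rewrite (bigD1 v) //= eqxx mulnCA; congr (_ * _).
  rewrite (big_nth (0, false)) big_mkord [in RHS](bigD1 v) //=; congr (_ * _).
  by apply: eq_bigr => u /negbTE->; rewrite subn0.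
rewrite -big_distrl /=; congr (_ * _); apply/eqP.
rewrite -(eqn_add2r N) -[X in _ + X == _](card_ord N) -sum1_card -big_split /=.
rewrite (eq_bigr (fun v => (vtype v).1)) => [|v _]; last by rewrite subnK.
have := card_slot 0 ts; rewrite cs sumnE big_map (big_nth (0, false)) big_mkord => <-.
by rewrite Np; lia.
Qed.

Theorem card_quotient_edge : #|quotient_matchings 1 ts| =
  2 ^ p.+1 * (p.+1`! * \prod_(t <- ts) t.1).
Proof.
rewrite card_quotient_matchings (eq_bigr (fun=> 2 ^ p.+1)) => [|a aL].
  by rewrite sum_nat_const card_linked_fix mulnC.
have [aI _] := linked_involutionsP _ aL; have [h1 h2] := linked_fix aL.
by rewrite card_voltages // h1 h2 card_self_inverse2 muln1.
Qed.

End EdgeCount.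

Definition node_types (a : nat -> nat) (r : seq nat) : seq (nat * bool) :=
  flatten [seq nseq (a i) (i, false) | i <- r].

Lemma mem_node_types a r i b : ((i, b) \in node_types a r) = [&& i \in r, 0 < a i & ~~ b].
Proof.
apply/flattenP/and3P => [[_ /mapP[j jr ->]]|[ir ai nb]].
  by rewrite mem_nseq => /andP[aj /eqP[-> ->]].
exists (nseq (a i) (i, false)); first by apply/mapP; exists i.
by rewrite mem_nseq ai (negbTE nb) eqxx.
Qed.

Lemma size_node_types a r : size (node_types a r) = \sum_(i <- r) a i.
Proof.
elim: r => [|i r IH]; first by rewrite big_nil.
by rewrite big_cons /node_types /= size_cat size_nseq -IH.
Qed.

Lemma sum_node_types a r : sumn [seq t.1 | t <- node_types a r] = \sum_(i <- r) i * a i.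
Proof.
elim: r => [|i r IH]; first by rewrite big_nil.
by rewrite big_cons /node_types /= map_cat sumn_cat map_nseq sumn_nseq -IH.
Qed.

Lemma marking_count_nseq (T : eqType) (sz : T -> nat) n t r : t \notin r ->
  marking_count sz (nseq n t ++ r) = sz t ^ n * n`! * marking_count sz r.
Proof.
move=> tr; elim: n => [|n IH]; first by rewrite /= mul1n.
rewrite /= IH eqxx count_cat count_nseq /= eqxx mul1n (count_memPn tr) addn0.
by rewrite expnS factS add1n; ring.
Qed.

Lemma marking_count_node_types k a r : uniq r ->
  marking_count (fun t => k * t.1) (node_types a r) =
  k ^ size (node_types a r) * \prod_(t <- node_types a r) t.1 * \prod_(i <- r) (a i)`!.
Proof.
elim: r => [|i r IH] /=; first by rewrite !big_nil.
case/andP=> ir ur; rewrite /node_types /= -/(node_types a r) marking_count_nseq.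
  rewrite IH // size_cat size_nseq big_cat big_cons /= expnD expnMn.
  have -> : \prod_(t <- nseq (a i) (i, false)) t.1 = i ^ a i.
    by elim: (a i) => [|n IHn] /=; rewrite ?big_nil // big_cons IHn expnS.
  by ring.
by rewrite mem_node_types (negbTE ir).
Qed.

(** * Labelled trees with a normalized automorphism *)

Section LiftedTrees.

Variables (k' : nat) (ts : seq (nat * bool)) (D : finType) (x0 : D).
Notation k := k'.+1.
Hypothesis hol1 : k' = 0 -> {in ts, forall t, t.2 = false}.
Hypothesis pos : {in ts, forall t, 0 < t.1}.
Hypothesis cD : #|D| = k * sumn [seq t.1 | t <- ts].

Definition lifted_trees : {set {perm D} * {perm D} * {perm D}} :=
  [set y : {perm D} * {perm D} * {perm D} |
    `[< exists m, frame k' (ts := ts) y.1.1 y.1.2 m >] &&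
    (y.2 \in invariant_matchings y.1.1 y.1.2)].

Lemma card_lifted_trees :
    (forall aw, aw \in quotient_matchings k' ts -> anchored k' aw.1) ->
  #|lifted_trees| * marking_count (fun t => k * t.1) ts =
  #|D|`! * #|quotient_matchings k' ts|.
Proof.
move=> anch.
have [s0 [f0 [m0 fr0]]] : exists (s f : {perm D}) m, frame k' (ts := ts) s f m.
  apply: frame_exists; first by rewrite card_cell.
  by move=> v; apply: pos; apply: mem_nth.
rewrite -(card_frames x0 hol1 fr0) mulnAC; congr (_ * _).
rewrite -sum1_card (partition_big (fun y : {perm D} * {perm D} * {perm D} => y.1)
   (fun sf => sf \in [set sf : {perm D} * {perm D} | `[< exists m, frame k' (ts := ts) sf.1 sf.2 m >]])) /=;
  last by move=> [sf al]; rewrite !inE => /andP[].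
rewrite -sum_nat_const; apply: eq_bigr => -[s f]; rewrite inE => fr.
have /asboolP[m /= frm] := fr; have [_ _ _ [c placeK cK]] := frm.
rewrite -(card_invariant_matchings frm placeK cK anch).
have inj : injective (fun al : {perm D} => ((s, f), al)) by move=> w w' [].
rewrite -(card_imset _ inj) -sum1_card; apply: eq_bigl => -[sf al].
apply/andP/imsetP => [[]|[al' alI [-> ->]]].
  by rewrite in_set => /andP[_ alI] /eqP/= e; subst sf; exists al.
by rewrite in_set fr.
Qed.

End LiftedTrees.

Section Counts.

Variables (D : finType) (x0 : D) (a : nat -> nat) (r : seq nat).
Hypotheses (ur : uniq r) (rpos : {in r, forall i, 0 < i}).
Notation nt := (node_types a r).

Let ntpos : {in nt, forall t, 0 < t.1}.
Proof. by move=> [i b]; rewrite mem_node_types => /and3P[/rpos]. Qed.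

Let nthol : {in nt, forall t, t.2 = false}.
Proof. by move=> [i b]; rewrite mem_node_types => /and3P[_ _ /negbTE]. Qed.

Let prod_gt0 : 0 < \prod_(t <- nt) t.1.
Proof. by rewrite big_seq; apply: prodn_cond_gt0 => t /ntpos. Qed.

Theorem card_lifted_plain p : size nt = p.+2 -> sumn [seq t.1 | t <- nt] = p.+1.*2 ->
    #|D| = p.+1.*2 ->
  #|lifted_trees 0 nt D| * \prod_(i <- r) (a i)`! = #|D|`! * p`!.
Proof.
move=> sz sm cD; have := @card_lifted_trees 0 nt D x0 (fun _ => nthol) ntpos.
rewrite sm mul1n => /(_ cD) H; have {}H := H (fun _ _ => Or31 _ _ (erefl 0)).
move: H; rewrite marking_count_node_types // (card_quotient_tree _ sz) ?card_slot //.
rewrite !exp1n !mul1n => H; apply/eqP; rewrite -(eqn_pmul2l prod_gt0).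
by apply/eqP; rewrite mulnCA H; ring.
Qed.

(** The p + 1 edges of the quotient give k^(p+1) voltages, its p + 2 nodes give k^(p+2) in the
    marking count, whence the single factor [k'.+1] on the left; the degrees cancel. *)
Theorem card_lifted_node k' l p : 0 < k' -> 0 < l ->
    size nt = p.+1 -> l + sumn [seq t.1 | t <- nt] = p.+1.*2 ->
    #|D| = k'.+1 * p.+1.*2 ->
  #|lifted_trees k' ((l, true) :: nt) D| * (k'.+1 * \prod_(i <- r) (a i)`!) = #|D|`! * p`!.
Proof.
move=> k0 l0 sz sm cD; set ts := (l, true) :: nt.
have hol : k' = 0 -> {in ts, forall t, t.2 = false} by move=> e; rewrite e in k0.
have tpos : {in ts, forall t, 0 < t.1}.
  by move=> t; rewrite inE => /predU1P[->|/ntpos].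
have sm' : sumn [seq t.1 | t <- ts] = p.+1.*2 by [].
have := @card_lifted_trees k' ts D x0 hol tpos; rewrite sm' => /(_ cD) H.
have an aw : aw \in quotient_matchings k' ts -> anchored k' aw.1.
  by move=> _; apply: Or32; exists ord0.
have {}H := H an; move: H.
rewrite (card_quotient_tree _ (p := p)) ?card_slot //= ?sz //.
have nin : (l, true) \notin nt by rewrite mem_node_types !andbF.
rewrite marking_count_node_types // eqxx (count_memPn nin) addn0 muln1 sz big_cons /=.
set P := \prod_(t <- nt) t.1; set A := \prod_(i <- r) _ => H.
have pos : 0 < k'.+1 ^ p.+1 * (l * P) by rewrite !muln_gt0 expn_gt0 l0 prod_gt0.
apply/eqP; rewrite -(eqn_pmul2r pos); apply/eqP.
transitivity (#|lifted_trees k' ts D| * (k'.+1 * l * (k'.+1 ^ p.+1 * P * A))); first by ring.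
by rewrite H; ring.
Qed.

(** The p + 1 full edges of the quotient have free voltages while that of the half-edge glued to
    itself is forced; against p + 2 nodes one factor 2 remains. *)
Theorem card_lifted_edge p : size nt = p.+2 -> sumn [seq t.1 | t <- nt] = p.+1.*2.+1 ->
    #|D| = 2 * p.+1.*2.+1 ->
  #|lifted_trees 1 nt D| * (2 * \prod_(i <- r) (a i)`!) = #|D|`! * p.+1`!.
Proof.
move=> sz sm cD; have := @card_lifted_trees 1 nt D x0 _ ntpos.
rewrite sm => /(_ (fun _ => nthol) cD) H.
have cs : #|slot nt| = p.+1.*2.+1 by rewrite card_slot.
have an aw : aw \in quotient_matchings 1 nt -> anchored 1 aw.1.
  case: aw => b w /quotient_matchingsP[bI _ lk] /=; apply: Or33; split=> //.
  have bL : b \in linked_involutions nt by apply/linked_involutionsP.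
  have [_ /eqP/cards1P[q e]] := linked_fix sz cs bL; exists q.
  by apply/eqP; have := set11 q; rewrite -e inE.
have {}H := H an; move: H.
rewrite (card_quotient_edge sz cs) marking_count_node_types // sz.
set P := \prod_(t <- nt) t.1; set A := \prod_(i <- r) _ => H.
have pos : 0 < 2 ^ p.+1 * P by rewrite !muln_gt0 expn_gt0 prod_gt0.
apply/eqP; rewrite -(eqn_pmul2r pos); apply/eqP.
transitivity (#|lifted_trees 1 nt D| * (2 ^ p.+2 * P * A)); first by rewrite [2 ^ p.+2]expnS; ring.
by rewrite H; ring.
Qed.

End Counts.

(** * The internal rotation *)

Lemma iter_transitive_order (D : finType) (g : D -> D) (I : {set D}) x e :
    x \in I -> (forall y, y \in I -> g y \in I) ->
    (forall y z, y \in I -> z \in I -> exists j, z = iter j g y) ->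
  (iter e g x == x) = (#|I| %| e).
Proof.
move=> xI gI tr.
have itI j y : y \in I -> iter j g y \in I.
  by move=> yI; elim: j => //= j IH; apply: gI.
have ord : fingraph.order g x = #|I|.
  apply: eq_card => y; apply/idP/idP => [/iter_findex <-|yI]; first exact: itI.
  by have [j ->] := tr x y xI yI; apply: fconnect_iter.
have per : iter #|I| g x = x.
  rewrite -ord; apply/(orbitPcycle 3 4).
  by have [j e'] := tr (g x) x (gI _ xI) xI; exists j; rewrite iterSr -e'.
have per_q q r : iter (r + q * #|I|) g x = iter r g x.
  by elim: q => [|q IH]; rewrite ?mul0n ?addn0 // mulSn addnCA addnC iterD per.
rewrite {1}(divn_eq e #|I|) addnC per_q /dvdn.
have lt : e %% #|I| < #|I| by rewrite ltn_pmod //; apply/card_gt0P; exists x.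
move: (e %% #|I|) lt => r lt; case: r lt => [|r] lt; first by rewrite /= !eqxx.
have := orbit_uniq g x; rewrite /fingraph.orbit ord.
case: #|I| lt => // M lt /=; rewrite (_ : (r.+1 == 0) = false) //.
move=> /andP[nx _]; apply: contraNF nx => /eqP {1}<-.
by rewrite -iterS iterSr; apply/trajectP; exists r.
Qed.

Lemma dvdn_mul_gcd m e i : 0 < m -> (m %| e * i) = (m %/ gcdn m e %| i).
Proof.
move=> m0; have g0 : 0 < gcdn m e by rewrite gcdn_gt0 m0.
have co : coprime (m %/ gcdn m e) (e %/ gcdn m e).
  rewrite /coprime -(eqn_pmul2r g0) muln_gcdl mul1n.
  by rewrite !divnK ?dvdn_gcdl ?dvdn_gcdr.
have mE := divnK (dvdn_gcdl m e); have eE := divnK (dvdn_gcdr m e).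
move: (gcdn m e) (m %/ _) (e %/ _) g0 co mE eE => g m' e' g0 co <- <-.
by rewrite mulnAC dvdn_pmul2r // Gauss_dvdr.
Qed.

Section Rotation.

Variables (D : finType) (s a : {perm D}).
Hypotheses (aK : involutive a) (an : forall x, a x != x).
Hypothesis conn : transitive2 s a.
Hypothesis cnt : #|porbits s|.*2 = #|D|.+2.

(** By [one_face] the indicator of the cycle of x under [a * s] is constant: a plane tree has a
    single face. *)
Lemma face_transitive x y : exists i, y = ((a * s) ^+ i)%g x.
Proof.
have sup : [set x | a x != x] = setT by apply/setP=> z; rewrite !inE an.
have := one_face aK conn; rewrite sup cardsT => /(_ cnt) H.
have : y \in porbit (a * s)%g x.
  rewrite -(H (fun z => z \in porbit (a * s)%g x) _ x y) ?porbit_id // => z.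
  have := porbit_perm (a * s)%g 1 z; rewrite expg1 => e.
  by rewrite -permM -!eq_porbit_mem e.
by case/porbitP=> i ->; exists i.
Qed.

End Rotation.

Section NextInternal.

Variable D : finType.
Implicit Types (x y : rooted_map D) (h : D).

Lemma head_filter (T : Type) (P : pred T) (d : T) r : has P r ->
  head d (filter P r) = nth d r (find P r).
Proof. by elim: r => //= z r IH; case: (P z). Qed.

Lemma next_corner_perm x h : next_corner x h = (alpha x * sigma x)%g h.
Proof. by rewrite permM. Qed.

Lemma iter_next_corner x i h : iter i (next_corner x) h = ((alpha x * sigma x) ^+ i)%g h.
Proof. by rewrite permX; apply: eq_iter => z; rewrite next_corner_perm. Qed.

(** Describes the next internal corner by the corners passed on the way, a form that isomorphisms
    preserve and that has at most one solution. *)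
Definition internal_step x h h' i := [/\ 0 < i, h' = iter i (next_corner x) h,
  ~~ leaf x h' & forall j, 0 < j < i -> leaf x (iter j (next_corner x) h)].

Lemma next_internal_step x h : ~~ leaf x h ->
  exists i, internal_step x h (next_internal_corner x h) i.
Proof.
move=> lh; set g := next_corner x.
have g_inj : injective g by move=> y z; rewrite /g !next_corner_perm => /perm_inj.
(* The search list contains h, which is not at a leaf, so the default value of [head] is never
   returned for lack of candidates. *)
have hO : h \in fingraph.orbit g (g h).
  by rewrite -fconnect_orbit fconnect_sym // fconnect1.
have hs : has (fun k => ~~ leaf x k) (fingraph.orbit g (g h)) by apply/hasP; exists h.
set O := fingraph.orbit g (g h) in hO hs.
have iO : find (fun k => ~~ leaf x k) O < size O by rewrite -has_find.
have nthO j : j < size O -> nth h O j = iter j.+1 g h.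
  move=> lj; rewrite (set_nth_default (g h)) //; move: lj; rewrite /O size_orbit => lj.
  by rewrite /fingraph.orbit nth_traject // -iterSr.
exists (find (fun k => ~~ leaf x k) O).+1; rewrite /next_internal_corner head_filter //.
split=> //; first by rewrite nthO.
  exact: (nth_find h hs).
case=> // j /= lj; have := before_find h lj; rewrite nthO; last exact: ltn_trans iO.
by move/negbFE.
Qed.

Lemma internal_step_unique x h h1 h2 i1 i2 :
  internal_step x h h1 i1 -> internal_step x h h2 i2 -> h1 = h2.
Proof.
move=> [p1 e1 n1 m1] [p2 e2 n2 m2]; have [lt|lt|eq] := ltngtP i1 i2.
- by rewrite e1 m2 ?p1 in n1.
- by rewrite e2 m1 ?p2 in n2.
by rewrite e1 e2 eq.
Qed.

Definition map_iso x y (f : {perm D}) : Prop :=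
  (forall h, sigma y (f h) = f (sigma x h)) /\ (forall h, alpha y (f h) = f (alpha x h)).

Lemma map_iso_conj x y f : map_iso x y f <-> sigma y = (sigma x ^ f)%g /\ alpha y = (alpha x ^ f)%g.
Proof.
split=> [[h1 h2]|[e1 e2]]; last by split=> h; rewrite ?e1 ?e2 permJ.
by split; apply/permP=> h; rewrite -(permKV f h) permJ ?h1 ?h2.
Qed.

Lemma card_porbit_conj (t f : {perm D}) h : #|porbit (t ^ f)%g (f h)| = #|porbit t h|.
Proof.
rewrite -[RHS](card_imset _ (@perm_inj _ f)); apply: eq_card => z.
apply/porbitP/imsetP => [[i ->]|[_ /porbitP[i ->] ->]].
  by exists ((t ^+ i)%g h); rewrite ?mem_porbit // -conjXg permJ.
by exists i; rewrite -conjXg permJ.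
Qed.

Lemma iso_leaf x y f h : map_iso x y f -> leaf y (f h) = leaf x h.
Proof.
by move=> /map_iso_conj[e _]; rewrite /leaf /degree /node e card_porbit_conj.
Qed.

Lemma iso_next_internal x y f h : map_iso x y f -> ~~ leaf x h ->
  next_internal_corner y (f h) = f (next_internal_corner x h).
Proof.
move=> iso lh; have [i [i0 e n m]] := next_internal_step lh.
have lfh : ~~ leaf y (f h) by rewrite (iso_leaf _ iso).
have [j st] := next_internal_step lfh; apply: internal_step_unique st _.
have it l : iter l (next_corner y) (f h) = f (iter l (next_corner x) h).
  elim: l => //= l ->; case: iso => h1 h2.
  by rewrite /next_corner h2 h1.
exists; first exact: i0.
- by rewrite it -e.
- by rewrite (iso_leaf _ iso).
by move=> l /m; rewrite it (iso_leaf _ iso).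
Qed.

Section Tree.

Variable x : rooted_map D.
Notation s := (sigma x).
Notation a := (alpha x).
Hypotheses (aK : involutive a) (an : forall h, a h != h).
Hypothesis conn : transitive2 s a.
Hypothesis cnt : #|porbits s|.*2 = #|D|.+2.

Notation nu := (next_internal_corner x).
Notation I := [set h | ~~ leaf x h].

Lemma nu_internal h : h \in I -> nu h \in I.
Proof. by rewrite !inE => /next_internal_step[i []]. Qed.

(** Induction on the number i of corners from h to h': since h' is internal, the next internal
    corner after h does not lie beyond it. *)
Lemma nu_transitive h h' : h \in I -> h' \in I -> exists j, h' = iter j nu h.
Proof.
move=> hI h'I; have [i] := face_transitive aK an conn cnt h h'.
rewrite -iter_next_corner; have [n] := ubnP i; elim: n i h hI => // n IH i h hI.
rewrite ltnS => le_in e; have [i0|ipos] := posnP i.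
  by exists 0; rewrite e i0.
have [l [l0 el nl ml]] : exists l, internal_step x h (nu h) l.
  by apply: next_internal_step; rewrite inE in hI.
have li : l <= i.
  rewrite leqNgt; apply/negP=> lt; have := ml i; rewrite ipos lt -e => /(_ isT).
  by rewrite inE in h'I; rewrite (negbTE h'I).
have [||j ->] := IH (i - l) (nu h) (nu_internal hI); last by exists j.+1; rewrite iterSr.
  by apply: leq_trans le_in; lia.
by rewrite el -iterD subnK.
Qed.

Lemma nu_period h e : h \in I -> (iter e nu h == h) = (#|I| %| e).
Proof.
move=> hI; apply: iter_transitive_order => //; first exact: nu_internal.
exact: nu_transitive.
Qed.

Lemma aut_iso f : commute f s -> commute f a -> map_iso x x f.
Proof. by move=> fs fa; split=> h; rewrite commute_permE. Qed.

Lemma aut_nu f h e : commute f s -> commute f a -> h \in I ->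
  f (iter e nu h) = iter e nu (f h) /\ iter e nu (f h) \in I.
Proof.
move=> fs fa hI; have iso := aut_iso fs fa.
have fI z : z \in I -> f z \in I by rewrite !inE (iso_leaf _ iso).
have itI z : z \in I -> iter e nu z \in I.
  by move=> zI; elim: e => //= e' IH; apply: nu_internal.
split; last exact/itI/fI.
elim: e {itI} => //= e IH; rewrite -IH; apply/esym/iso_next_internal => //.
have : iter e nu h \in I by elim: e {IH} => //= e IH; apply: nu_internal.
by rewrite inE.
Qed.

Lemma aut_power f h i e : commute f s -> commute f a -> h \in I ->
  f h = iter i nu h -> (f ^+ e)%g h = iter (i * e) nu h.
Proof.
move=> fs fa hI fh; elim: e => [|e IH]; first by rewrite muln0 expg0 perm1.
rewrite expgSr permM IH; have [-> _] := aut_nu (i * e) fs fa hI.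
by rewrite fh -iterD mulnS addnC.
Qed.

(** An automorphism is determined by the image of h, so a power of it is trivial exactly when the
    corresponding number of rotation steps returns to h. *)
Lemma aut_order f h i : commute f s -> commute f a -> h \in I ->
  f h = iter i nu h -> #[f]%g = #|I| %/ gcdn #|I| i.
Proof.
move=> fs fa hI fh.
have I0 : 0 < #|I| by apply/card_gt0P; exists h.
have dv j : (#[f]%g %| j) = (#|I| %/ gcdn #|I| i %| j).
  rewrite -dvdn_mul_gcd // order_dvdn -(nu_period _ hI) -(aut_power j fs fa hI fh).
  apply/eqP/eqP => [->|]; first by rewrite perm1.
  by apply: (automorphism_free conn); apply: commuteXl.
by apply/eqP; rewrite eqn_dvd dv dvdnn -dv dvdnn.
Qed.

(** An automorphism moves h by some i steps and has order m / gcd(m, i), m being the number of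
    internal corners. If this is m / gcd(m, e), then gcd(m, i) = gcd(m, e), so e is a multiple of i
    modulo m and a power of the automorphism moves h by e steps. The right side does not mention h:
    the condition is the same for every root. *)
Lemma rotation_automorphism h e : h \in I ->
  (exists f : {perm D}, [/\ commute f s, commute f a & f h = iter e nu h]) <->
  (exists f : {perm D}, [/\ commute f s, commute f a & #[f]%g = #|I| %/ gcdn #|I| e]).
Proof.
move=> hI; split=> -[f [fs fa fh]]; first by exists f; split=> //; apply: aut_order fh.
have fI : f h \in I by rewrite inE (iso_leaf _ (aut_iso fs fa)); rewrite inE in hI.
have [i fi] := nu_transitive hI fI.
have I0 : 0 < #|I| by apply/card_gt0P; exists h.
have := aut_order fs fa hI fi; rewrite fh => gE.
have gi : gcdn #|I| i = gcdn #|I| e.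
  have d0 : 0 < #|I| %/ gcdn #|I| e by rewrite divn_gt0 ?gcdn_gt0 ?I0 // dvdn_leq ?dvdn_gcdl.
  apply/eqP; rewrite -(eqn_pmul2l d0) {1}gE.
  by rewrite !divnK ?dvdn_gcdl.
have [b _ mb] := Bezoutl i I0.
have [e' ee] := dvdnP (dvdn_gcdr #|I| e).
(* Since m divides gcd(m, i) + b i, the factor m - 1 supplies the minus sign: i b (m - 1) e' is e
   modulo m. *)
exists (f ^+ (b * #|I|.-1 * e'))%g; split; try exact: commuteXl.
rewrite (aut_power _ fs fa hI fi).
set M := #|I| in I0 mb ee gi *; set t := (i * _).
have key : t = e %[mod M].
  apply/eqP; rewrite -(eqn_modDr (gcdn M i * M.-1 * e')).
  have -> : t + gcdn M i * M.-1 * e' = (gcdn M i + b * i) * (M.-1 * e') by rewrite /t; ring.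
  have -> : e + gcdn M i * M.-1 * e' = M * (gcdn M i * e').
    transitivity (M.-1.+1 * (gcdn M i * e')); last by rewrite prednK.
    have {1}-> : e = e' * gcdn M i by rewrite gi.
    by rewrite mulSn; ring.
  by rewrite -modnMml (eqP mb) mul0n modnMr mod0n.
have perM : iter M nu h = h by apply/eqP; rewrite nu_period.
have red u : iter u nu h = iter (u %% M) nu h.
  rewrite {1}(divn_eq u M) addnC iterD; congr (iter _ _ _).
  by elim: (u %/ M) => // q IH; rewrite mulSn iterD IH perM.
by rewrite (red t) key -red.
Qed.

End Tree.

End NextInternal.

(** * Isomorphism classes and those fixed by a power of the rotation *)

Section TreeClasses.

Variables (D : finType) (d : nat -> nat) (N n : nat).
Hypothesis dN : forall i, N < i -> d i = 0.
Hypothesis d_sum : \sum_(1 <= i < N.+1) d i = n.+1.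
Hypothesis cD : #|D| = 2 * n.
Implicit Types (s a f : {perm D}) (x y : rooted_map D).

Definition degree_dist s : Prop :=
  forall i, 0 < i -> #|[set h | #|porbit s h| == i]| = i * d i.

(** Acyclicity is a consequence: the degrees give one node more than edges, and then [tree_acyclic]
    applies. *)
Definition plane s a : Prop :=
  [/\ involutive a, forall h, a h != h, transitive2 s a & degree_dist s].

Lemma card_degree s i : #|[set h | #|porbit s h| == i]| =
  i * #|[set v in porbits s | #|v| == i]|.
Proof.
rewrite (card_porbits_pred s (fun A => #|A| == i)) mulnC -sum_nat_const.
by apply: eq_big => [A|A /andP[_ /eqP]//]; rewrite inE.
Qed.

Lemma degree_dist_nodes s : degree_dist s <->
  forall i, 0 < i -> #|[set v in porbits s | #|v| == i]| = d i.
Proof.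
split=> H i i0; last by rewrite card_degree H.
by apply/eqP; rewrite -(eqn_pmul2l i0) -card_degree H.
Qed.

Lemma degree_dist_count s : degree_dist s -> #|porbits s|.*2 = #|D|.+2.
Proof.
move/degree_dist_nodes=> H; suff -> : #|porbits s| = n.+1 by rewrite cD; lia.
rewrite -d_sum big_nat (eq_bigr (fun i => \sum_(A in porbits s) (#|A| == i))); last first.
  move=> i /andP[i0 _]; rewrite -H // -sum1_card [RHS]big_mkcond [RHS]big_mkcond /=.
  by rewrite big_mkcond; apply: eq_bigr => A _; rewrite inE; case: (A \in _); case: eqP.
rewrite -big_nat exchange_big /= -sum1_card; apply: eq_bigr => A As.
have A0 : 0 < #|A| by case/imsetP: As => h _ ->; rewrite lt0n card_porbit_neq0.
have AN : #|A| <= N.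
  rewrite leqNgt; apply/negP=> lt; have := H _ A0; rewrite dN // => /eqP.
  by rewrite cards_eq0 => /eqP/setP/(_ A); rewrite !inE As eqxx.
rewrite (bigD1_seq #|A|) ?iota_uniq ?mem_index_iota ?A0 //= eqxx big1 // => i.
by rewrite eq_sym => /negbTE->.
Qed.

Lemma tree_plane x : internally_rooted_tree d x <->
  plane (sigma x) (alpha x) /\ ~~ leaf x (root_corner x).
Proof.
split=> [[[ei co ac] nb lf]|[[aK an tr dd] lf]].
  split=> //; split.
  - by move=> h; case: (ei h).
  - by move=> h; apply/eqP; case: (ei h).
  - exact/transitive2_connect.
  - exact/degree_dist_nodes.
have ei : edge_involution x by move=> h; split; [apply/eqP | apply: aK].
split=> //; last exact/degree_dist_nodes.
split=> //; first exact/transitive2_connect.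
apply: tree_acyclic => //; exact: degree_dist_count.
Qed.

Lemma plane_conj s a f : plane s a -> plane (s ^ f)%g (a ^ f)%g.
Proof.
move=> [aK an tr dd].
have cj (t : {perm D}) h : (t ^ f)%g h = f (t ((f^-1)%g h)).
  by rewrite -{1}(permKV f h) permJ.
split.
- by move=> h; rewrite !cj permK aK permKV.
- by move=> h; rewrite cj -{2}(permKV f h) (inj_eq perm_inj) an.
- move=> c cs ca h k.
  have := tr (fun z => c (f z)) _ _ ((f^-1)%g h) ((f^-1)%g k).
  rewrite !permKV; apply=> z; first by rewrite -permJ cs.
  by rewrite -permJ ca.
move=> i i0; rewrite -dd // -(card_imset [set h | #|porbit s h| == i] (@perm_inj _ f)).
apply: eq_card => h; rewrite -(permKV f h) (mem_imset _ _ perm_inj) !inE.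
by rewrite card_porbit_conj.
Qed.

Definition conj_map x f : rooted_map D := ((sigma x ^ f)%g, (alpha x ^ f)%g, f (root_corner x)).

Lemma rooted_isoP x y : rooted_iso x y <-> exists f, y = conj_map x f.
Proof.
split=> [[f [h1 h2 h3]]|[f ->]]; exists f.
  have [e1 e2] := proj1 (map_iso_conj x y f) (conj h1 h2).
  case: y {h1 h2} h3 e1 e2 => -[y1 y2] y3; rewrite /root_corner /sigma /alpha /=.
  by rewrite /conj_map => -> -> ->.
by split=> [h|h|]; rewrite ?permJ.
Qed.

Lemma conj_mapM x f g : conj_map (conj_map x f) g = conj_map x (f * g)%g.
Proof. by rewrite /conj_map /= !conjgM permM. Qed.

Lemma conj_map1 x : conj_map x 1 = x.
Proof. by case: x => -[x1 x2] x3; rewrite /conj_map /= !conjg1 perm1. Qed.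

Lemma mem_iso_class x y : reflect (exists f, y = conj_map x f) (y \in iso_class x).
Proof. by rewrite inE; apply: (iffP (asboolP _)) => /rooted_isoP. Qed.

Lemma iso_class_refl x : x \in iso_class x.
Proof. by apply/mem_iso_class; exists 1%g; rewrite conj_map1. Qed.

Lemma iso_class_conj x f : iso_class (conj_map x f) = iso_class x.
Proof.
apply/setP=> y; apply/idP/idP => /mem_iso_class[g ->]; apply/mem_iso_class.
  by exists (f * g)%g; rewrite conj_mapM.
by exists (f^-1 * g)%g; rewrite conj_mapM mulKVg.
Qed.

Lemma iso_class_eq x y : iso_class y = iso_class x <-> exists f, y = conj_map x f.
Proof.
split=> [e|[f ->]]; last exact: iso_class_conj.
by apply/mem_iso_class; rewrite -e iso_class_refl.
Qed.

Lemma conj_map_iso x f : map_iso x (conj_map x f) f.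
Proof. by apply/map_iso_conj. Qed.

Lemma rotation_iso_class x : ~~ leaf x (root_corner x) ->
  internal_rotation (iso_class x) = iso_class (rotate_map x).
Proof.
move=> lf.
have rotE f : rotate_map (conj_map x f) = conj_map (rotate_map x) f.
  by rewrite /rotate_map (iso_next_internal (conj_map_iso x f) lf).
apply/setP=> y; apply/imsetP/mem_iso_class => [[_ /mem_iso_class[f ->] ->]|[f ->]].
  by exists f.
by exists (conj_map x f); rewrite ?rotE //; apply/mem_iso_class; exists f.
Qed.

Definition tree_classes : {set {set rooted_map D}} :=
  [set iso_class x | x in [set x | `[< internally_rooted_tree d x >]]].

Lemma tree_classesP X : reflect
  (exists x, [/\ plane (sigma x) (alpha x), ~~ leaf x (root_corner x) & X = iso_class x])
  (X \in tree_classes).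
Proof.
apply: (iffP imsetP) => [[x]|[x [h1 h2 ->]]].
  by rewrite inE => /asboolP/tree_plane[h1 h2] ->; exists x.
by exists x => //; rewrite inE; apply/asboolP/tree_plane.
Qed.

Lemma iter_rotate x e : iter e (@rotate_map D) x =
  (sigma x, alpha x, iter e (next_internal_corner x) (root_corner x)).
Proof. by elim: e => [|e IH] /=; [case: x => -[] | rewrite IH]. Qed.

Lemma iter_rotation x e : ~~ leaf x (root_corner x) ->
  iter e (@internal_rotation D) (iso_class x) =
    iso_class (iter e (@rotate_map D) x) /\
  ~~ leaf (iter e (@rotate_map D) x) (root_corner (iter e (@rotate_map D) x)).
Proof.
move=> lf; elim: e => //= e [-> IH]; rewrite rotation_iso_class //; split=> //.
by have [i []] := next_internal_step IH.
Qed.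

Definition nb_internal : nat := #|D| - d 1.

Lemma card_internal s : degree_dist s ->
  #|[set h | #|porbit s h| != 1]| = nb_internal.
Proof.
move=> dd; have := dd 1 isT; rewrite mul1n /nb_internal => <-.
rewrite [LHS]cardsCs; congr (_ - _); apply: eq_card => h; rewrite !inE negbK.
by [].
Qed.

Lemma rotation_tree X : X \in tree_classes -> internal_rotation X \in tree_classes.
Proof.
case/tree_classesP=> x [pl lf ->]; apply/tree_classesP; exists (rotate_map x).
have [H1 H2] := iter_rotation 1 lf; split=> //.
Qed.

Lemma rotation_period X : X \in tree_classes ->
  iter nb_internal (@internal_rotation D) X = X.
Proof.
case/tree_classesP=> x [pl lf ->]; have [aK an tr dd] := pl.
have [-> _] := iter_rotation nb_internal lf; rewrite iter_rotate.
have := nu_period aK an tr (degree_dist_count dd) nb_internal (h := root_corner x).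
rewrite inE (card_internal dd) dvdnn => /(_ lf)/eqP->.
by case: x {pl lf aK an tr dd} => -[].
Qed.

(** Conjugation acts freely here, since an automorphism fixing the root corner is trivial. *)
Lemma card_iso_class x : transitive2 (sigma x) (alpha x) -> #|iso_class x| = #|D|`!.
Proof.
move=> tr.
have -> : iso_class x = conj_map x @: [set: {perm D}].
  apply/setP=> y; apply/idP/imsetP => [/mem_iso_class[f ->]|[f _ ->]]; first by exists f.
  by apply/mem_iso_class; exists f.
rewrite card_imset => [|f g [e1 e2 e3]].
  rewrite -cardsT -card_perm; apply: eq_card => g; rewrite !inE.
  by apply/esym/subsetP=> h; rewrite inE.
have cm (t : {perm D}) : (t ^ f = t ^ g)%g -> commute (f * g^-1)%g t.
  move=> e; apply: commute_sym; rewrite /commute; apply: (mulgI (f * g^-1)^-1%g).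
  by rewrite mulKg -/(conjg _ _) conjgM e -conjgM mulgV conjg1.
have := automorphism_free tr (cm _ e1) (cm _ e2) (x := root_corner x).
rewrite permM e3 permK => /(_ erefl) e.
by apply: (mulIg g^-1%g); rewrite mulgV e.
Qed.

Definition plane_aut (k : nat) : {set {perm D} * {perm D}} :=
  [set p : {perm D} * {perm D} | `[< plane p.1 p.2 /\
     exists f, [/\ commute f p.1, commute f p.2 & #[f]%g = k] >]].

(** Both sides count the rooted maps lying in fixed classes. Each class has one member per
    permutation of [D]; and being fixed depends on the underlying plane tree alone, which leaves
    every internal corner as a root. *)
Theorem card_fixed_classes e :
  #|[set X in tree_classes | iter e (@internal_rotation D) X == X]| * #|D|`! =
  #|plane_aut (nb_internal %/ gcdn nb_internal e)| * nb_internal.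
Proof.
set k := nb_internal %/ _.
pose Xe := [set x : rooted_map D | ((sigma x, alpha x) \in plane_aut k) && ~~ leaf x (root_corner x)].
have XeP x : x \in Xe -> plane (sigma x) (alpha x) /\ ~~ leaf x (root_corner x).
  by rewrite !inE => /andP[/asboolP[? _] ?].
have fixP x : plane (sigma x) (alpha x) -> ~~ leaf x (root_corner x) ->
   (iter e (@internal_rotation D) (iso_class x) == iso_class x) = (x \in Xe).
  move=> pl lf; have [aK an tr dd] := pl.
  have [-> _] := iter_rotation e lf; rewrite !inE lf andbT iter_rotate.
  have hI : root_corner x \in [set h | ~~ leaf x h] by rewrite inE.
  have R := rotation_automorphism aK an tr (degree_dist_count dd) e hI.
  rewrite (card_internal dd) -/k in R.
  apply/eqP/asboolP => [/iso_class_eq[f [e1 e2 e3]]|[_ /R[f [fs fa fr]]]].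
    split=> //; apply/R; exists f; split=> //; exact/commute_sym/commgP/conjg_fixP/esym.
  apply: (proj2 (iso_class_eq x _)); exists f; rewrite /conj_map fr.
  by congr (_, _, _); apply/esym/conjg_fixP/commgP/commute_sym.
have -> : [set X in tree_classes | iter e (@internal_rotation D) X == X] =
    (@iso_class D) @: Xe.
  apply/setP=> X; rewrite inE; apply/andP/imsetP.
    by case=> /tree_classesP[x [pl lf ->]]; rewrite fixP // => xX; exists x.
  case=> x xX ->; have [pl lf] := XeP x xX; rewrite fixP // xX; split=> //.
  by apply/tree_classesP; exists x.
transitivity #|Xe|.
  rewrite -sum_nat_const -[RHS]sum1_card.
  rewrite [RHS](partition_big (@iso_class D) (fun X => X \in (@iso_class D) @: Xe)) /=; last first.
    by move=> x; apply: imset_f.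
  apply: eq_bigr => X /imsetP[x xX ->]; have [pl lf] := XeP x xX.
  have [aK an tr dd] := pl; rewrite -(card_iso_class tr) -sum1_card.
  apply: eq_bigl => y; apply/idP/andP => [yx|[_ /eqP <-]]; last exact: iso_class_refl.
  have [f yE] := mem_iso_class x y yx; subst y.
  split; last by rewrite iso_class_conj.
  rewrite -fixP ?iso_class_conj ?fixP //; first exact: plane_conj.
  by rewrite (iso_leaf _ (conj_map_iso x f)).
rewrite -sum1_card (partition_big (fun x : rooted_map D => x.1) (mem (plane_aut k))) /=.
  rewrite -sum_nat_const; apply: eq_bigr => -[s a] pk.
  have [pl _] : plane s a /\ True by move: pk; rewrite inE => /asboolP[].
  have [_ _ _ dd] := pl.
  have inj : injective (fun h : D => ((s, a), h) : rooted_map D) by move=> h h' [].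
  rewrite -(card_internal dd) -(card_imset _ inj) -sum1_card.
  apply: eq_bigl => -[sa h]; apply/andP/imsetP => [[]|[h' + [-> ->]]].
    by rewrite !inE => /andP[_ lh] /eqP/= e'; subst sa; exists h; rewrite ?inE.
  rewrite !inE => lh; split=> //; rewrite lh andbT.
  by move: pk; rewrite inE.
by move=> x; rewrite !inE => /andP[pk _]; case: x pk => -[].
Qed.

End TreeClasses.

(** * Plane trees with an automorphism of given order *)

Lemma card_classes (T : finType) (cl : T -> {set T}) (S : {set T}) z :
    (forall x, x \in cl x) -> (forall x y, y \in cl x -> cl y = cl x) ->
    (forall x, x \in S -> cl x \subset S) -> (forall x, x \in S -> #|cl x| = z) ->
  z %| #|S|.
Proof.
move=> cl_refl cl_eq clS clz.
rewrite -sum1_card (partition_big cl (mem (cl @: S))) /=; last exact: imset_f.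
rewrite (eq_bigr (fun=> z)) => [|_ /imsetP[x xS ->]].
  by rewrite sum_nat_const dvdn_mull.
rewrite -(clz x xS) -sum1_card; apply: eq_bigl => y; apply/andP/idP => [[_ /eqP <-]//|yx].
by rewrite (cl_eq _ _ yx) eqxx (subsetP (clS x xS)).
Qed.

Lemma solve_modn m i e : 0 < m -> gcdn m i %| e -> exists t, i * t = e %[mod m].
Proof.
move=> m0 /dvdnP[e' eE]; have [b _ mb] := Bezoutl i m0.
exists (b * m.-1 * e'); apply/eqP; rewrite -(eqn_modDr (gcdn m i * m.-1 * e')).
have -> : i * (b * m.-1 * e') + gcdn m i * m.-1 * e' =
  (gcdn m i + b * i) * (m.-1 * e') by ring.
have -> : e + gcdn m i * m.-1 * e' = m * (gcdn m i * e').
  transitivity (m.-1.+1 * (gcdn m i * e')); last by rewrite prednK.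
  by rewrite {1}eE mulSn; ring.
by rewrite -modnMml (eqP mb) mul0n modnMr mod0n.
Qed.

Section Automorphisms.

Variables (D : finType) (s a : {perm D}).
Hypotheses (aK : involutive a) (an : forall h, a h != h).
Hypothesis conn : transitive2 s a.
Hypothesis cnt : #|porbits s|.*2 = #|D|.+2.

(** An automorphism commutes with the corner permutation [a * s], which is a single cycle, and so is
    a power of it. *)
Lemma aut_in_faces f (x0 : D) : commute f s -> commute f a -> f \in <[(a * s)%g]>%g.
Proof.
move=> fs fa; have [i fi] := face_transitive aK an conn cnt x0 (f x0).
have fphi : commute f (a * s)%g by apply: commuteM.
suff -> : f = ((a * s) ^+ i)%g by apply: mem_cycle.
apply/permP=> y; have [j ->] := face_transitive aK an conn cnt x0 y.
rewrite (commute_permE _ (commuteX j fphi)) fi -!permM.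
by rewrite -!expgD addnC.
Qed.

(** Both lie in the cyclic group generated by [a * s], which has at most one subgroup of a given
    order. *)
Lemma aut_same_order f g (x0 : D) : commute f s -> commute f a -> commute g s ->
  commute g a -> #[f]%g = #[g]%g -> exists t, g = (f ^+ t)%g.
Proof.
move=> fs fa gs ga e; apply/cycleP.
have eqc := eq_subG_cyclic (cycle_cyclic (a * s)%g) (H := <[f]>%G) (K := <[g]>%G).
have := eqc; rewrite !cycle_subG !aut_in_faces // => /(_ isT isT).
by rewrite /= -!orderE e eqxx => /eqP->; apply: cycle_id.
Qed.

End Automorphisms.

Lemma expg_porbit_inj (D : finType) (s : {perm D}) x i j :
    i < #|porbit s x| -> j < #|porbit s x| -> (s ^+ i)%g x = (s ^+ j)%g x ->
  i = j.
Proof.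
move=> li lj e; apply/eqP.
rewrite -(nth_uniq x _ _ (uniq_traject_porbit s x)) ?size_traject //.
by rewrite !nth_traject // -!permX e.
Qed.

Section Types.

Variables (D : finType) (k' : nat) (s f : {perm D}).
Notation k := k'.+1.
Hypotheses (fs : commute f s) (fk : (f ^+ k)%g = 1%g).

Lemma card_porbit_aut x : #|porbit s (f x)| = #|porbit s x|.
Proof.
rewrite -(card_porbit_conj s f x); congr #|porbit _ _|.
exact/esym/conjg_fixP/commgP/commute_sym.
Qed.

Lemma card_porbit_orbit2 x y : y \in orbit2 s f x -> #|porbit s y| = #|porbit s x|.
Proof.
case/orbit2P=> i [j ->]; rewrite porbit_perm.
by elim: j => [|j IH]; rewrite ?expg0 ?perm1 // expgSr permM card_porbit_aut.
Qed.

Lemma typed_free x : (forall b, 0 < b < k -> (f ^+ b)%g x \notin porbit s x) ->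
  typed k s f (#|porbit s x|, false) x.
Proof.
move=> free; split=> /=; first by rewrite lt0n card_porbit_neq0.
  by rewrite expg0 perm1 -[RHS](iter_porbit s x) permX.
have sep i c i' c' : c < c' < k ->
    (s ^+ i)%g ((f ^+ c)%g x) = (s ^+ i')%g ((f ^+ c')%g x) -> False.
  move=> /andP[lt lk] e; have b0 : 0 < c' - c < k by lia.
  case/negP: (free _ b0); rewrite -eq_porbit_mem.
  have e2 : (s ^+ i)%g x = (s ^+ i')%g ((f ^+ (c' - c))%g x).
    apply: (@perm_inj _ (f ^+ c)%g); rewrite (sf_commute fs i c) e (sf_commute fs i' c).
    by rewrite -[(f ^+ c)%g ((f ^+ _)%g x)]permM -expgD subnK ?(ltnW lt).
  by have := congr1 (porbit s) e2; rewrite !porbit_perm => ->.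
move=> i c i' c' li lc li' lc' e.
have [lt|lt|ec] := ltngtP c c'.
- by case: (sep _ _ _ _ _ e); rewrite lt.
- by case: (sep i' c' i c); rewrite ?lt.
subst c'; split=> //; set y := (f ^+ c)%g x in e.
have dy : #|porbit s y| = #|porbit s x|.
  by apply: card_porbit_orbit2; apply/orbit2P; exists 0, c; rewrite expg0 perm1.
by apply: (expg_porbit_inj _ _ e); rewrite dy.
Qed.

Variable (ts : seq (nat * bool)).

Lemma marking_count_gt0 : {in ts, forall t, 0 < t.1} ->
  0 < marking_count (fun t => k * t.1) ts.
Proof.
elim: ts => //= t r IH pos; rewrite eqxx !muln_gt0 /= (pos t) ?mem_head //= IH //.
by move=> u ur; apply: pos; rewrite inE ur orbT.
Qed.

(** The count of markings is positive, so one exists, and its entries serve as base points. *)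
Lemma frame_of_types (x0 : D) (ty : D -> nat * bool) :
    #|D| = k * sumn [seq t.1 | t <- ts] -> {in ts, forall t, 0 < t.1} ->
    (forall x, typed k s f (ty x) x) ->
    (forall x y, y \in orbit2 s f x -> ty y = ty x) ->
    {in ts, forall t, #|[set x | ty x == t]| = k * t.1 * count_mem t ts} ->
  exists m, frame k' (ts := ts) s f m.
Proof.
move=> cD pos tyP ty_eq cnt.
have sz : size (markings (orbit2 s f) ty [set: D] ts) = marking_count (fun t => k * t.1) ts.
  apply: size_markings => //.
  - exact: orbit2_refl.
  - exact: orbit2_eq.
  - by move=> x; apply: (card_orbit2 (ltn0Sn k') fs fk).
  - by move=> t /cnt <-; apply: eq_card => x; rewrite !inE.
have [ms msM] : exists ms, ms \in markings (orbit2 s f) ty [set: D] ts.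
  case: (markings _ _ _ _) sz => [|ms r] /= sz; last by exists ms; rewrite mem_head.
  by have := marking_count_gt0 pos; rewrite -sz.
move: msM; rewrite mem_markings => /(good_markingP _ _ _ _ _ x0 (0, false))[sm _ mty msep].
exists (fun v => nth x0 ms v); apply: frame_of_marks => //.
- by rewrite card_cell.
- by move=> v; rewrite /vtype -mty.
move=> u v uv; have [uv'|vu|/val_inj e] := ltngtP u v.
- by apply: msep; rewrite uv' /=.
- apply: contraNN (msep v u _); last by rewrite vu /=.
  exact: orbit2_sym.
by rewrite e eqxx in uv.
Qed.

Definition type_degree (t : nat * bool) : nat := if t.2 then k * t.1 else t.1.

Lemma frame_degree m i : frame k' (ts := ts) s f m ->
  #|[set x | #|porbit s x| == i]| = \sum_(t <- ts | type_degree t == i) k * t.1.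
Proof.
move=> fr; have [_ _ mt [c placeK cK]] := fr.
rewrite (big_nth (0, false)) big_mkord -sum1_card.
rewrite (partition_big (fun x => tag (c x).1) (fun v => type_degree (vtype v) == i)) /=.
  apply: eq_bigr => v vi; rewrite -(card_orbit2 (ltn0Sn k') fs fk (mt v)) -sum1_card.
  apply: eq_bigl => x; rewrite inE (orbit2_place fr cK placeK).
  have [e|] := eqVneq (tag (c x).1) v; rewrite ?andbF // andbT.
  have := typed_degree (ltn0Sn k') fs fk (typed_orbit2 fs (x := m v) (y := x) _ (mt v)).
  by rewrite (orbit2_place fr cK placeK) e eqxx => /(_ isT) ->.
move=> x; rewrite inE => /eqP <-; apply/eqP.
have := typed_degree (ltn0Sn k') fs fk (typed_orbit2 fs (x := m (tag (c x).1)) (y := x) _ (mt _)).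
by rewrite (orbit2_place fr cK placeK) eqxx => /(_ isT) ->.
Qed.

Lemma frame_order m : frame k' (ts := ts) s f m -> 0 < size ts -> #[f]%g = k.
Proof.
move=> [_ _ mt _] N0; have [t0 _ inj] := mt (Ordinal N0).
apply/eqP; rewrite eqn_leq dvdn_leq ?order_dvdn ?fk //= leqNgt; apply/negP=> lt.
have [] := inj 0 0 0 #[f]%g t0 isT t0 lt; first by rewrite expg_order.
by move=> _ /esym/eqP; rewrite -leqn0 leqNgt order_gt0.
Qed.

End Types.

Lemma sum_node_types_degree k a r i : uniq r ->
  \sum_(t <- node_types a r | t.1 == i) k * t.1 = if i \in r then k * i * a i else 0.
Proof.
elim: r => [|j r IH] /=; first by rewrite big_nil.
case/andP=> jr ur; rewrite /node_types /= big_cat /= -/(node_types a r) IH //.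
have -> : \sum_(t <- nseq (a j) (j, false) | t.1 == i) k * t.1 = if j == i then k * i * a i else 0.
  case: eqVneq => [<-|ne]; last first.
    rewrite big_seq_cond big1 // => t /andP[].
    by rewrite mem_nseq => /andP[_ /eqP-> /=]; rewrite (negbTE ne).
  elim: (a j) => [|q IHq] /=; first by rewrite big_nil muln0.
  by rewrite big_cons /= eqxx IHq mulnS.
rewrite inE [i == j]eq_sym; case: eqVneq => [e|] //=.
by rewrite -e (negbTE jr) addn0.
Qed.

Lemma count_node_types a r i : uniq r -> i \in r ->
  count_mem (i, false) (node_types a r) = a i.
Proof.
elim: r => //= j r IH /andP[jr ur]; rewrite /node_types /= count_cat count_nseq /= xpair_eqE andbT.
rewrite inE => /predU1P[->|ir].
  by rewrite eqxx mul1n (count_memPn _) ?addn0 // -/(node_types a r) mem_node_types (negbTE jr).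
by rewrite (IH ur ir); case: eqVneq => // e; rewrite e ir in jr.
Qed.

(** * The quotient of a plane tree about its centre *)

Section Centers.

Variables (D : finType) (d : nat -> nat) (N n : nat).
Hypothesis dN : forall i, N < i -> d i = 0.
Hypothesis d_sum : \sum_(1 <= i < N.+1) d i = n.+1.
Hypothesis d_deg : \sum_(1 <= i < N.+1) i * d i = 2 * n.
Hypothesis n_ge2 : 2 <= n.
Hypothesis cD : #|D| = 2 * n.

Lemma node_centered_degree_sum k j : node_centered d N n k j ->
  k * (j %/ k + \sum_(1 <= i < N.+1) i * (d i %/ k)) = 2 * n.
Proof.
case=> _ jN kj dj di; rewrite -d_deg mulnDr [k * _]mulnC divnK // big_distrr /=.
have jr : j \in index_iota 1 N.+1 by rewrite mem_index_iota.
rewrite (bigD1_seq j jr (iota_uniq _ _)) [in RHS](bigD1_seq j jr (iota_uniq _ _)) /=.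
rewrite addnA {2}(divn_eq (d j) k) dj; congr (_ + _); first by ring.
rewrite big_seq_cond [RHS]big_seq_cond; apply: eq_bigr => i /andP[].
by rewrite mem_index_iota => iN ij; rewrite {2}(divn_eq (d i) k) (eqP (di i iN ij)); ring.
Qed.

Section PlaneTree.

Variables (s a : {perm D}).
Hypothesis pl : plane d s a.

Let aK : involutive a. Proof. by case: pl. Qed.
Let an : forall h, a h != h. Proof. by case: pl. Qed.
Let conn : transitive2 s a. Proof. by case: pl. Qed.
Let dd : degree_dist d s. Proof. by case: pl. Qed.
Let cnt : #|porbits s|.*2 = #|D|.+2.
Proof. exact: degree_dist_count dN d_sum cD _ dd. Qed.

Section Aut.

Variables (k' : nat) (f : {perm D}).
Notation k := k'.+1.
Hypotheses (fs : commute f s) (fa : commute f a) (fk : #[f]%g = k).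

Lemma aut_expg1 : (f ^+ k)%g = 1%g.
Proof. by rewrite -fk expg_order. Qed.

Lemma aut_expg_neq1 b : 0 < b < k -> (f ^+ b)%g != 1%g.
Proof.
move=> /andP[b0 bk]; rewrite -order_dvdn fk; apply/negP=> /(dvdn_leq b0).
by rewrite leqNgt bk.
Qed.

Lemma aut_free b x : (f ^+ b)%g x = x -> (f ^+ b)%g = 1%g.
Proof. by apply: (@automorphism_free _ s a) => //; apply: commuteXl. Qed.

Lemma card_porbit_aut_free x : #|porbit f x| = k.
Proof.
apply: card_porbit_period => [//||]; first by rewrite aut_expg1 perm1.
have sep i j : i < j < k -> (f ^+ i)%g x = (f ^+ j)%g x -> False.
  move=> /andP[ij jk] e; have b0 : 0 < j - i < k by lia.
  case/eqP: (aut_expg_neq1 b0); apply: (aut_free (x := (f ^+ i)%g x)).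
  by rewrite -permM -expgD subnKC ?(ltnW ij).
move=> i j ik jk e; have [lt|lt|//] := ltngtP i j.
  by case: (sep i j) => //; rewrite lt.
by case: (sep j i) => //; rewrite lt.
Qed.

(** Away from the centre the powers of [f] permute the nodes freely, so the half-edges at nodes of
    degree i split into classes of [k * i] elements. *)
Lemma degree_rest (A : {set D}) i : 0 < i ->
    (forall x y, x \in A -> y \in orbit2 s f x -> y \in A) ->
    (forall x, x \notin A -> forall b, 0 < b < k -> (f ^+ b)%g x \notin porbit s x) ->
  k * i %| #|[set x | #|porbit s x| == i] :\: A|.
Proof.
move=> i0 clA freeA.
apply: (card_classes (cl := orbit2 s f)).
- by move=> x; apply: orbit2_refl.
- by move=> x y; apply: orbit2_eq.
- move=> x; rewrite !inE => /andP[xA xi]; apply/subsetP=> y yx; rewrite !inE.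
  rewrite (card_porbit_orbit2 fs yx) xi andbT; apply: contra xA => yA.
  by apply: (clA y) => //; apply: orbit2_sym.
move=> x; rewrite !inE => /andP[xA /eqP xi].
have := typed_free fs (freeA x xA).
by move/(card_orbit2 (ltn0Sn k') fs aut_expg1) => ->; rewrite /= xi.
Qed.

Lemma edge_center_dvd i : 1 < k -> (forall y, f y \notin porbit s y) -> k = 2 ->
  0 < i -> 2 %| d i.
Proof.
move=> k1 free k2 i0; have := degree_rest (A := set0) i0.
rewrite setD0 dd // k2 [i * _]mulnC dvdn_pmul2r //; apply=> x; first by rewrite inE.
by move=> _ b /andP[b0 bk]; have -> : b = 1 by [lia]; rewrite expg1.
Qed.

Section NodeCenter.

Variable x1 : D.
Hypothesis k1 : 1 < k.
Hypothesis fx1 : f x1 \in porbit s x1.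
Hypothesis center : forall i y, (f ^+ i)%g != 1%g -> (f ^+ i)%g y \in porbit s y ->
  y \in porbit s x1.
Notation A := (porbit s x1).
Notation j := #|A|.

Lemma center_stable x y : x \in A -> y \in orbit2 s f x -> y \in A.
Proof.
move=> xA /orbit2P[b [c ->]].
rewrite -eq_porbit_mem porbit_perm -imset_porbit; last by apply: commuteXl.
move: xA; rewrite -eq_porbit_mem => /eqP->; rewrite imset_porbit; last by apply: commuteXl.
by rewrite eq_porbit_mem; apply: mem_porbit_expg.
Qed.

Lemma center_free x : x \notin A -> forall b, 0 < b < k -> (f ^+ b)%g x \notin porbit s x.
Proof. by move=> xA b b0; apply: contra xA; apply/center/aut_expg_neq1. Qed.

Lemma center_dvd : k %| j.
Proof.
apply: (card_classes (cl := porbit f)) => [x|x y|x xA|x _].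
- exact: porbit_id.
- by rewrite -eq_porbit_mem => /eqP.
- apply/subsetP=> y /porbitP[b ->]; apply: (center_stable xA).
  by apply/orbit2P; exists 0, b; rewrite expg0 perm1.
exact: card_porbit_aut_free.
Qed.

Lemma card_degree_center i : 0 < i ->
  i * d i = #|[set x | #|porbit s x| == i] :\: A| + (i == j) * j.
Proof.
move=> i0; rewrite -dd //; set S := [set x | _]; rewrite -(cardsID A S) addnC; congr (_ + _).
have [e|ne] := eqVneq i j.
  rewrite mul1n; congr #|pred_of_set _|; apply/setIidPr/subsetP=> x xA.
  by rewrite inE e; move: xA; rewrite -eq_porbit_mem => /eqP->.
apply/eqP; rewrite mul0n cards_eq0; apply/set0Pn=> -[x]; rewrite !inE => /andP[/eqP xi].
by rewrite -eq_porbit_mem => /eqP e; rewrite -xi e eqxx in ne.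
Qed.

Lemma center_rest i : 0 < i ->
  #|[set x | #|porbit s x| == i] :\: A| = k * i * (d i %/ k) /\ d i %% k = (i == j).
Proof.
move=> i0; have /dvdnP[q qE] := degree_rest i0 center_stable center_free.
have := card_degree_center i0; rewrite qE.
have -> : (i == j) * j = i * (i == j) by case: eqVneq => [->|]; rewrite ?muln1 ?mul1n ?muln0.
rewrite (_ : q * (k * i) = i * (q * k)); last by rewrite mulnC [k * i]mulnC -mulnA [k * q]mulnC.
rewrite -mulnDr => /eqP; rewrite eqn_pmul2l // => /eqP ->.
have lt : (i == j) < k by case: (i == j).
by rewrite divnMDl // divn_small // addn0 modnMDl modn_small //; split=> //; lia.
Qed.

Lemma center_node_centered : node_centered d N n k j.
Proof.
have j0 : 0 < j by rewrite lt0n card_porbit_neq0.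
have [_ dj] := center_rest j0; rewrite eqxx in dj.
have jN : 0 < j < N.+1.
  by rewrite j0 ltnS leqNgt; apply/negP=> /dN e; rewrite e mod0n in dj.
have di i : 0 < i < N.+1 -> i != j -> k %| d i.
  by case/andP=> i0 _ ij; case: (center_rest i0) => _; rewrite (negbTE ij) /dvdn => ->.
split=> //; last exact: center_dvd.
have jr : j \in index_iota 1 N.+1 by rewrite mem_index_iota.
have := d_sum; rewrite (bigD1_seq j jr (iota_uniq _ _)) /= (divn_eq (d j) k) dj.
rewrite addn1 addSn => -[<-]; rewrite dvdn_add ?dvdn_mull // big_seq_cond.
by apply: dvdn_sum => i /andP[]; rewrite mem_index_iota => iN ij; apply: di.
Qed.

(* f acts on the central node as some power s ^+ u; the generator of <[f]> acting
   as the least possible power of s is singled out. *)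
Lemma rotation_root : exists t, (f ^+ t)%g x1 = (s ^+ (j %/ k))%g x1.
Proof.
have j0 : 0 < j by rewrite lt0n card_porbit_neq0.
have /porbitP[u fu] := fx1.
have su : (s ^+ j)%g x1 = x1 by rewrite permX iter_porbit.
have fXu t : (f ^+ t)%g x1 = (s ^+ (u * t))%g x1.
  elim: t => [|t IH]; first by rewrite muln0 !expg0.
  rewrite expgS permM fu (sf_commute fs u t) IH.
  by rewrite -permM -expgD mulnS addnC.
have modj b c : b = c %[mod j] -> (s ^+ b)%g x1 = (s ^+ c)%g x1.
  move=> e; rewrite (divn_eq b j) (divn_eq c j) e ![_ * j]mulnC !expgD !expgM !permM.
  have fix1 q : ((s ^+ j) ^+ q)%g x1 = x1.
    by elim: q => [|q IH]; rewrite ?expg0 ?perm1 // expgSr permM IH.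
  by rewrite !fix1.
(* The power of [f] with exponent j / gcd(j, u) acts on the centre as a power of [s ^+ j], so it
   fixes x1 and is trivial; hence k divides that exponent. *)
have gk : gcdn j u * k %| j.
  have /dvdnP[c jE] := dvdn_gcdl j u; have /dvdnP[w uE] := dvdn_gcdr j u.
  have g0 : 0 < gcdn j u by rewrite gcdn_gt0 j0.
  suff kc : k %| c by rewrite [X in _ %| X]jE mulnC dvdn_pmul2r.
  rewrite -fk order_dvdn; apply/eqP; apply: (aut_free (x := x1)).
  rewrite fXu (modj _ 0) ?expg0 ?perm1 //.
  by rewrite {1}uE -mulnA [gcdn j u * c]mulnC -jE modnMl mod0n.
have gl : gcdn j u %| j %/ k by rewrite dvdn_divRL ?center_dvd.
have [t te] := solve_modn j0 gl; exists t; rewrite fXu; exact: modj.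
Qed.

(** On the centre, j / k steps of [s] act as g, which is the flagged type; all other nodes are moved
    freely, because the nontrivial powers of g are powers of [f]. *)
Lemma center_frame (x0 : D) : exists g, commute g a /\
  exists m, frame k'
    (ts := (j %/ k, true) :: node_types (fun i => d i %/ k) (index_iota 1 N.+1)) s g m.
Proof.
have [t tE] := rotation_root; set l := j %/ k in tE *; set g := (f ^+ t)%g in tE.
have j0 : 0 < j by rewrite lt0n card_porbit_neq0.
have jl : l * k = j by rewrite divnK ?center_dvd.
have l0 : 0 < l by rewrite -(@ltn_pmul2r k) // mul0n jl.
have gs : commute g s by apply: commuteXl.
have gk : (g ^+ k)%g = 1%g by rewrite -expgM mulnC expgM aut_expg1 expg1n.
have gA x : x \in A -> g x = (s ^+ l)%g x.
  by case/porbitP=> i ->; rewrite commute_permE; [rewrite tE -!permM -!expgD addnC|exact: commuteX].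
have gXA b x : x \in A -> (g ^+ b)%g x = (s ^+ (l * b))%g x.
  move=> xA; elim: b => [|b IH]; first by rewrite muln0 !expg0.
  rewrite expgSr permM IH gA -?permM -?expgD ?mulnSr //.
  by rewrite -eq_porbit_mem porbit_perm eq_porbit_mem.
have dA x : x \in A -> #|porbit s x| = j by rewrite -eq_porbit_mem => /eqP ->.
have g1 b : 0 < b < k -> (g ^+ b)%g != 1%g.
  case/andP=> b0 bk; apply/eqP=> e; have := gXA b x1 (porbit_id _ _).
  rewrite e perm1 => /esym H; have : l * b = 0.
    by apply: (@expg_porbit_inj D s x1); rewrite ?expg0 ?perm1 // -jl ltn_pmul2l.
  by move/eqP; rewrite muln_eq0 !gtn_eqF.
have free x : x \notin A -> forall b, 0 < b < k -> (g ^+ b)%g x \notin porbit s x.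
  move=> xA b b0; apply: contra xA; rewrite /g -expgM; apply: center.
  by rewrite expgM; apply: g1.
have clA x y : y \in orbit2 s g x -> (y \in A) = (x \in A).
  suff H u v : v \in orbit2 s g u -> u \in A -> v \in A.
    by move=> yx; apply/idP/idP; apply: H => //; apply: orbit2_sym.
  case/orbit2P=> b [c ->] uA; apply: (center_stable uA).
  by apply/orbit2P; exists b, (t * c); rewrite expgM.
pose ty x : nat * bool := if x \in A then (l, true) else (#|porbit s x|, false).
exists g; split; first exact: commuteXl.
apply: (frame_of_types gs gk x0 (ty := ty)).
- by rewrite /= sum_node_types cD (node_centered_degree_sum center_node_centered).
- move=> u; rewrite inE => /predU1P[->|]//.
  by case: u => i b; rewrite mem_node_types mem_index_iota => /and3P[/andP[]].
- move=> x; rewrite /ty; case: ifP => [xA|/negbT xA]; last by apply: typed_free => //; apply: free.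
  split=> //=; first by rewrite expg1 gA.
  move=> i c i' c' li lc li' lc'; rewrite !gXA // -!permM -!expgD => e.
  have bnd q r : q < l -> r < k -> l * r + q < #|porbit s x|.
    by move=> ql rk; rewrite dA // -jl; nia.
  have := expg_porbit_inj (bnd _ _ li lc) (bnd _ _ li' lc') e.
  by move=> e2; have : c = c'; [nia|move=> ec; split=> //; move: e2; rewrite ec => /addnI].
- by move=> x y yx; rewrite /ty (clA x y yx) (card_porbit_orbit2 gs yx).
move=> u; rewrite inE => /predU1P[->|].
  rewrite /= eqxx (count_memPn _) ?addn0 ?muln1 1?mulnC ?jl ?mem_node_types ?andbF //.
  apply: eq_card => x; rewrite inE /ty; case: (x \in A); rewrite ?eqxx //.
  by rewrite xpair_eqE andbF.
case: u => i b; rewrite mem_node_types => /and3P[ir _ /negbTE->].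
have i0 : 0 < i by move: ir; rewrite mem_index_iota => /andP[].
rewrite /= count_node_types ?iota_uniq // (_ : (l, true) == (i, false) = false); last first.
  by apply/eqP=> -[].
rewrite add0n -(proj1 (center_rest i0)); apply: eq_card => x; rewrite !inE /ty.
by case: (x \in A); rewrite ?xpair_eqE ?andbT ?andbF.
Qed.

End NodeCenter.

Lemma free_frame (x0 : D) : (forall x b, 0 < b < k -> (f ^+ b)%g x \notin porbit s x) ->
    (forall i, 0 < i -> k %| d i) ->
  exists m, frame k' (ts := node_types (fun i => d i %/ k) (index_iota 1 N.+1)) s f m.
Proof.
move=> free kd; apply: (frame_of_types fs aut_expg1 x0 (ty := fun x => (#|porbit s x|, false))).
- rewrite sum_node_types cD -d_deg big_distrr /= big_seq [RHS]big_seq.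
  apply: eq_bigr => i; rewrite mem_index_iota => /andP[i0 _].
  by rewrite {1}(divn_eq (d i) k) (eqP (kd i i0)); ring.
- by move=> [i b]; rewrite mem_node_types mem_index_iota => /and3P[/andP[]].
- by move=> x; apply: (typed_free fs (free x)).
- by move=> x y yx; rewrite (card_porbit_orbit2 fs yx).
move=> [i b]; rewrite mem_node_types => /and3P[ir _ /negbTE->].
have i0 : 0 < i by move: ir; rewrite mem_index_iota => /andP[].
rewrite count_node_types ?iota_uniq //= -mulnA [i * _]mulnC mulnA [k * _]mulnC divnK ?kd //.
by rewrite mulnC -dd //; apply: eq_card => x; rewrite !inE xpair_eqE andbT.
Qed.

End Aut.
End PlaneTree.
End Centers.

Section PlaneAut.

Variables (D : finType) (d : nat -> nat) (N n : nat).
Hypothesis dN : forall i, N < i -> d i = 0.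
Hypothesis d_sum : \sum_(1 <= i < N.+1) d i = n.+1.
Hypothesis d_deg : \sum_(1 <= i < N.+1) i * d i = 2 * n.
Hypothesis n_ge2 : 2 <= n.
Hypothesis cD : #|D| = 2 * n.

Notation types k := (node_types (fun i => d i %/ k) (index_iota 1 N.+1)).

Lemma inhabited_half_edges : exists x0 : D, true.
Proof.
have /card_gt0P[x _] : 0 < #|D| by rewrite cD muln_gt0 (ltnW n_ge2).
by exists x.
Qed.

Lemma sum_type_degree k' i : 0 < i ->
  \sum_(t <- types k'.+1 | type_degree k' t == i) k'.+1 * t.1 = i * (d i %/ k'.+1 * k'.+1).
Proof.
move=> i0; rewrite big_seq_cond (eq_bigl (fun t => (t \in types k'.+1) && (t.1 == i))).
  rewrite -big_seq_cond sum_node_types_degree ?iota_uniq // mem_index_iota i0 /= ltnS.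
  by case: leqP => [_|/dN ->]; rewrite ?div0n ?mul0n ?muln0 //; ring.
case=> j b; apply/andb_id2l; rewrite mem_node_types => /and3P[_ _ /negbTE->].
by [].
Qed.

Lemma free_frame_degree k' (s f : {perm D}) m : (forall i, 0 < i -> k'.+1 %| d i) ->
  frame k' (ts := types k'.+1) s f m -> degree_dist d s.
Proof.
move=> kd fr i i0; have [fs fk _ _] := fr.
by rewrite (frame_degree fs fk i fr) sum_type_degree // divnK ?kd.
Qed.

Lemma center_frame_degree k' j (s f : {perm D}) m : node_centered d N n k'.+1 j ->
  frame k' (ts := (j %/ k'.+1, true) :: types k'.+1) s f m -> degree_dist d s.
Proof.
case=> _ /andP[j0 jN] kj dj di fr i i0; have [fs fk _ _] := fr.
rewrite (frame_degree fs fk i fr) big_cons sum_type_degree // /type_degree /=.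
rewrite [k'.+1 * _]mulnC divnK // [j == i]eq_sym.
case: (eqVneq i j) => [->|ij]; last first.
  have [iN|/dN ->] := leqP i N; last by rewrite div0n mul0n.
  by rewrite divnK // di // i0 ltnS.
by rewrite [in RHS](divn_eq (d j) k'.+1) dj mulnDr muln1 addnC.
Qed.

(** Forgetting the automorphism is injective on lifted trees when having a frame determines it, and
    surjective when every tree with an automorphism of order [k'.+1] has a normalized one. *)
Lemma card_plane_aut_lifted k' ts : 0 < size ts ->
    (forall (s f : {perm D}) m, frame k' (ts := ts) s f m -> degree_dist d s) ->
    (forall s a : {perm D}, plane d s a ->
       (exists f, [/\ commute f s, commute f a & #[f]%g = k'.+1]) ->
       exists f, commute f a /\ exists m, frame k' (ts := ts) s f m) ->
    (forall (s a f g : {perm D}) m m', plane d s a -> commute f a -> commute g a ->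
       frame k' (ts := ts) s f m -> frame k' (ts := ts) s g m' -> f = g) ->
  #|plane_aut D d k'.+1| = #|lifted_trees k' ts D|.
Proof.
move=> ts0 degs ex uni.
pose pr (y : {perm D} * {perm D} * {perm D}) := (y.1.1, y.2).
have liftP y : y \in lifted_trees k' ts D ->
    [/\ plane d y.1.1 y.2, commute y.1.2 y.2 & exists m, frame k' (ts := ts) y.1.1 y.1.2 m].
  rewrite inE => /andP[/asboolP[m fr] /invariant_matchingsP[aK an af conn]].
  split; [split=> //; exact: degs fr| |by exists m].
  by apply/permP=> x; rewrite !permM af.
have <- : pr @: lifted_trees k' ts D = plane_aut D d k'.+1.
  apply/setP=> -[s a]; apply/imsetP/idP => [[y /liftP[pl fa [m fr]] [-> ->]]|].
    rewrite inE; apply/asboolP; split=> //; exists y.1.2; split=> //; first by case: fr.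
    by have [fs fk _ _] := fr; apply: (frame_order fk fr).
  rewrite inE => /asboolP[pl /(ex _ _ pl)[f [fa [m fr]]]].
  exists (s, f, a) => //; rewrite inE; apply/andP; split; first by apply/asboolP; exists m.
  case: pl => aK an conn _; apply/invariant_matchingsP; split=> // x.
  by rewrite -!permM fa.
rewrite card_in_imset // => -[[s f] a] [[s' f'] a'] /liftP[pl fa [m fr]] /liftP[pl' fa' [m' fr']].
move=> [es ea]; move: pl pl' fa fa' fr fr'; rewrite /= -es -ea => pl _ fa fa' fr fr'.
by rewrite (uni _ _ _ _ _ _ pl fa fa' fr fr').
Qed.

Section Uniqueness.

Variables (s a f g : {perm D}).
Hypothesis pl : plane d s a.
Hypotheses (fs : commute f s) (fa : commute f a) (gs : commute g s) (ga : commute g a).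
Hypothesis fg : #[f]%g = #[g]%g.

Lemma same_order_power : exists t, g = (f ^+ t)%g.
Proof.
have [x0 _] := inhabited_half_edges; have [aK an conn dd] := pl.
have cnt : #|porbits s|.*2 = #|D|.+2 by apply: (degree_dist_count dN d_sum cD dd).
exact: (aut_same_order aK an conn cnt x0 fs fa gs ga fg).
Qed.

(** A cyclic group of order at most 2 has only one generator. *)
Lemma small_order_unique : #[f]%g <= 2 -> f = g.
Proof.
have [t tE] := same_order_power; have := order_gt0 f; case e: #[f]%g => [|[|[|o]]] // _ _.
  move/eqP: e fg; rewrite order_eq1 => /eqP->; rewrite order1 => /esym/eqP.
  by rewrite order_eq1 => /eqP.
have f2 : (f ^+ 2)%g = 1%g by rewrite -e expg_order.
move: tE; rewrite -(odd_double_half t) expgD -mul2n expgM f2 expg1n mulg1.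
case: (odd t) => g1; first by rewrite g1 [(f ^+ _)%g]expg1.
by move: fg; rewrite e g1 expg0 order1.
Qed.

(** Both rotations preserve the same node; turning it by the same amount [l], they agree at y, and
    automorphisms act freely. *)
Lemma center_unique l x y : f != 1%g -> #[f]%g != 2 \/ (exists z, f z \in porbit s z) ->
  f x = (s ^+ l)%g x -> g y = (s ^+ l)%g y -> f = g.
Proof.
move=> f1 ncen fx gy; have [aK an conn dd] := pl.
have cnt : #|porbits s|.*2 = #|D|.+2 by apply: (degree_dist_count dN d_sum cD dd).
have [[x1 _ cen]|[o2 _ free]] := automorphism_center aK an conn cnt fs fa f1; last first.
  by case: ncen => [|[z]]; rewrite ?o2 // (negbTE (free z)).
have [t tE] := same_order_power.
have xc : x \in porbit s x1 by apply: (cen 1); rewrite ?expg1 ?fx ?mem_porbit.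
have yc : y \in porbit s x1.
  apply: (cen t); rewrite -tE ?gy ?mem_porbit //.
  by rewrite -order_eq1 -fg order_eq1.
have /porbitP[i yE] : y \in porbit s x.
  by move: xc yc; rewrite -!eq_porbit_mem => /eqP-> /eqP->.
apply/eqP; rewrite eq_sym eq_mulgV1; apply/eqP.
have fVs : commute f^-1%g s by apply/commute_sym/commuteV/commute_sym.
have fVa : commute f^-1%g a by apply/commute_sym/commuteV/commute_sym.
apply: (@automorphism_free _ s a _ y) => //.
- by apply/commute_sym/commuteM; apply/commute_sym.
- by apply/commute_sym/commuteM; apply/commute_sym.
apply: (@perm_inj _ f); rewrite permM permKV gy yE -!permM -expgD.
by rewrite [RHS]permM (commute_permE _ (commuteX i fs)) fx -permM -expgD addnC.
Qed.

End Uniqueness.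

Lemma aut_center k' (s a f : {perm D}) : plane d s a -> commute f s -> commute f a ->
    #[f]%g = k'.+1 -> 1 < k'.+1 ->
  (exists2 x, f x \in porbit s x & forall i y, (f ^+ i)%g != 1%g ->
       (f ^+ i)%g y \in porbit s y -> y \in porbit s x) \/
  (k'.+1 = 2 /\ forall y, f y \notin porbit s y).
Proof.
move=> pl fs fa fk k1; have [aK an conn dd] := pl.
have cnt : #|porbits s|.*2 = #|D|.+2 by apply: (degree_dist_count dN d_sum cD dd).
have f1 : f != 1%g by rewrite -order_eq1 fk gtn_eqF.
have [|[o2 _ free]] := automorphism_center aK an conn cnt fs fa f1; first by left.
by right; split=> //; rewrite -fk.
Qed.

Lemma plane_aut_centered k' : 0 < k' -> plane_aut D d k'.+1 != set0 ->
  (exists j, node_centered d N n k'.+1 j) \/ edge_centered d N k'.+1.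
Proof.
move=> k0 /set0Pn[[s a]]; rewrite inE => /asboolP[/= pl [f [fs fa fk]]].
have [[x fx cen]|[k2 free]] := aut_center pl fs fa fk k0.
  left; exists #|porbit s x|.
  by have := center_node_centered dN d_sum d_deg n_ge2 cD pl fs fa fk k0 fx cen.
right; split=> // i /andP[i0 _].
exact: (edge_center_dvd dN d_sum d_deg n_ge2 cD pl fs fk k0 free k2 i0).
Qed.

Lemma card_plane_aut_node k' j : 0 < k' -> node_centered d N n k'.+1 j ->
  #|plane_aut D d k'.+1| = #|lifted_trees k' ((j %/ k'.+1, true) :: types k'.+1) D|.
Proof.
move=> k0 cj; have [x0 _] := inhabited_half_edges.
have [_ jN _ dj _] := cj; have j0 : 0 < j by case/andP: jN.
apply: card_plane_aut_lifted => //.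
- by move=> s f m; apply: center_frame_degree.
- move=> s a pl [f [fs fa fk]].
  have [[x fx cen]|[k2 free]] := aut_center pl fs fa fk k0; last first.
    have := edge_center_dvd dN d_sum d_deg n_ge2 cD pl fs fk k0 free k2 j0.
    by rewrite -k2 /dvdn dj.
  have := center_frame dN d_sum d_deg n_ge2 cD pl fs fa fk k0 fx cen x0.
  have [_ dx] := center_rest dN d_sum d_deg n_ge2 cD pl fs fk k0 fx cen j0.
  by move: dx; rewrite dj; case: eqVneq => // -> _.
move=> s a f g m m' pl fa ga fr fr'.
have [fs fk mt _] := fr; have [gs gk mt' _] := fr'.
have fo := frame_order fk fr isT; have go := frame_order gk fr' isT.
have [_ fx _] := mt ord0; have [_ gx _] := mt' ord0.
apply: (center_unique pl fs fa gs ga _ (l := j %/ k'.+1) (x := m ord0) (y := m' ord0)).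
- by rewrite fo go.
- by rewrite -order_eq1 fo gtn_eqF.
- right; exists (m ord0).
  by rewrite -[f _](congr1 (fun h : {perm D} => h _) (expg1 f)) -fx mem_porbit.
- by rewrite fx expg1.
by rewrite gx expg1.
Qed.

Lemma card_plane_aut_edge : edge_centered d N 2 ->
  #|plane_aut D d 2| = #|lifted_trees 1 (types 2) D|.
Proof.
move=> [_ di]; have [x0 _] := inhabited_half_edges.
have kd i : 0 < i -> 2 %| d i.
  by move=> i0; have [iN|/dN ->//] := leqP i N; apply: di; rewrite i0 ltnS.
have szt : 0 < size (types 2).
  rewrite size_node_types (centered_sum_divn d_sum d_deg n_ge2) //.
  by right; split.
apply: card_plane_aut_lifted => //.
- by move=> s f m; apply: free_frame_degree.
- move=> s a pl [f [fs fa fk]]; exists f; split=> //.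
  apply: (free_frame d_deg cD pl fs fk x0) => //.
  have [[x fx cen]|[_ free]] := aut_center pl fs fa fk isT.
    have j0 : 0 < #|porbit s x| by rewrite lt0n card_porbit_neq0.
    have [_] := center_rest dN d_sum d_deg n_ge2 cD pl fs fk isT fx cen j0.
    by rewrite eqxx (eqP (kd _ j0)).
  by move=> x [|[|b]] // _; rewrite expg1 free.
move=> s a f g m m' pl fa ga fr fr'.
have [fs fk _ _] := fr; have [gs gk _ _] := fr'.
have fo := frame_order fk fr szt; have go := frame_order gk fr' szt.
by apply: (small_order_unique pl fs fa gs ga); rewrite fo ?go.
Qed.

Lemma card_plane_aut1 : #|plane_aut D d 1| = #|lifted_trees 0 (types 1) D|.
Proof.
have [x0 _] := inhabited_half_edges.
have szt : 0 < size (types 1).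
  by rewrite size_node_types (eq_bigr d) ?d_sum // => i _; rewrite divn1.
apply: card_plane_aut_lifted => //.
- by move=> s f m; apply: free_frame_degree => i _; apply: dvd1n.
- move=> s a pl [f [fs fa fk]]; exists f; split=> //.
  apply: (free_frame d_deg cD pl fs fk x0) => [x b|i _]; first by rewrite ltnS leqn0 andbC; case: b.
  exact: dvd1n.
move=> s a f g m m' pl fa ga fr fr'.
have [fs fk _ _] := fr; have [gs gk _ _] := fr'.
have fo := frame_order fk fr szt; have go := frame_order gk fr' szt.
by apply: (small_order_unique pl fs fa gs ga); rewrite fo ?go.
Qed.

End PlaneAut.

(** * The number of fixed classes as a value of the polynomial *)

Section FixedPoints.

Variables (D : finType) (d : nat -> nat) (N n : nat).
Hypothesis dN : forall i, N < i -> d i = 0.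
Hypothesis d_sum : \sum_(1 <= i < N.+1) d i = n.+1.
Hypothesis d_deg : \sum_(1 <= i < N.+1) i * d i = 2 * n.
Hypothesis n_ge2 : 2 <= n.
Hypothesis cD : #|D| = 2 * n.

Let r_pos : forall i, i \in index_iota 1 N.+1 -> 0 < i.
Proof. by move=> i; rewrite mem_index_iota => /andP[]. Qed.

Lemma card_plane_aut_centered k : 1 < k ->
    (exists j, node_centered d N n k j) \/ edge_centered d N k ->
  #|plane_aut D d k| * (k * \prod_(1 <= i < N.+1) (d i %/ k)`!) = #|D|`! * (n.-1 %/ k)`!.
Proof.
move=> k1 cen; have [x0 _] := inhabited_half_edges n_ge2 cD.
have sz := centered_sum_divn d_sum d_deg n_ge2 k1 cen.
case: cen => [[j nc]|ec].
  have ds := node_centered_degree_sum d_deg nc.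
  have [kn jN kj _ _] := nc.
  case: k k1 sz nc ds kn kj => // k' k1 sz nc ds kn kj.
  have l0 : 0 < j %/ k'.+1.
    by rewrite divn_gt0 // dvdn_leq //; case/andP: jN.
  (* Since k divides n, the quotient has n / k edges. *)
  have nE : n = k'.+1 * (n.-1 %/ k'.+1).+1.
    have /dvdnP[[|q] e] := kn; first by move: n_ge2; rewrite e.
    have -> : n.-1 = q * k'.+1 + k' by rewrite e mulSn addSn -pred_Sn addnC.
    by rewrite divnMDl // divn_small // addn0 mulnC.
  rewrite (card_plane_aut_node dN d_sum d_deg n_ge2 cD k1 nc).
  apply: (card_lifted_node x0 (iota_uniq _ _) r_pos k1 l0).
  - by rewrite size_node_types.
  - rewrite sum_node_types -muln2; apply/eqP; rewrite -(@eqn_pmul2l k'.+1) // ds.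
    by rewrite mulnA -nE mulnC.
  by rewrite cD {1}nE; rewrite -muln2; ring.
case: (ec) => k2 di; subst k; rewrite (card_plane_aut_edge dN d_sum d_deg n_ge2 cD ec).
have ds : 2 * \sum_(1 <= i < N.+1) i * (d i %/ 2) = 2 * n.
  rewrite -d_deg big_distrr /= big_seq [RHS]big_seq; apply: eq_bigr => i.
  by rewrite mem_index_iota => iN; rewrite {2}(divn_eq (d i) 2) (eqP (di i iN)); ring.
have no : odd n.
  have : 2 %| n.+1; last by rewrite dvdn2 /= negbK.
  rewrite -d_sum big_seq; apply: dvdn_sum => i.
  by rewrite mem_index_iota => /di.
have := odd_double_half n; rewrite no => nE.
(* Here n is odd, hence at least 3, and (n - 1) / 2, the number of full edges of the quotient, is
   positive. *)
have [p pE] : exists p, n.-1 %/ 2 = p.+1 by exists (n.-1 %/ 2).-1; lia.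
rewrite pE; apply: (card_lifted_edge x0 (iota_uniq _ _) r_pos).
- by rewrite size_node_types sz pE.
- rewrite sum_node_types; apply/double_inj; rewrite -mul2n ds mul2n; congr _.*2; lia.
by rewrite cD; lia.
Qed.

Lemma card_plane_aut_trivial :
  #|plane_aut D d 1| * \prod_(1 <= i < N.+1) (d i)`! = #|D|`! * n.-1`!.
Proof.
have [x0 _] := inhabited_half_edges n_ge2 cD.
rewrite (card_plane_aut1 dN d_sum d_deg n_ge2 cD).
have e (F : nat -> nat) : \sum_(1 <= i < N.+1) F (d i %/ 1) = \sum_(1 <= i < N.+1) F (d i).
  by apply: eq_bigr => i _; rewrite divn1.
rewrite (eq_bigr (fun i => (d i %/ 1)`!)) => [|i _]; last by rewrite divn1.
have pE : n.-1.+1 = n by lia.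
apply: (card_lifted_plain x0 (iota_uniq _ _) r_pos).
- by rewrite size_node_types (eq_bigr d) ?d_sum ?pE // => i _; rewrite divn1.
- rewrite sum_node_types (eq_bigr (fun i => i * d i)) ?d_deg ?pE -?mul2n //.
  by move=> i _; rewrite divn1.
by rewrite cD pE mul2n.
Qed.

Theorem card_fixed_evalz (C : numClosedFieldType) e (z : C) :
    (nb_internal D d %/ gcdn (nb_internal D d) e).-primitive_root%R z ->
  (#|[set X in tree_classes D d | iter e (@internal_rotation D) X == X]|%:R =
   evalz z (sieving_poly d N n))%R.
Proof.
set m := nb_internal D d; set k := m %/ gcdn m e => zk.
have d1 := d1_le d_sum d_deg n_ge2.
have m0 : 0 < m by rewrite /m /nb_internal cD; lia.
have k0 : 0 < k by rewrite divn_gt0 ?gcdn_gt0 ?m0 // dvdn_leq ?dvdn_gcdl.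
have km : k %| m by rewrite /k dvdn_div ?dvdn_gcdl.
have := card_fixed_classes dN d_sum cD e; rewrite -/m -/k.
set Fx := #|_| => FE.
have PE := sieving_polyE d_sum d_deg n_ge2; rewrite -cD -/m in PE.
have D0 : 0 < #|D|`! := fact_gt0 _.
have [k1|] := ltnP 1 k; last first.
  move=> k_le1; have k1 : k = 1 by lia.
  have F0 : (\prod_(1 <= i < N.+1) ((d i)`!)%:R != 0 :> C)%R.
    by rewrite -natr_prod pnatr_eq0 -lt0n prodn_gt0 // => i; apply: fact_gt0.
  apply: (mulIf F0); rewrite (evalz_quotient1 zk PE k1) -natr_prod -natrM; congr (_%:R)%R.
  have := card_plane_aut_trivial; rewrite k1 in FE => H.
  apply/eqP; rewrite -(eqn_pmul2r D0); apply/eqP.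
  rewrite mulnAC FE.
  transitivity (#|plane_aut D d 1| * \prod_(1 <= i < N.+1) (d i)`! * m); first by ring.
  by rewrite H; ring.
(* Without a centre both sides vanish: no plane tree has an automorphism of order k, and a factor
   [PhiK] survives in the numerator. *)
have [cen|ncen] := EM ((exists j, node_centered d N n k j) \/ edge_centered d N k); last first.
  have -> : Fx = 0.
    apply/eqP; rewrite -(eqn_pmul2r D0) FE mul0n muln_eq0 (gtn_eqF m0) orbF cards_eq0.
    apply: contra_notT ncen => ne.
    by case: (k) k1 ne => // k' k1; apply: plane_aut_centered.
  apply/esym/(evalz_quotient0 k0 zk PE km k1); rewrite ltnS leqNgt; apply/negP=> lt.
  by case: ncen; case: (sum_divn_centered d_sum d_deg n_ge2 k1 lt).
have F0 : (k%:R * \prod_(1 <= i < N.+1) ((d i %/ k)`!)%:R != 0 :> C)%R.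
  by rewrite -natr_prod -natrM pnatr_eq0 -lt0n muln_gt0 k0 prodn_gt0 // => i; apply: fact_gt0.
apply: (mulIf F0); rewrite [RHS]mulrA (evalz_quotient k0 zk PE km).
- rewrite -natr_prod -!natrM; congr (_%:R)%R.
  apply/eqP; rewrite -(eqn_pmul2r D0); apply/eqP.
  rewrite mulnAC FE mulnAC card_plane_aut_centered //; ring.
- exact: centered_sum_divn.
- case: cen => [[j [_ jN _ dj di]]|[k2 di]] i; rewrite mem_index_iota => iN.
    by have [->|ij] := eqVneq i j; rewrite ?dj // (eqP (di i iN ij)).
  by rewrite k2 (eqP (di i iN)).
case: cen => [[j [kn _ _ _ _]]|[-> _]]; [left|by right].
have /dvdnP[[|q] e1] := kn; first by move: n_ge2; rewrite e1.
rewrite e1 mulSn; case: (k) k1 => // k' _; rewrite addSn -pred_Sn addnC modnMDl.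
by rewrite modn_small.
Qed.

End FixedPoints.

Local Open Scope ring_scope.

(** * Unimodality *)

Section SubsetSums.

Variable m : nat.
Implicit Types (i j : 'I_m) (S : {set 'I_m.+1}).

Let lo i : 'I_m.+1 := widen_ord (leqnSn m) i.
Let hi i : 'I_m.+1 := lift ord0 i.
(* The action of sl2 on the exterior algebra of its (m + 1)-dimensional
   irreducible representation, on functions of the subsets of {0, .., m}: raise
   and lower move one element by one step, their commutator is diagonal by
   raise_lower, and they are adjoint for the weights below. *)
Definition swap i S : {set 'I_m.+1} := tperm (lo i) (hi i) @^-1: S.
Let c i : nat := (i.+1 * (m - i))%N.

Let ups i S := (hi i \in S) && (lo i \notin S).
Let dns i S := (lo i \in S) && (hi i \notin S).

Definition raise (v : {set 'I_m.+1} -> rat) S : rat :=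
  \sum_i (ups i S)%:R * v (swap i S).
Definition lower (v : {set 'I_m.+1} -> rat) S : rat :=
  \sum_i (c i * dns i S)%:R * v (swap i S).

Lemma in_swap i S x : (x \in swap i S) = (tperm (lo i) (hi i) x \in S).
Proof. by rewrite inE. Qed.

Lemma swapK i : involutive (swap i).
Proof. by move=> S; apply/setP=> x; rewrite !in_swap tpermK. Qed.

Lemma ups_swap i S : ups i (swap i S) = dns i S.
Proof. by rewrite /ups /dns !in_swap tpermL tpermR. Qed.

Lemma dns_swap i S : dns i (swap i S) = ups i S.
Proof. by rewrite -ups_swap swapK. Qed.

Lemma lo_eq i j : (lo i == lo j) = (i == j).
Proof. by []. Qed.

Lemma hi_eq i j : (hi i == hi j) = (i == j).
Proof. by rewrite (inj_eq lift_inj). Qed.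

(** Moves at distinct places commute; when the two places share an element, both sides are 0. *)
Lemma swap_exchange i j S (w : {set 'I_m.+1} -> rat) : i != j ->
  (ups i S && dns j (swap i S))%:R * w (swap j (swap i S)) =
  (dns j S && ups i (swap j S))%:R * w (swap i (swap j S)).
Proof.
move=> ij; have lij : lo i != lo j by rewrite lo_eq.
have hij : hi i != hi j by rewrite hi_eq.
have ji : lo j != lo i by rewrite eq_sym.
have hji : hi j != hi i by rewrite eq_sym.
have [e|n1] := eqVneq (lo j) (hi i).
  have n2 : lo i != hi j.
    have := congr1 val e; rewrite -(inj_eq val_inj) /= /bump /= !add1n => ->.
    by rewrite neq_ltn ltnS leqnSn.
  rewrite /ups /dns !in_swap -e tpermR tpermL.
  by case: (lo i \in S); case: (lo j \in S); case: (hi j \in S);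
     rewrite /= ?andbF ?mulr0n ?mul0r.
have [e|n2] := eqVneq (lo i) (hi j).
  rewrite /ups /dns !in_swap e tpermL.
  rewrite -e tpermR.
  by case: (hi j \in S); case: (hi i \in S); case: (lo j \in S);
     rewrite /= ?andbF ?mulr0n ?mul0r.
have t1 : tperm (lo i) (hi i) (lo j) = lo j by rewrite tpermD // eq_sym.
have t2 : tperm (lo i) (hi i) (hi j) = hi j by rewrite tpermD // eq_sym.
have t3 : tperm (lo j) (hi j) (lo i) = lo i by rewrite tpermD // eq_sym.
have t4 : tperm (lo j) (hi j) (hi i) = hi i by rewrite tpermD // eq_sym.
have -> : swap j (swap i S) = swap i (swap j S).
  apply/setP=> x; rewrite !in_swap; congr (_ \in S).
  by rewrite -!permM conjgC tpermJ t1 t2.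
rewrite /ups /dns !in_swap t1 t2 t3 t4.
by rewrite andbC.
Qed.

(** Summation by parts: an element x of S gets the coefficient x (m + 1 - x) - (x + 1) (m - x) = 2x
    - m. *)
Lemma sum_ups_dns S :
  \sum_i (c i)%:R * ((ups i S)%:R - (dns i S)%:R) =
  \sum_(x in S) ((2 * x)%:R - m%:R) :> rat.
Proof.
transitivity (\sum_i (c i * (hi i \in S))%:R - \sum_i (c i * (lo i \in S))%:R : rat).
  rewrite -sumrB; apply: eq_bigr => i _; rewrite !natrM -mulrBr; congr (_ * _).
  by rewrite /ups /dns; case: (_ \in S); case: (_ \in S).
have -> : \sum_i (c i * (hi i \in S))%:R =
    \sum_(x < m.+1) (x * (m.+1 - x) * (x \in S))%:R :> rat.
  by rewrite [RHS]big_ord_recl /= !mul0n add0r.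
have -> : \sum_i (c i * (lo i \in S))%:R =
    \sum_(x < m.+1) (x.+1 * (m - x) * (x \in S))%:R :> rat.
  by rewrite [RHS]big_ord_recr /= subnn muln0 mul0n addr0.
rewrite -sumrB [RHS]big_mkcond /=; apply: eq_bigr => x _.
case: (x \in S); rewrite ?muln0 ?subrr // !muln1.
have /subnKC : (x <= m)%N by rewrite -ltnS ltn_ord.
move: (nat_of_ord x) (m - x)%N => a b <-.
by rewrite -addnS addKn !natrM !natrD -natr1; ring.
Qed.

Lemma raise_lower v S : raise (lower v) S - lower (raise v) S =
  (\sum_(x in S) ((2 * x)%:R - m%:R)) * v S.
Proof.
rewrite -sum_ups_dns /raise /lower mulr_suml.
pose T1 i j := (c j)%:R * ((ups i S && dns j (swap i S))%:R * v (swap j (swap i S))).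
pose T2 i j := (c j)%:R * ((dns j S && ups i (swap j S))%:R * v (swap i (swap j S))).
transitivity (\sum_i \sum_j T1 i j - \sum_i \sum_j T2 i j).
  congr (_ - _).
    apply: eq_bigr => i _; rewrite mulr_sumr; apply: eq_bigr => j _.
    by rewrite /T1 -mulnb !natrM; ring.
  rewrite [RHS]exchange_big; apply: eq_bigr => j _ /=; rewrite mulr_sumr.
  by apply: eq_bigr => i _; rewrite /T2 -mulnb !natrM; ring.
rewrite -sumrB; apply: eq_bigr => i _.
rewrite (bigD1 i) //= [X in _ - X](bigD1 i) //= opprD addrACA -sumrB.
rewrite [X in _ + X]big1 => [|j ji]; last first.
  by rewrite /T1 /T2 swap_exchange ?subrr // eq_sym.
by rewrite addr0 /T1 /T2 dns_swap ups_swap swapK !andbb; ring.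
Qed.

(** Weights that make [raise] adjoint to [lower]: they grow by the factor [c i] when an element
    moves from i to i + 1. *)
Definition wt (x : nat) : nat := \prod_(i < m | (i < x)%N) c i.
Definition weight S : rat := \prod_(x in S) (wt x)%:R.

Lemma weight_gt0 S : 0 < weight S.
Proof.
apply: prodr_gt0 => x _; rewrite ltr0n; apply: prodn_cond_gt0 => i _.
by rewrite /c muln_gt0 subn_gt0 ltn_ord.
Qed.

Lemma weight_swap i S : dns i S -> weight (swap i S) = (c i)%:R * weight S.
Proof.
case/andP=> loS hiS; rewrite /weight (big_setD1 (lo i) loS) /=.
have hi_sw : hi i \in swap i S by rewrite in_swap tpermR.
rewrite (big_setD1 (hi i) hi_sw) /= mulrA; congr (_ * _).
  rewrite -natrM; congr (_%:R); rewrite /wt (bigD1 i) //=; congr (_ * _)%N.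
  apply: eq_bigl => j; rewrite /bump /= add1n ltnS ltn_neqAle andbC.
  by rewrite -(inj_eq val_inj).
apply: eq_bigl => x; rewrite !inE.
have [->|xl] := eqVneq x (lo i).
  by rewrite tpermL (negbTE hiS) andbF.
have [->|xh] := eqVneq x (hi i); first by rewrite (negbTE hiS).
by rewrite tpermD // eq_sym.
Qed.

Lemma adjoint v u : \sum_S weight S * (raise v S * u S) =
  \sum_S weight S * (v S * lower u S).
Proof.
transitivity (\sum_i \sum_S weight S * ((ups i S)%:R * v (swap i S) * u S)).
  rewrite exchange_big; apply: eq_bigr => S _ /=.
  by rewrite /raise mulr_suml mulr_sumr.
transitivity (\sum_i \sum_S weight S * (v S * ((c i * dns i S)%:R * u (swap i S)))).
  apply: eq_bigr => i _; rewrite (reindex_inj (inv_inj (swapK i))) /=.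
  apply: eq_bigr => S _; rewrite ups_swap swapK.
  case E : (dns i S); last by rewrite muln0 !mulr0n !mul0r !mulr0.
  by rewrite weight_swap // /= muln1 mulr1n; ring.
rewrite exchange_big; apply: eq_bigr => S _ /=.
by rewrite /lower !mulr_sumr.
Qed.

Definition level (N s : nat) : {set {set 'I_m.+1}} :=
  [set S : {set 'I_m.+1} | (#|S| == N) && (\sum_(x in S) x == s)%N].

(** Below the middle the commutator acts on the level as a negative scalar. If [raise v] is 0,
    pairing [raise (lower v)] with v shows that the square norm of [lower v] is this scalar times
    that of v, so both are 0. *)
Lemma raise_inj N s v : (2 * s < N * m)%N ->
    (forall S, S \notin level N s -> v S = 0) ->
  (forall S, raise v S = 0) -> forall S, v S = 0.
Proof.
move=> ltsm supp rv.
have h S : raise (lower v) S = ((2 * s)%:R - (N * m)%:R) * v S.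
  have := raise_lower v S; rewrite [X in _ - X](_ : _ = 0) ?subr0; last first.
    by rewrite /lower big1 // => i _; rewrite rv mulr0.
  move->; have [|/supp->] := boolP (S \in level N s); last by rewrite !mulr0.
  rewrite inE => /andP[/eqP cS /eqP sS]; congr (_ * _).
  by rewrite sumrB -natr_sum -big_distrr /= sS sumr_const cS -mulrnA (mulnC N).
have := adjoint (lower v) v; rewrite (eq_bigr (fun S =>
  ((2 * s)%:R - (N * m)%:R) * (weight S * (v S * v S)))); last first.
  by move=> S _; rewrite h; ring.
rewrite -mulr_sumr => e.
have neg : (2 * s)%:R - (N * m)%:R < 0 :> rat by rewrite subr_lt0 ltr_nat.
have ge0 : 0 <= \sum_S weight S * (lower v S * lower v S).
  by apply: sumr_ge0 => S _; apply: mulr_ge0; [exact/ltW/weight_gt0 | rewrite -expr2; exact: sqr_ge0].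
have pos S : 0 <= weight S * (v S * v S).
  by apply: mulr_ge0; [exact/ltW/weight_gt0 | rewrite -expr2; exact: sqr_ge0].
have /eqP : \sum_S weight S * (v S * v S) = 0.
  apply/eqP; rewrite eq_le sumr_ge0 // andbT.
  by move: ge0; rewrite -e nmulr_rge0.
rewrite psumr_eq0 // => /allP z S; have := z S (mem_index_enum _).
by rewrite !mulf_eq0 (gt_eqF (weight_gt0 S)) orbb => /eqP.
Qed.

Lemma card_swap i S : #|swap i S| = #|S|.
Proof. by rewrite card_preimset //; apply: perm_inj. Qed.

Lemma sum_swap i S : ups i S -> (\sum_(x in S) x = (\sum_(x in swap i S) x).+1)%N.
Proof.
case/andP=> hiS loS; rewrite (big_setD1 _ hiS) /=.
have lo_sw : lo i \in swap i S by rewrite in_swap tpermL.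
rewrite [in RHS](big_setD1 _ lo_sw) /= /bump /= add1n -addSn; congr (_ + _)%N.
apply: eq_bigl => x; rewrite !inE.
have [->|xl] := eqVneq x (lo i); first by rewrite (negbTE loS) andbF.
have [->|xh] := eqVneq x (hi i); first by rewrite tpermR (negbTE loS).
by rewrite tpermD // eq_sym.
Qed.

(** By [raise_inj] the matrix of [raise] between the two levels has independent rows, so it has at
    least as many columns. *)
Theorem card_level_le N s : (2 * s < N * m)%N ->
  (#|level N s| <= #|level N s.+1|)%N.
Proof.
move=> ltsm; pose A := level N s; pose B := level N s.+1.
pose e (a b : {set 'I_m.+1}) : rat := \sum_i (ups i b && (swap i b == a))%:R.
pose M := \matrix_(i < #|A|, j < #|B|) e (enum_val i) (enum_val j).
suff rf : row_free M by rewrite -(eqP rf) rank_leq_col.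
apply: inj_row_free => x xM; pose v S := \sum_i x 0 i * (enum_val i == S)%:R.
have vE S : raise v S = \sum_i x 0 i * e (enum_val i) S.
  rewrite /raise /v /e.
  under eq_bigr do rewrite mulr_sumr.
  rewrite exchange_big; apply: eq_bigr => j _ /=; rewrite mulr_sumr.
  by apply: eq_bigr => i _; rewrite -mulnb natrM [swap _ _ == _]eq_sym; ring.
have supp S : S \notin A -> v S = 0.
  move=> nS; rewrite /v big1 // => i _; case: eqP => [e1|]; rewrite ?mulr0 //.
  by rewrite -e1 enum_valP in nS.
have rv S : raise v S = 0.
  have [SB|nSB] := boolP (S \in B).
    have := congr1 (fun r : 'rV_#|B| => r 0 (enum_rank_in SB S)) xM.
    rewrite !mxE => <-; rewrite vE; apply: eq_bigr => i _.
    by rewrite mxE enum_rankK_in.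
  rewrite /raise big1 // => i _; case E : (ups i S); rewrite ?mul0r // mul1r.
  apply: supp; apply: contra nSB; rewrite !inE card_swap => /andP[-> /eqP <-].
  by rewrite (sum_swap E) eqxx.
apply/rowP=> i; rewrite mxE; have := raise_inj ltsm supp rv (enum_val i).
rewrite /v (bigD1 i) //= eqxx mulr1 big1 ?addr0 // => j ji.
by rewrite (inj_eq enum_val_inj) (negbTE ji) mulr0.
Qed.

Lemma card_level_sym N s : (s <= N * m)%N ->
  #|level N s| = #|level N (N * m - s)|.
Proof.
move=> sm; have rK : involutive (fun S : {set 'I_m.+1} => (@rev_ord m.+1) @^-1: S).
  by move=> S; apply/setP=> x; rewrite !inE rev_ordK.
rewrite -[RHS](card_preimset _ (inv_inj rK)); apply: eq_card => S; rewrite !inE.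
rewrite (card_preimset _ rev_ord_inj); case: eqP => //= cS.
have : (\sum_(x in @rev_ord m.+1 @^-1: S) x + \sum_(x in S) x = N * m)%N.
  rewrite (reindex_inj rev_ord_inj) /= addnC.
  rewrite [X in (_ + X)%N](eq_bigl (mem S)) => [|x]; last by rewrite inE rev_ordK.
  rewrite -big_split /= (eq_bigr (fun=> m)) => [|x _]; last first.
    by rewrite subSS subnKC // -ltnS ltn_ord.
  by rewrite sum_nat_const cS.
set a := (\sum_(x in S) x)%N; set b := (\sum_(x in @rev_ord m.+1 @^-1: S) x)%N.
by move=> e; apply/eqP/eqP; clearbody a b; lia.
Qed.

End SubsetSums.

(** * The cone of symmetric unimodal polynomials *)

Lemma qpolyD a b : qpoly (a + b) = qpoly a + 'X^a * qpoly b.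
Proof.
rewrite /qpoly big_split_ord /= mulr_sumr; congr (_ + _).
by apply: eq_bigr => i _; rewrite exprD.
Qed.

(** The Clebsch-Gordan rule for characters of sl2, with exponents shifted to start at 0. *)
Lemma qpoly_mul_sum a b : (a <= b)%N ->
  qpoly a * qpoly b = \sum_(t < a) 'X^t * qpoly (a + b - 1 - 2 * t).
Proof.
elim: a => [|a IH] ab; first by rewrite {1}/qpoly !big_ord0 mul0r.
have -> : qpoly a.+1 = qpoly a + 'X^a by rewrite -addn1 qpolyD [qpoly 1]big_ord1 mulr1.
rewrite mulrDl IH ?(ltnW ab) // big_ord_recr /=.
have -> : (a.+1 + b - 1 - 2 * a = b - a)%N by lia.
transitivity (\sum_(t < a) ('X^t * qpoly (a + b - 1 - 2 * t) + 'X^(a + b - 1 - t))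
   + 'X^a * qpoly (b - a)); last first.
  congr (_ + _); apply: eq_bigr => t _; have ta := ltn_ord t.
  have -> : (a.+1 + b - 1 - 2 * t = (a + b - 1 - 2 * t) + 1)%N by lia.
  rewrite qpolyD mulrDr [qpoly 1]big_ord1 mulr1; congr (_ + _).
  by rewrite -exprD; congr ('X^_); lia.
rewrite big_split /= -addrA; congr (_ + _).
have -> : \sum_(t < a) 'X^(a + b - 1 - t) = 'X^b * qpoly a.
  rewrite /qpoly mulr_sumr (reindex_inj rev_ord_inj) /=; apply: eq_bigr => t _.
  by rewrite -exprD; congr ('X^_); have := ltn_ord t; lia.
have {1}-> : b = (b - a + a)%N by lia.
by rewrite qpolyD mulrDr mulrA -exprD addrC subnKC ?(ltnW ab) // addrC.
Qed.

(* Symmetric unimodal polynomials with centre of symmetry d / 2. *)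
Inductive cone (d : nat) : {poly int} -> Prop :=
| cone0 : cone d 0
| coneD (i : nat) (u : int) p : (2 * i <= d)%N -> 0 <= u -> cone d p ->
    cone d (u *: ('X^i * qpoly (d.+1 - 2 * i)) + p).

Lemma cone_add d p q : cone d p -> cone d q -> cone d (p + q).
Proof.
move=> + cq; elim=> [|i u p' id u0 _ IH]; first by rewrite add0r.
by rewrite -addrA; apply: coneD.
Qed.

Lemma cone_scale d (u : int) p : 0 <= u -> cone d p -> cone d (u *: p).
Proof.
move=> u0; elim=> [|i v p' id v0 _ IH]; first by rewrite scaler0; apply: cone0.
by rewrite scalerDr scalerA; apply: coneD => //; rewrite mulr_ge0.
Qed.

Lemma cone_base d i : (2 * i <= d)%N -> cone d ('X^i * qpoly (d.+1 - 2 * i)).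
Proof. by move=> id; have := coneD id ler01 (cone0 d); rewrite scale1r addr0. Qed.

Lemma cone_sum d (I : Type) (r : seq I) (Q : pred I) (F : I -> {poly int}) :
  (forall i, Q i -> cone d (F i)) -> cone d (\sum_(i <- r | Q i) F i).
Proof. by move=> H; apply: big_ind => //; [apply: cone0 | apply: cone_add]. Qed.

Lemma cone_base_mul d e i j : (2 * i <= d)%N -> (2 * j <= e)%N ->
  cone (d + e) (('X^i * qpoly (d.+1 - 2 * i)) * ('X^j * qpoly (e.+1 - 2 * j))).
Proof.
wlog le : d e i j / (d.+1 - 2 * i <= e.+1 - 2 * j)%N.
  move=> H id je; case: (leqP (d.+1 - 2 * i) (e.+1 - 2 * j)) => [|/ltnW] le.
    exact: H.
  by rewrite mulrC addnC; apply: H.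
move=> id je; rewrite mulrACA -exprD qpoly_mul_sum // mulr_sumr.
apply: cone_sum => t _; have := ltn_ord t => lt; rewrite mulrA -exprD.
have -> : (d.+1 - 2 * i + (e.+1 - 2 * j) - 1 - 2 * t =
   (d + e).+1 - 2 * (i + j + t))%N by lia.
by apply: cone_base; lia.
Qed.

Lemma cone_mul d e p q : cone d p -> cone e q -> cone (d + e) (p * q).
Proof.
move=> + cq; elim=> [|i u p' id u0 _ IH]; first by rewrite mul0r; apply: cone0.
rewrite mulrDl; apply: cone_add => //; rewrite -scalerAl; apply: cone_scale => //.
elim: cq {IH} => [|j v q' je v0 _ IH]; first by rewrite mulr0; apply: cone0.
rewrite mulrDr; apply: cone_add => //; rewrite -scalerAr; apply: cone_scale => //.
exact: cone_base_mul.
Qed.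

(** Multiplied by 1 - X, a generator becomes X^j - X^(d + 1 - j), and the negative term lies beyond
    the middle. *)
Lemma cone_coef d p i : cone d p -> (2 * i <= d)%N -> 0 <= ((1 - 'X) * p)`_i.
Proof.
move=> cp id; elim: cp => [|j u p' jd u0 _ IH]; first by rewrite mulr0 coef0.
rewrite mulrDr coefD addr_ge0 // -scalerAr coefZ mulr_ge0 //.
rewrite mulrCA -opprB mulNr qpolyE opprB mulrBr mulr1 -exprD coefB !coefXn.
by case: eqP => [_|_]; case: eqP => // e; lia.
Qed.

Lemma cone_unimodal d (p : {poly int}) : (size p <= d.+1)%N ->
    (forall i, 0 <= p`_i) ->
    (forall i, (i <= d)%N -> p`_i = p`_(d - i)) ->
    (forall i, (2 * i < d)%N -> p`_i <= p`_i.+1) -> cone d p.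
Proof.
move=> sz p0 sym mono.
(* The coordinates on the generators are the increments of the coefficients up to the middle. *)
pose u i := p`_i - (if i is j.+1 then p`_j else 0).
have -> : p = \sum_(i < (d./2).+1) u i *: ('X^i * qpoly (d.+1 - 2 * i)).
  apply/polyP=> s; rewrite coef_sum.
  have qc M t : (qpoly M)`_t = (t < M)%N%:R.
    rewrite /qpoly coef_sum; case: ltnP => tM; last first.
      by rewrite big1 // => i _; rewrite coefXn gtn_eqF // (leq_trans _ tM).
    rewrite (bigD1 (Ordinal tM)) //= coefXn eqxx big1 ?addr0 // => i /negbTE.
    by rewrite -(inj_eq val_inj) /= coefXn eq_sym => ->.
  have bc i : (i < (d./2).+1)%N -> ('X^i * qpoly (d.+1 - 2 * i))`_s =
      ((i <= s) && (s <= d - i))%N%:R.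
    move=> id; rewrite coefXnM qc; case: ltnP => //= le.
    by congr (nat_of_bool _)%:R; apply/idP/idP; lia.
  have tele M : \sum_(i < M.+1) u i = p`_M.
    elim: M => [|M IH]; first by rewrite big_ord1 /u subr0.
    by rewrite big_ord_recr /= IH /u; ring.
  have [ds|sd] := ltnP d s.
    rewrite nth_default ?(leq_trans sz) // big1 // => i _.
    by rewrite coefZ bc //; case: andP => [[? ?]|]; rewrite ?mulr0 //; lia.
  have -> : p`_s = p`_(minn s (d - s)).
    by rewrite /minn; case: ifP => // _; apply: sym.
  rewrite -tele (big_ord_widen (d./2).+1 u); last first.
    by rewrite ltnS; lia.
  rewrite big_mkcond; apply: eq_bigr => i _ /=; rewrite coefZ bc //.
  have -> : ((i <= s) && (s <= d - i))%N = (i < (minn s (d - s)).+1)%N.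
    rewrite ltnS leq_min; have := ltn_ord i; move: (nat_of_ord i) => t td.
    by case: (t <= s)%N => //=; lia.
  by case: ifP; rewrite ?mulr1 ?mulr0.
apply: cone_sum => i _; apply: cone_scale; last by apply: cone_base; have := ltn_ord i; lia.
rewrite /u; case: (nat_of_ord i) (ltn_ord i) => [|j] jd; first by rewrite subr0.
by rewrite subr_ge0 mono //; lia.
Qed.

(** * Gaussian binomials and multinomials *)

Definition gsub M N : {poly int} :=
  \sum_(S : {set 'I_M} | #|S| == N) 'X^(\sum_(x in S) x).

Lemma gsub_coef m N s : (gsub m.+1 N)`_s = #|level m N s|%:R.
Proof.
rewrite /gsub coef_sum -sum1_card natr_sum.
rewrite (eq_bigr (fun S : {set 'I_m.+1} =>
    if (\sum_(x in S) x == s)%N then 1 else 0)); last first.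
  by move=> S _; rewrite coefXn eq_sym; case: eqP.
by rewrite -big_mkcondr; apply: eq_bigl => S; rewrite inE.
Qed.

Lemma cone_gsub m N : cone (N * m) (gsub m.+1 N).
Proof.
apply: cone_unimodal.
- apply/leq_sizeP=> j lj; rewrite gsub_coef; suff -> : level m N j = set0.
    by rewrite cards0.
  apply/setP=> S; rewrite !inE; apply/negP=> /andP[/eqP cS /eqP sS].
  move: lj; rewrite -sS -cS -sum_nat_const ltnNge => /negP[].
  by apply: leq_sum => x _; rewrite -ltnS ltn_ord.
- by move=> i; rewrite gsub_coef ler0n.
- by move=> i ld; rewrite !gsub_coef -card_level_sym.
by move=> i ld; rewrite !gsub_coef ler_nat card_level_le.
Qed.

Lemma gsub_gen M :
  \prod_(i < M) (('X^i)%:P * 'X + 1) =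
  \sum_(S : {set 'I_M}) ('X^(\sum_(x in S) x))%:P * 'X^#|S| :> {poly {poly int}}.
Proof.
rewrite bigA_distr; apply: eq_bigr => S _.
rewrite -big_mkcond big_split /= prodr_const -rmorph_prod; congr (_%:P * _).
by rewrite (big_morph _ (exprD 'X) (expr0 _)).
Qed.

Lemma gsub_coefE M N :
  gsub M N = (\prod_(i < M) (('X^i)%:P * 'X + 1) : {poly {poly int}})`_N.
Proof.
rewrite gsub_gen coef_sum /gsub big_mkcond; apply: eq_bigr => S _.
by rewrite coefCM coefXn eq_sym; case: eqP; rewrite ?mulr1 ?mulr0.
Qed.

(** Pascal's rule, obtained by sorting the subsets of {0, .., M'} according to whether they contain
    M'. *)
Fixpoint gbin (M N : nat) : {poly int} :=
  if N is N'.+1 then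
    if M is M'.+1 then gbin M' N + 'X^(M' - N') * gbin M' N' else 0
  else 1.

Lemma gbin_small M N : (M < N)%N -> gbin M N = 0.
Proof.
elim: M N => [|M IH] [|N] //=; rewrite ltnS => MN.
by rewrite !IH ?mulr0 ?addr0 // ltnW.
Qed.

(** The exponent ['C(N, 2)] is the smallest possible sum, 0 + 1 + .. + (N - 1). *)
Lemma gsub_gbin M N : gsub M N = 'X^('C(N, 2)) * gbin M N.
Proof.
elim: M N => [|M IH] [|N]; rewrite ?gsub_coefE ?big_ord0 /=.
- by rewrite mulr1 coef1.
- by rewrite mulr0 coef1.
- rewrite big_ord_recr /= mulrDr mulr1 coefD mulrA coefMX /= add0r.
  by rewrite -gsub_coefE IH; case: (M).
rewrite big_ord_recr /= mulrDr mulr1 coefD mulrA coefMX /= coefMC -!gsub_coefE !IH.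
rewrite addrC mulrDr; congr (_ + _); rewrite mulrAC mulrA -!exprD.
have [NM|MN] := leqP N M; last by rewrite gbin_small // !mulr0.
by rewrite binS bin1; congr ('X^_ * _); lia.
Qed.

Lemma gbin_qfactp M N : (N <= M)%N ->
  gbin M N * (qfactp N * qfactp (M - N)) = qfactp M.
Proof.
elim: M N => [|M IH] [|N] //=; rewrite ?qfactp0 ?subn0 ?mul1r ?mulr1 //.
rewrite ltnS leq_eqVlt subSS => /predU1P[->|NM].
  rewrite gbin_small // add0r subnn mul1r qfactp0 mulr1 !qfactpS mulrA.
  by have := IH M (leqnn _); rewrite subnn qfactp0 mulr1 => ->.
have e1 := IH N.+1 NM; have e2 := IH N (ltnW NM).
have eM : (M - N = (M - N.+1).+1)%N by lia.
have -> : qfactp M.+1 = qfactp M * qpoly (M - N) + 'X^(M - N) * (qfactp M * qpoly N.+1).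
  rewrite qfactpS; have -> : (M.+1 = (M - N) + N.+1)%N by lia.
  by rewrite qpolyD; ring.
rewrite mulrDl; congr (_ + _).
  by rewrite eM [qfactp (M - N.+1).+1]qfactpS -e1; ring.
by rewrite -e2 [qfactp N.+1]qfactpS; ring.
Qed.

(* gsub is a power of X times a Gaussian binomial, hence the shift. *)
Definition unimodal (D : nat) (p : {poly int}) : Prop :=
  exists sh, cone (D + 2 * sh) ('X^sh * p).

Lemma unimodal_mul D E p q : unimodal D p -> unimodal E q ->
  unimodal (D + E) (p * q).
Proof.
case=> a ca [b cb]; exists (a + b)%N; have := cone_mul ca cb.
by rewrite mulrACA -exprD; congr cone; lia.
Qed.

Lemma unimodal_coef D p i : unimodal D p -> (2 * i <= D)%N ->
  0 <= ((1 - 'X) * p)`_i.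
Proof.
case=> a ca iD; have := @cone_coef _ _ (i + a) ca; rewrite mulrCA coefXnM.
by rewrite ltnNge leq_addl /= addnK; apply; lia.
Qed.

Lemma unimodal1 : unimodal 0 1.
Proof.
exists 0%N; have := @cone_base 0 0 isT.
by rewrite expr0 !mul1r [qpoly _]big_ord1.
Qed.

Lemma unimodal_gbin M N : (N <= M)%N -> unimodal (N * (M - N)) (gbin M N).
Proof.
case: M => [|m] NM.
  by move: NM; rewrite leqn0 => /eqP->; apply: unimodal1.
exists 'C(N, 2); rewrite -gsub_gbin; have := cone_gsub m N; congr cone.
case: N NM => [|N] //= NM.
have -> : (2 * 'C(N.+1, 2) = N.+1 * N)%N.
  by elim: N {NM} => // N IH; rewrite binS bin1 mulnDr IH; lia.
by rewrite -mulnDr; congr (_ * _)%N; lia.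
Qed.

Lemma binD2 x y : ('C(x + y, 2) = 'C(x, 2) + 'C(y, 2) + x * y)%N.
Proof.
elim: x => [|x IH]; first by rewrite add0n mul0n addn0.
by rewrite addSn !binS !bin1 IH; lia.
Qed.

Lemma unimodal_multinomial (l : seq nat) : exists B D,
  [/\ B * \prod_(x <- l) qfactp x = qfactp (sumn l), unimodal D B &
      (D + \sum_(x <- l) 'C(x, 2) = 'C(sumn l, 2))%N].
Proof.
elim: l => [|x l [B [D [BE uB DE]]]].
  exists 1, 0%N; rewrite !big_nil mul1r qfactp0; split=> //; exact: unimodal1.
exists (gbin (x + sumn l) x * B), (x * sumn l + D)%N; rewrite !big_cons /=; split.
- rewrite -(gbin_qfactp (leq_addr (sumn l) x)) addKn -BE; ring.
- have := unimodal_gbin (leq_addr (sumn l) x); rewrite addKn => u.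
  exact: unimodal_mul.
by rewrite binD2 -DE; lia.
Qed.

(** * Low coefficients and palindromic polynomials *)

Definition nonneg_to (T : nat) (p : {poly int}) : Prop :=
  forall i, (i <= T)%N -> 0 <= p`_i.

Lemma nonneg_toM T p q : nonneg_to T p -> nonneg_to T q -> nonneg_to T (p * q).
Proof.
move=> hp hq i iT; rewrite coefM; apply: sumr_ge0 => j _.
apply: mulr_ge0; [apply: hp | apply: hq]; last by rewrite (leq_trans (leq_subr _ _)).
by rewrite (leq_trans _ iT) // -ltnS.
Qed.

Lemma nonneg_to_mulXn T a p : nonneg_to (T - a) p -> nonneg_to T ('X^a * p).
Proof.
move=> hp i iT; rewrite coefXnM; case: ltnP => // ai; apply: hp.
exact: leq_sub2r.
Qed.

Lemma nonneg_to_geom T M t : nonneg_to T (\sum_(j < t) 'X^(M * j)).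
Proof.
move=> i _; rewrite coef_sum; apply: sumr_ge0 => j _.
by rewrite coefXn ler0n.
Qed.

Lemma geom_sum M t : (1 - 'X^M) * (\sum_(j < t) 'X^(M * j)) = 1 - 'X^(M * t) :> {poly int}.
Proof.
rewrite (eq_bigr (fun j : 'I_t => 'X^M ^+ j)) => [|j _]; last by rewrite exprM.
by rewrite exprM -[RHS]opprB subrX1 -mulNr opprB.
Qed.

(* Truncated power series division: the numerators keep nonnegative low
   coefficients when divided by 1 - X^a, and the products below recover p. *)
Lemma nonneg_to_divide T a b n p u v : (0 < a)%N -> (0 < b)%N ->
    p * ((1 - 'X^a) * (1 - 'X^b)) =
      (1 - 'X^b) * u + 'X^n * ((1 - 'X^a) * v) ->
    nonneg_to T u -> nonneg_to (T - n) v -> nonneg_to T p.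
Proof.
move=> a0 b0 pE hu hv i iT.
pose ga : {poly int} := \sum_(j < T.+1) 'X^(a * j).
pose gb : {poly int} := \sum_(j < T.+1) 'X^(b * j).
have trunc M (q : {poly int}) l : (0 < M)%N -> (l <= T)%N ->
    (q * (1 - 'X^(M * T.+1)))`_l = q`_l.
  move=> M0 lT; rewrite mulrBr mulr1 coefB coefMXn.
  by rewrite (_ : (l < _)%N) ?subr0 //; nia.
have e : p * (1 - 'X^(a * T.+1)) * (1 - 'X^(b * T.+1)) =
    (ga * u) * (1 - 'X^(b * T.+1)) +
    ('X^n * (gb * v)) * (1 - 'X^(a * T.+1)).
  rewrite -!geom_sum -/ga -/gb.
  transitivity ((p * ((1 - 'X^a) * (1 - 'X^b))) * (ga * gb)); first by ring.
  by rewrite pE; ring.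
have := congr1 (fun q : {poly int} => q`_i) e; rewrite coefD !trunc // => ->.
rewrite addr_ge0 //.
  by apply: nonneg_toM iT => //; apply: nonneg_to_geom.
apply: nonneg_to_mulXn iT; apply: nonneg_toM => //; exact: nonneg_to_geom.
Qed.

Lemma poly_sum_coef M (p : {poly int}) : (size p <= M)%N ->
  p = \sum_(i < M) p`_i *: 'X^i.
Proof.
move=> sp; rewrite -poly_def; apply/polyP=> i; rewrite coef_poly.
by case: ltnP => // le; rewrite nth_default // (leq_trans sp).
Qed.

Definition revp (D : nat) (p : {poly int}) : {poly int} :=
  \sum_(i < D.+1) p`_i *: 'X^(D - i).

Lemma revp_coef D p i : (i <= D)%N -> (revp D p)`_i = p`_(D - i).
Proof.
move=> iD; have ltD : (D - i < D.+1)%N by rewrite ltnS leq_subr.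
rewrite /revp coef_sum (bigD1 (Ordinal ltD)) //= big1 ?addr0.
  by rewrite coefZ coefXn subKn // eqxx mulr1.
move=> j /negP nj; rewrite coefZ coefXn; case: eqP => [e|]; rewrite ?mulr0 //.
by case: nj; apply/eqP/val_inj => /=; have := ltn_ord j; lia.
Qed.

Lemma revpD D p q : revp D (p + q) = revp D p + revp D q.
Proof. by rewrite -big_split; apply: eq_bigr => i _; rewrite coefD scalerDl. Qed.

Lemma revpZ D (u : int) p : revp D (u *: p) = u *: revp D p.
Proof. by rewrite scaler_sumr; apply: eq_bigr => i _; rewrite coefZ scalerA. Qed.

Lemma revp_sum D (I : Type) (r : seq I) (F : I -> {poly int}) :
  revp D (\sum_(i <- r) F i) = \sum_(i <- r) revp D (F i).
Proof.
apply: (big_morph _ (revpD D)).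
by rewrite /revp big1 // => i _; rewrite coef0 scale0r.
Qed.

Lemma revpXn D l : (l <= D)%N -> revp D 'X^l = 'X^(D - l).
Proof.
move=> lD; rewrite /revp (bigD1 (Ordinal (lD : l < D.+1)%N)) //= coefXn eqxx.
rewrite scale1r big1 ?addr0 // => j /negbTE.
by rewrite -(inj_eq val_inj) coefXn /= => ->; rewrite scale0r.
Qed.

Lemma revpM D E (p q : {poly int}) : (size p <= D.+1)%N -> (size q <= E.+1)%N ->
  revp (D + E) (p * q) = revp D p * revp E q.
Proof.
move=> sp sq; rewrite {1}(poly_sum_coef sp) {1}(poly_sum_coef sq).
rewrite !mulr_suml revp_sum; apply: eq_bigr => i _.
rewrite !mulr_sumr revp_sum; apply: eq_bigr => j _.
rewrite -!scalerAl -!scalerAr !scalerA revpZ -exprD revpXn; last first.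
  by rewrite leq_add // -ltnS.
rewrite -exprD; congr (_ *: 'X^_); have := ltn_ord i; have := ltn_ord j; lia.
Qed.

Definition palindromic (D : nat) (p : {poly int}) : Prop := size p = D.+1 /\ revp D p = p.

Lemma palindromicM D E p q : palindromic D p -> palindromic E q ->
  palindromic (D + E) (p * q).
Proof.
move=> [sp rp] [sq rq]; split; last by rewrite revpM ?sp ?sq // rp rq.
rewrite size_mul -?size_poly_eq0 ?sp ?sq //; lia.
Qed.

Lemma palindromic1 : palindromic 0 1.
Proof. by split; rewrite ?size_poly1 // /revp big_ord1 coef1 scale1r. Qed.

Lemma palindromic_qpoly M : palindromic M (qpoly M.+1).
Proof.
split; first by rewrite size_qpoly.
rewrite /qpoly revp_sum [RHS](reindex_inj rev_ord_inj) /=; apply: eq_bigr => i _.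
by rewrite revpXn ?subSS // -ltnS ltn_ord.
Qed.

Lemma palindromic_qfactp M : palindromic 'C(M, 2) (qfactp M).
Proof.
elim: M => [|M IH]; first by rewrite qfactp0; apply: palindromic1.
by rewrite qfactpS binS bin1; apply: palindromicM => //; apply: palindromic_qpoly.
Qed.

Lemma palindromic_prod (l : seq nat) :
  palindromic (\sum_(x <- l) 'C(x, 2)) (\prod_(x <- l) qfactp x).
Proof.
elim: l => [|x l IH]; first by rewrite !big_nil; apply: palindromic1.
by rewrite !big_cons; apply: palindromicM => //; apply: palindromic_qfactp.
Qed.

Lemma palindromic_quotient D E p r : palindromic E r ->
  palindromic (D + E) (p * r) -> palindromic D p.
Proof.
move=> [sr rr] [spr rpr]; have r0 : r != 0 by rewrite -size_poly_eq0 sr.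
have p0 : p != 0 by apply/eqP=> p0; rewrite p0 mul0r size_poly0 in spr.
have sp : size p = D.+1.
  have : (0 < size p)%N by rewrite size_poly_gt0.
  move: spr; rewrite (size_mul p0 r0) sr addnS /= => e _.
  by apply: (@addIn E); rewrite e addSn.
by split=> //; apply: (mulIf r0); rewrite -[in LHS]rr -revpM ?sp ?sr.
Qed.

(** A coefficient of index i above T equals the one of index D - i, which is at most T. *)
Lemma palindromic_nonneg D p T : palindromic D p -> (D <= (2 * T).+1)%N ->
  nonneg_to T p -> forall i, 0 <= p`_i.
Proof.
move=> [sp rp] DT hp i; have [iD|Di] := leqP i D; last first.
  by rewrite nth_default // sp.
have [iT|Ti] := leqP i T; first exact: hp.
by rewrite -rp revp_coef //; apply: hp; lia.
Qed.

Lemma one_subXn M : 1 - 'X^M = (1 - 'X) * qpoly M.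
Proof. by rewrite -opprB -qpolyE -mulNr opprB. Qed.

Theorem sieving_poly_nonneg (d : nat -> nat) (N n : nat)
    (d_sum : (\sum_(1 <= i < N.+1) d i)%N = n.+1)
    (d_deg : (\sum_(1 <= i < N.+1) i * d i)%N = (2 * n)%N)
    (n_ge2 : (2 <= n)%N) i :
  0 <= (sieving_poly d N n)`_i.
Proof.
have PE := sieving_polyE d_sum d_deg n_ge2; move: PE; set P := sieving_poly d N n => PE.
have d1n := d1_le d_sum d_deg n_ge2.
have N1 : (1 < N.+1)%N by rewrite ltnS (N_gt0 d_sum).
(* Leaves are set apart; [K] below is the number of internal nodes. *)
pose l := [seq d i | i <- index_iota 2 N.+1].
pose K := (n.+1 - d 1)%N.
have sl : sumn l = K.
  by rewrite sumnE big_map /K -d_sum (big_ltn N1) addKn.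
have RE : \prod_(1 <= i < N.+1) qfactp (d i) = qfactp (d 1%N) * \prod_(x <- l) qfactp x.
  by rewrite (big_ltn N1) big_map.
have [B [D [BE uB DE]]] := unimodal_multinomial l.
rewrite RE in PE; rewrite sl in BE DE.
set R := \prod_(x <- l) qfactp x in PE BE.
have R0 : qfactp (d 1%N) * R != 0.
  rewrite mulf_neq0 ?qfactp_neq0 // /R big_seq.
  by apply: (big_ind (fun p => p != 0)) => [|p q p0 q0|x _]; rewrite ?oner_neq0 ?mulf_neq0 ?qfactp_neq0.
(* The q-multinomial [n+1]! / prod [d_i]!. *)
pose A := gbin n.+1 K * B.
have Kn : (K <= n.+1)%N by rewrite /K leq_subr.
have nK : (n.+1 - K = d 1)%N by rewrite /K subKn // ltnW.
have uA : unimodal (K * d 1%N + D) A.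
  by have := unimodal_gbin Kn; rewrite nK => /unimodal_mul; apply.
have AE : A * (qfactp (d 1%N) * R) = qfactp n.-1 * qpoly n * qpoly n.+1.
  have -> : qfactp n.-1 * qpoly n * qpoly n.+1 = qfactp n.+1.
    by rewrite qfactpS; case: (n) n_ge2 => // k _; rewrite qfactpS.
  by rewrite -(gbin_qfactp Kn) nK -BE /A; ring.
pose T := ((K * d 1%N + D)./2)%N.
(* [Q] is [n-1]! [K] [K-1] / prod [d_i]!, a binomial on K - 2 times the same [B]. With a single
   internal node [K-1] = 0. *)
have [Q QE nQ] : exists2 Q, Q * (qfactp (d 1%N) * R) =
    qfactp n.-1 * qpoly K * qpoly K.-1 & nonneg_to (T - n) ((1 - 'X) * Q).
  have [lt2|ge2] := ltnP K 2.
    exists 0; last by move=> j _; rewrite mulr0 coef0.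
    have -> : K.-1 = 0%N by lia.
    by rewrite mul0r [qpoly 0]big_ord0 mulr0.
  have le : (K - 2 <= n.-1)%N by lia.
  have eq1 : (n.-1 - (K - 2) = d 1)%N by lia.
  exists (gbin n.-1 (K - 2) * B).
    rewrite -(gbin_qfactp le) eq1 -!mulrA; congr (_ * _).
    have -> : qfactp (K - 2) * (qfactp (d 1%N) * (qpoly K * qpoly K.-1)) =
        qfactp (d 1%N) * qfactp K.
      have -> : K = (K - 2).+2 by lia.
      by rewrite subSS subSS subn0 !qfactpS /=; ring.
    by rewrite -BE; ring.
  have := unimodal_gbin le; rewrite eq1 => /unimodal_mul/(_ uB) uQ j jT.
  (* T - n is at most half of (K - 2) d_1 + D, because d_1 is at most n. *)
  by apply: unimodal_coef uQ _; move: jT; rewrite /T mulnBl; nia.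
have mE : (2 * n - d 1 = n + K.-1)%N by rewrite /K; lia.
have key : P * ((1 - 'X^(n.+1)) * (1 - 'X^K)) =
   (1 - 'X^K) * ((1 - 'X) * A) +
   'X^n * ((1 - 'X^(n.+1)) * ((1 - 'X) * Q)) :> {poly int}.
  apply: (mulIf R0); rewrite !one_subXn.
  transitivity ((P * (qfactp (d 1%N) * R)) *
    ((1 - 'X) * qpoly n.+1 * ((1 - 'X) * qpoly K))); first by ring.
  rewrite PE mE qpolyD.
  transitivity ((1 - 'X) * qpoly K * (1 - 'X) * (A * (qfactp (d 1%N) * R)) +
    'X^n * (1 - 'X) * qpoly n.+1 * (1 - 'X) * (Q * (qfactp (d 1%N) * R))); last by ring.
  by rewrite AE QE; ring.
have [palR palPR] : palindromic ('C(d 1%N, 2) + \sum_(x <- l) 'C(x, 2)) (qfactp (d 1%N) * R) /\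
    palindromic (2 * n - (d 1%N).+1 + 'C(n.-1, 2)) (qpoly (2 * n - d 1%N) * qfactp n.-1).
  split; apply: palindromicM; try exact: palindromic_qfactp.
    exact: palindromic_prod.
  have -> : (2 * n - d 1 = (2 * n - (d 1%N).+1).+1)%N by lia.
  exact: palindromic_qpoly.
have e2 : ('C(n.+1, 2) = 'C(n.-1, 2) + n.-1 + n)%N.
  by rewrite binS bin1 -{1}(prednK (ltnW n_ge2)) binS bin1.
have e3 : ('C(n.+1, 2) = 'C(K, 2) + 'C(d 1%N, 2) + K * d 1%N)%N.
  by rewrite -binD2; congr 'C(_, 2); rewrite /K; lia.
pose DP := (2 * n - (d 1%N).+1 + 'C(n.-1, 2) - ('C(d 1%N, 2) + \sum_(x <- l) 'C(x, 2)))%N.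
have palP : palindromic DP P.
  apply: (palindromic_quotient palR); rewrite PE subnK //.
  have := proj1 palPR; rewrite -PE => sz.
  have P0 : P != 0 by apply/eqP => P0; rewrite P0 mul0r size_poly0 in sz.
  have : (0 < size P)%N by rewrite size_poly_gt0.
  move: sz; rewrite (size_mul P0 R0) (proj1 palR); move: (size P) => z.
  move: (2 * n - (d 1).+1)%N ('C(n.-1, 2)) ('C(d 1, 2)) => a b c; lia.
(* The degree of [P] is d_1 less than that of [A], so T reaches the middle of [P]. *)
apply: (palindromic_nonneg (T := T) palP).
  by rewrite /DP /T; lia.
apply: (nonneg_to_divide _ _ key) => //; first by rewrite /K; lia.
by move=> j jT; apply: (unimodal_coef uA); rewrite /T in jT; lia.
Qed.

(** * Cyclic sieving *)

Lemma qint_tofrac M : qint qvar M = tofrac (qpoly M).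
Proof.
have X1 : 1 - qvar != 0.
  by rewrite -tofrac1 -tofracB tofrac_eq0 -oppr_eq0 opprB polyXsubC_eq0.
apply: (mulIf X1); rewrite /qint divfK // mulrC /qvar -tofracXn -tofrac1 -!tofracB -tofracM.
by congr tofrac; rewrite -[1 - 'X]opprB mulNr qpolyE opprB.
Qed.

Lemma qfact_tofrac M : qfact qvar M = tofrac (qfactp M).
Proof. by rewrite /qfact /qfactp rmorph_prod; apply: eq_bigr => i _; apply: qint_tofrac. Qed.

Lemma sieving_poly_tofrac d N n (d_sum : (\sum_(1 <= i < N.+1) d i)%N = n.+1)
    (d_deg : (\sum_(1 <= i < N.+1) i * d i)%N = (2 * n)%N) (n_ge2 : (2 <= n)%N) :
  tofrac (sieving_poly d N n) = qint qvar (2 * n - d 1%N) / (qint qvar n.+1 * qint qvar n)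
                   * qmultinomial qvar n.+1 N d.
Proof.
have PE : tofrac (sieving_poly d N n) * \prod_(1 <= i < N.+1) tofrac (qfactp (d i)) =
    tofrac (qpoly (2 * n - d 1%N)) * tofrac (qfactp n.-1) :> {fraction {poly int}}.
  rewrite -(rmorph_prod (@tofrac _) (index_iota 1 N.+1) xpredT (fun i => qfactp (d i))).
  by rewrite -!tofracM sieving_polyE.
have n0 : (n = n.-1.+1)%N by rewrite prednK ?(ltnW n_ge2).
have nz M : (0 < M)%N -> tofrac (qpoly M) != 0 :> {fraction {poly int}}.
  by rewrite tofrac_eq0 -size_poly_eq0 size_qpoly -lt0n.
have -> : qmultinomial qvar n.+1 N d = tofrac (qfactp n.-1) * tofrac (qpoly n) *
    tofrac (qpoly n.+1) / \prod_(1 <= i < N.+1) qfact qvar (d i).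
  by rewrite -!tofracM {3}n0 -qfactpS -n0 -qfactpS -qfact_tofrac.
rewrite !qint_tofrac.
rewrite (eq_bigr (fun i => tofrac (qfactp (d i)))) => [|i _]; last exact: qfact_tofrac.
set B := \prod_(_ <= _ < _) _ in PE *.
have B0 : B != 0.
  rewrite prodf_seq_neq0; apply/allP => i _ /=; rewrite tofrac_eq0.
  exact: qfactp_neq0.
apply: (mulIf B0); rewrite PE.
have := nz n.+1 isT; have := nz n (ltnW n_ge2).
move: (tofrac (qpoly n)) (tofrac (qpoly n.+1)) (tofrac (qpoly (2 * n - d 1%N))).
move: (tofrac (qfactp n.-1)) => w u v a u0 v0.
rewrite -[RHS]mulrA (divfK B0) -[w * u * v]mulrA [u * v]mulrC.
by rewrite [w * (v * u)]mulrC [RHS]mulrA (divfK (mulf_neq0 v0 u0)).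
Qed.

(** Multiplication of exponents by #[g] - 1 acts as a change of sign both in the group and on the
    root of unity. *)
Lemma expgz_nat (C : numClosedFieldType) (gT : finGroupType) (g : gT) (w : C) (e : int) :
  #[g]%g.-primitive_root w -> exists e' : nat, expgz g e = (g ^+ e')%g /\ w ^ e = w ^+ e'.
Proof.
case: e => e wg; first by exists e.
exists (#[g]%g.-1 * e.+1)%N; rewrite expgM exprM -invg_expg expgVn; split=> //.
suff -> : w ^+ #[g]%g.-1 = w^-1 by rewrite exprVn.
have w0 : w != 0 by apply: contraTneq (prim_order_gt0 wg) => w0; have := prim_expr_order wg;
  rewrite w0 expr0n; case: #[g]%g => //= ? /esym/eqP; rewrite oner_eq0.
apply: (mulfI w0); rewrite mulfV // -exprS prednK ?order_gt0 //.
by rewrite prim_expr_order.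
Qed.

Lemma sum_degrees d N n (d_tree : \sum_(1 <= i < N.+1) (i%:Z - 2) * (d i)%:Z = - 2)
    (d_sum : (\sum_(1 <= i < N.+1) d i)%N = n.+1) :
  (\sum_(1 <= i < N.+1) i * d i)%N = (2 * n)%N.
Proof.
have e1 : \sum_(1 <= i < N.+1) (i%:Z - 2) * (d i)%:Z =
    ((\sum_(1 <= i < N.+1) i * d i)%N)%:Z - 2 * ((\sum_(1 <= i < N.+1) d i)%N)%:Z.
  elim/big_ind3: _ => //= [x1 y1 z1 x2 y2 z2 -> ->|i _]; last by rewrite PoszM; ring.
  by rewrite !PoszD; ring.
by move: e1; rewrite d_tree d_sum; lia.
Qed.

Section Rotation.

Variables (D : finType) (d : nat -> nat) (N n : nat).
Hypothesis dN : forall i, (N < i)%N -> d i = 0%N.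
Hypothesis d_sum : (\sum_(1 <= i < N.+1) d i)%N = n.+1.
Hypothesis cD : #|D| = (2 * n)%N.
Notation S := (tree_classes D d).
Notation rot := (@internal_rotation D).

(* The rotation is bijective on tree classes only; the action of the group is
   trivial on all other sets. *)
Definition rotation_fun (X : {set rooted_map D}) := if X \in S then rot X else X.

Lemma rotation_fun_stable X : (rotation_fun X \in S) = (X \in S).
Proof. by rewrite /rotation_fun; case: ifP => // XS; apply: (rotation_tree dN d_sum cD). Qed.

Lemma iter_rotation_fun e X : X \in S -> iter e rotation_fun X = iter e rot X.
Proof.
move=> XS; elim: e => //= e <-; rewrite /rotation_fun.
suff -> : iter e rotation_fun X \in S by [].
by elim: e => //= e IH; rewrite rotation_fun_stable.
Qed.

Hypothesis m_gt0 : (0 < nb_internal D d)%N.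

Lemma rotation_fun_period X : iter (nb_internal D d) rotation_fun X = X.
Proof.
have [XS|XS] := boolP (X \in S).
  by rewrite iter_rotation_fun // (rotation_period dN d_sum cD XS).
by elim: (nb_internal D d) => //= q ->; rewrite /rotation_fun (negbTE XS).
Qed.

Lemma rotation_fun_inj : injective rotation_fun.
Proof.
apply: (can_inj (g := iter (nb_internal D d).-1 rotation_fun)) => X.
by rewrite -iterSr prednK // rotation_fun_period.
Qed.

Definition rotation_perm : {perm {set rooted_map D}} := perm rotation_fun_inj.

Lemma rotation_permX e X : X \in S -> (rotation_perm ^+ e)%g X = iter e rot X.
Proof.
move=> XS; rewrite -iter_rotation_fun // permX.
by elim: e => //= e ->; rewrite permE.
Qed.

Lemma rotation_perm_order : (#[rotation_perm]%g %| nb_internal D d)%N.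
Proof.
rewrite order_dvdn; apply/eqP/permP=> X; rewrite permX perm1 -[RHS]rotation_fun_period.
by elim: (nb_internal D d) => //= q ->; rewrite permE.
Qed.

End Rotation.

Theorem theorem22 (C : numClosedFieldType) (d : nat -> nat) (N n : nat)
    (dN : forall i, (N < i)%N -> d i = 0%N)
    (d_tree : \sum_(1 <= i < N.+1) (i%:Z - 2) * (d i)%:Z = - 2)
    (d_sum : (\sum_(1 <= i < N.+1) d i)%N = n.+1)
    (n_ge2 : (2 <= n)%N)
    (gT : finGroupType) (G : {group gT}) (g : gT)
    (cardG : #|G| = (2 * n - d 1%N)%N)
    (genG : generator G g) :
  exists (to : action G {set rooted_map 'I_(2 * n)}) (P : {poly int}),
    [/\ {in Ti n d, forall X, to X g = internal_rotation X},
        tofrac P = qint qvar (2 * n - d 1%N)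
                   / (qint qvar n.+1 * qint qvar n)
                   * qmultinomial qvar n.+1 N d
      & cyclic_sieving C g to (Ti n d) P].
Proof.
have d_deg := sum_degrees d_tree d_sum.
set D := 'I_(2 * n); have cD : #|D| = (2 * n)%N by rewrite card_ord.
have mE : nb_internal D d = (2 * n - d 1%N)%N by rewrite /nb_internal cD.
have m0 : (0 < nb_internal D d)%N by rewrite mE; have := d1_le d_sum d_deg n_ge2; lia.
have eG : G = <[g]>%G by apply/val_inj/eqP.
subst G; have og : #[g]%g = nb_internal D d by rewrite mE -cardG.
have dv := rotation_perm_order dN d_sum cD m0; rewrite -og in dv.
set p := rotation_perm dN d_sum cD m0 in dv.
(* The order of [p] divides that of [g], so sending g to p defines a morphism on the cyclic group;
   the action may fail to be faithful. *)
pose to := morph_action [morphism of eltm dv].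
have toE e X : to X (g ^+ e)%g = (p ^+ e)%g X by rewrite /to mactE /= eltmE.
have toS e X : X \in Ti n d -> to X (g ^+ e)%g = iter e (@internal_rotation D) X.
  by move=> XS; rewrite toE rotation_permX.
exists to, (sieving_poly d N n); split=> [X XS||].
- by rewrite -[X in to _ X]expg1 toS.
- exact: sieving_poly_tofrac.
split=> //.
- apply/subsetP=> h /cycleP[e ->]; rewrite !inE mem_cycle /=; apply/subsetP=> X XS.
  rewrite inE toS //; elim: e => //= e IH; exact: (rotation_tree dN d_sum cD).
- by move=> i; apply: sieving_poly_nonneg.
move=> w e; rewrite cardG -mE => wm.
have [e' [-> ->]] : exists e' : nat, expgz g e = (g ^+ e')%g /\ w ^ e = w ^+ e'.
  by apply: expgz_nat; rewrite og.
(* [w ^+ e'] is a primitive root of order m / gcd(m, e'), the order of the automorphism that a fixed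
   tree must have. *)
have zk := exp_prim_root wm e'; rewrite gcdnC in zk.
rewrite -[RHS](card_fixed_evalz dN d_sum d_deg n_ge2 cD zk); congr (_%:R).
apply: eq_card => X; rewrite in_setI [RHS]inE; apply: andb_id2l => XS.
by apply/afix1P/eqP; rewrite toS.
Qed.
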